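(* Let $V\subset\mathbb{R}^8=\mathbb{C}^4$ be a $4$-plane (a real $4$-dimensional linear subspace). Suppose that $V\cap S^7$ is associative in the squashed sphere $(S^7,\tilde\varphi,\tilde g)$. Then, up to the ${\rm Sp}(1){\rm Sp}(2)$-action, $V$ is either $$V_1=\{(z_1,z_2,0,0)\in\mathbb{C}^4;\ z_1,z_2\in\mathbb{C}\}\quad\text{or}\quad V_2=\{(z_1,0,z_3,0)\in\mathbb{C}^4;\ z_1,z_3\in\mathbb{C}\}.$$ In other words, the space $\mathcal{M}$ of $4$-planes whose intersections with $S^7$ are associative is described as $$\mathcal{M}={\rm Sp}(1){\rm Sp}(2)/K_1\ \sqcup\ {\rm Sp}(1){\rm Sp}(2)/K_2,$$ where $K_1={\rm Sp}(1)({\rm Sp}(1)\times{\rm Sp}(1))$ and $K_2={\rm U}(1){\rm U}(2)$.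
   Context: Group action. Identify $\mathbb{C}^4$ with $\mathbb{H}^2$ by $(z_1,z_2,z_3,z_4)\mapsto(z_1+z_2j,\,z_3+z_4j)$. Let $J=\begin{pmatrix}J'&0\\0&J'\end{pmatrix}$, $J'=\begin{pmatrix}0&-1\\1&0\end{pmatrix}$. The group ${\rm Sp}(1)$ of unit quaternions acts on $\mathbb{C}^4$ by $(a_1+a_2j)\cdot u=a_1u+a_2J\overline{u}$ ($a_1,a_2\in\mathbb{C}$), i.e. by left multiplication on $\mathbb{H}^2$; ${\rm Sp}(2)=\{g\in{\rm U}(4);\ {}^tgJg=J\}$ acts linearly on $\mathbb{C}^4$. (As quaternionic matrices, $A\in {\rm Sp}(2)$ acts on row vectors by $(q_1,q_2)\mapsto(q_1,q_2)\,{}^t\overline{A}$.) These actions commute and define an action of ${\rm Sp}(1){\rm Sp}(2)={\rm Sp}(1)\times{\rm Sp}(2)/\{\pm(1,1)\}$ on $\mathbb{C}^4$ and on $S^7$. For subgroups $G_1\subset{\rm Sp}(1)$, $G_2\subset{\rm Sp}(2)$, $G_1G_2$ denotes the image of $G_1\times G_2$ in ${\rm Sp}(1){\rm Sp}(2)$. In $K_1$, ${\rm Sp}(1)\times{\rm Sp}(1)\subset{\rm Sp}(2)$ is the group of diagonal quaternionic matrices; in $K_2$, ${\rm U}(1)\subset{\rm Sp}(1)$ is the group of unit complex numbers and ${\rm U}(2)\subset{\rm Sp}(2)$ is the group of quaternionic matrices with complex entries. The squashed $S^7$. Let $I_1,I_2,I_3$ be the complex structures on $\mathbb{C}^4$ given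 by the actions of $i,j,k\in{\rm Sp}(1)$, $g$ the standard round metric on $S^7\subset\mathbb{C}^4$, $(\xi_i)_z=-I_i(z)$ and $\eta_i=g(\xi_i,\cdot)$ for $i=1,2,3$. Let $\mathcal{V}={\rm span}\{\xi_1,\xi_2,\xi_3\}\subset TS^7$ (tangent to the fibers of the Hopf fibration $\pi:S^7\to S^4=\mathbb{H}P^1$), $\mathcal{H}$ its $g$-orthogonal complement and $\top:TS^7\to\mathcal{H}$ the projection. Put $\omega_i=\frac12 d\eta_i((\cdot)^\top,(\cdot)^\top)$. Define the metric $\tilde g$ by $\tilde g|_{\mathcal{V}\times\mathcal{V}}=(3/5)^2g|_{\mathcal{V}\times\mathcal{V}}$, $\tilde g|_{\mathcal{H}\times\mathcal{H}}=(3/\sqrt5)^2g|_{\mathcal{H}\times\mathcal{H}}$, $\tilde g|_{\mathcal{H}\times\mathcal{V}}=0$, and the $3$-form $\tilde\varphi=\frac{27}{25}\left(\frac15\eta_1\wedge\eta_2\wedge\eta_3+\sum_{i=1}^3\eta_i\wedge\omega_i\right)$. Then $\tilde\varphi$ is a nearly parallel $G_2$-structure with induced metric $\tilde g$, and $(S^7,\tilde\varphi,\tilde g)$ is called the squashed $S^7$. Its automorphism group is ${\rm Sp}(1){\rm Sp}(2)$. A $3$-dimensional submanifold $A\subset S^7$ is called associative (in the squashed $S^7$) if, for a suitable orientation, $\tilde\varphi|_{TA}={\rm vol}_A$, where ${\rm vol}_A$ is the volume form of $\tilde g|_A$.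
   Formalization: Complex conjugation lies in Sp(1)Sp(2) and fixes V2 but is not in K2, so M is not Sp(1)Sp(2)/K1 ⊔ Sp(1)Sp(2)/K2 equivariantly. Proved instead: stabilizers K1 of V1 and K2 ∪ conj·K2 of V2, and a bijection of sets, canonical on the K1 part, sending the K2 part onto the orbit of V2. *)

(* Defs.v *)
From HB Require Import structures.
From mathcomp Require Import all_boot all_order all_algebra.
From mathcomp Require Import generic_quotient complex ring.
From mathcomp Require Import all_classical all_reals all_analysis.

Set Implicit Arguments.
Unset Strict Implicit.
Unset Printing Implicit Defensive.
Import Order.TTheory GRing.Theory Num.Theory.
Import numFieldNormedType.Exports.

Local Open Scope classical_set_scope.
Local Open Scope ring_scope.
Local Open Scope complex_scope.
Local Open Scope quotient_scope.

(* The pair (a, b) stands for the quaternion a + b j.  Addition of quaternions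
   is the addition of pairs; their product is qmul, not the componentwise one. *)
Notation quat R := (R[i] * R[i])%type.

#[local] Arguments conjc : simpl never.

Lemma conjcN1 (R : realType) : conjc (-1 : R[i]) = -1.
Proof. by rewrite rmorphN /= conjc1. Qed.

Section Quaternions.
Variable R : realType.
Implicit Types p q : quat R.

(* j z = conjc z j for z complex, and j ^ 2 = -1 *)
Definition qmul p q : quat R :=
  (p.1 * q.1 - p.2 * conjc q.2, p.1 * q.2 + p.2 * conjc q.1).

Definition qconj q : quat R := (conjc q.1, - q.2).

Definition qnorm2 q : R[i] := q.1 * conjc q.1 + q.2 * conjc q.2.

Definition quat_i : quat R := ('i, 0).
Definition quat_j : quat R := (0, 1).
Definition quat_k : quat R := (0, 'i).

Lemma quat_ijk : qmul quat_i quat_j = quat_k.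
Proof. by rewrite /qmul /= !(conjc0, conjc1, mulr0, mul0r, mulr1, subr0, addr0). Qed.

Lemma qmulA : associative qmul.
Proof.
move=> p q r; rewrite /qmul /=; congr (_, _);
  rewrite !(rmorphD, rmorphN, rmorphM) /= ?conjcK; ring.
Qed.

Lemma qmul1q : left_id (1, 0) qmul.
Proof. by case=> a b; rewrite /qmul /= !mul1r !mul0r subr0 addr0. Qed.

Lemma qmulq1 : right_id (1, 0) qmul.
Proof.
by case=> a b; rewrite /qmul /= conjc0 conjc1 !mulr1 !mulr0 subr0 add0r.
Qed.

Lemma qnorm2M p q : qnorm2 (qmul p q) = qnorm2 p * qnorm2 q.
Proof.
rewrite /qnorm2 /qmul /= !(rmorphD, rmorphN, rmorphM) /= ?conjcK; ring.
Qed.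

Lemma qnorm2C q : qnorm2 (qconj q) = qnorm2 q.
Proof. by rewrite /qnorm2 /qconj /= rmorphN mulrNN conjcK mulrC. Qed.

Lemma qconjK q : qmul (qconj q) q = (qnorm2 q, 0).
Proof. by rewrite /qmul /qnorm2 /=; congr (_, _); ring. Qed.

Lemma qmulKC q : qmul q (qconj q) = (qnorm2 q, 0).
Proof.
by rewrite /qmul /qnorm2 /= rmorphN conjcK; congr (_, _); ring.
Qed.

End Quaternions.

Section Sp1.
Variable R : realType.

Record Sp1 := MkSp1 { sp1val :> quat R ; _ : qnorm2 sp1val == 1 }.
HB.instance Definition _ := [isSub for sp1val].
HB.instance Definition _ := [Choice of Sp1 by <:].

Fact sp1_one_subproof : qnorm2 (1, 0) == 1 :> R[i].
Proof. by rewrite /qnorm2 /= conjc0 conjc1 mulr0 mulr1 addr0. Qed.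
Fact sp1_inv_subproof (x : Sp1) : qnorm2 (qconj x) == 1.
Proof. by rewrite qnorm2C (valP x). Qed.
Fact sp1_mul_subproof (x y : Sp1) : qnorm2 (qmul x y) == 1.
Proof. by rewrite qnorm2M (eqP (valP x)) (eqP (valP y)) mulr1. Qed.

Definition sp1_one := MkSp1 sp1_one_subproof.
Definition sp1_inv x := MkSp1 (sp1_inv_subproof x).
Definition sp1_mul x y := MkSp1 (sp1_mul_subproof x y).

Fact sp1_mulA : associative sp1_mul.
Proof. by move=> x y z; apply/val_inj/qmulA. Qed.
Fact sp1_mul1 : left_id sp1_one sp1_mul.
Proof. by move=> x; apply/val_inj/qmul1q. Qed.
Fact sp1_mulr1 : right_id sp1_one sp1_mul.
Proof. by move=> x; apply/val_inj/qmulq1. Qed.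
Fact sp1_mulV : left_inverse sp1_one sp1_inv sp1_mul.
Proof. by move=> x; apply/val_inj; rewrite /= qconjK (eqP (valP x)). Qed.
Fact sp1_mulrV : right_inverse sp1_one sp1_inv sp1_mul.
Proof. by move=> x; apply/val_inj; rewrite /= qmulKC (eqP (valP x)). Qed.

HB.instance Definition _ := isGroup.Build Sp1
  sp1_mulA sp1_mul1 sp1_mulr1 sp1_mulV sp1_mulrV.

Fact sp1_N1_subproof : qnorm2 (-1, 0) == 1 :> R[i].
Proof. by rewrite /qnorm2 /= conjc0 conjcN1 mulr0 mulrNN mulr1 addr0. Qed.
Definition sp1_N1 := MkSp1 sp1_N1_subproof.

Fact sp1_j_subproof : qnorm2 (quat_j R) == 1.
Proof. by rewrite /qnorm2 /= conjc0 conjc1 mulr0 mulr1 add0r. Qed.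
Definition sp1_j := MkSp1 sp1_j_subproof.

End Sp1.

Section Sp2.
Variable R : realType.

Definition Jprime : 'M[R[i]]_2 :=
  \matrix_(i, j) (if (i == 0) && (j == 1) then -1
                  else if (i == 1) && (j == 0) then 1 else 0).

Definition Jmx : 'M[R[i]]_4 := block_mx Jprime 0 0 Jprime.

Definition adjmx (g : 'M[R[i]]_4) : 'M[R[i]]_4 := (map_mx conjc g)^T.

Definition is_Sp2 (g : 'M[R[i]]_4) :=
  (g *m adjmx g == 1%:M) && (g^T *m Jmx *m g == Jmx).

Record Sp2 := MkSp2 { sp2val :> 'M[R[i]]_4 ; _ : is_Sp2 sp2val }.
HB.instance Definition _ := [isSub for sp2val].
HB.instance Definition _ := [Choice of Sp2 by <:].

Lemma adjmxM g h : adjmx (g *m h) = adjmx h *m adjmx g.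
Proof. by rewrite /adjmx map_mxM trmx_mul. Qed.
Lemma adjmxK : involutive adjmx.
Proof. by move=> g; apply/matrixP=> i j; rewrite !mxE conjcK. Qed.
Lemma adjmx1 : adjmx 1%:M = 1%:M.
Proof. by rewrite /adjmx map_mx1 trmx1. Qed.

Fact sp2_one_subproof : is_Sp2 1%:M.
Proof. by rewrite /is_Sp2 adjmx1 trmx1 !mul1mx mulmx1 !eqxx. Qed.
Fact sp2_mul_subproof (g h : Sp2) : is_Sp2 (g *m h).
Proof.
case: g h => [g /andP[/eqP gU /eqP gJ]] [h /andP[/eqP hU /eqP hJ]] /=.
apply/andP; split; apply/eqP.
  by rewrite adjmxM mulmxA -(mulmxA g) hU mulmx1.
by rewrite trmx_mul !mulmxA -(mulmxA _ _ g) -(mulmxA h^T) (mulmxA g^T) gJ.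
Qed.
Fact sp2_inv_subproof (g : Sp2) : is_Sp2 (adjmx g).
Proof.
case: g => [g /andP[/eqP gU /eqP gJ]] /=; have gV := mulmx1C gU.
apply/andP; split; apply/eqP; first by rewrite adjmxK.
rewrite -[in LHS]gJ !mulmxA -trmx_mul gU trmx1 mul1mx -mulmxA gU mulmx1 //.
Qed.

Definition sp2_one := MkSp2 sp2_one_subproof.
Definition sp2_inv g := MkSp2 (sp2_inv_subproof g).
Definition sp2_mul g h := MkSp2 (sp2_mul_subproof g h).

Fact sp2_mulA : associative sp2_mul.
Proof. by move=> x y z; apply/val_inj/mulmxA. Qed.
Fact sp2_mul1 : left_id sp2_one sp2_mul.
Proof. by move=> x; apply/val_inj/mul1mx. Qed.
Fact sp2_mulr1 : right_id sp2_one sp2_mul.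
Proof. by move=> x; apply/val_inj/mulmx1. Qed.
Fact sp2_mulrV : right_inverse sp2_one sp2_inv sp2_mul.
Proof. by move=> x; apply/val_inj; case: x => g /= /andP[/eqP]. Qed.
Fact sp2_mulV : left_inverse sp2_one sp2_inv sp2_mul.
Proof. by move=> x; apply/val_inj; case: x => g /= /andP[/eqP/mulmx1C]. Qed.

HB.instance Definition _ := isGroup.Build Sp2
  sp2_mulA sp2_mul1 sp2_mulr1 sp2_mulV sp2_mulrV.

Lemma adjmxN g : adjmx (- g) = - adjmx g.
Proof. by rewrite /adjmx map_mxN linearN. Qed.

Fact sp2_N_subproof (g : Sp2) : is_Sp2 (- sp2val g).
Proof.
case: g => [g gP]; have /andP[gU gJ] := gP.
rewrite /is_Sp2 /= adjmxN mulNmx mulmxN opprK gU.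
have -> : (- g)^T = - g^T by apply/matrixP=> i j; rewrite !mxE.
by rewrite !mulNmx mulmxN opprK.
Qed.
Definition sp2_N1 := MkSp2 (sp2_N_subproof sp2_one).

Lemma adjJ : adjmx Jmx = Jmx^T.
Proof.
have C' : map_mx conjc Jprime = Jprime.
  apply/matrixP=> i j; rewrite !mxE.
  by case: ifP => _; [rewrite conjcN1|case: ifP => _; rewrite ?conjc1 ?conjc0].
have E := map_block_mx (@conjc R) Jprime 0 0 Jprime.
rewrite C' map_mx0 in E.
by rewrite /adjmx; congr trmx; exact: E.
Qed.

Lemma Jsqr : Jmx *m Jmx^T = 1%:M.
Proof.
have C' : Jprime *m Jprime^T = 1%:M.
  by apply/matrixP=> [[[|[|i]] Hi]] [[|[|j]] Hj] //;
     rewrite !mxE !big_ord_recl big_ord0 !mxE /=; ring.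
have E : block_mx Jprime 0 0 Jprime *m (block_mx Jprime 0 0 Jprime)^T = 1%:M.
  by rewrite tr_block_mx mulmx_block !trmx0 !mul0mx !mulmx0 !addr0 !add0r C'
             -scalar_mx_block.
exact: E.
Qed.

Lemma trJ : Jmx^T = - Jmx.
Proof.
have J't : Jprime^T = - Jprime.
  by apply/matrixP=> [[[|[|i]] Hi]] [[|[|j]] Hj] //; rewrite !mxE /= ?oppr0 ?opprK.
have E := tr_block_mx Jprime 0 0 Jprime.
have N := opp_block_mx Jprime 0 0 Jprime; rewrite !oppr0 in N.
by rewrite J't !trmx0 -N in E; exact: E.
Qed.

Lemma JJ : Jmx *m Jmx = - 1%:M.
Proof. by rewrite -[X in _ *m X]opprK -trJ mulmxN Jsqr. Qed.

Fact sp2_J_subproof : is_Sp2 Jmx.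
Proof. by rewrite /is_Sp2 adjJ Jsqr (mulmx1C Jsqr) mul1mx !eqxx. Qed.
Definition sp2_J := MkSp2 sp2_J_subproof.

End Sp2.

Section Sp1Sp2.
Variable R : realType.

Definition Sp1xSp2 := (Sp1 R * Sp2 R)%type.
HB.instance Definition _ := Choice.on Sp1xSp2.

Definition pr_one : Sp1xSp2 := (1%g, 1%g).
Definition pr_inv (x : Sp1xSp2) : Sp1xSp2 := (x.1^-1, x.2^-1)%g.
Definition pr_mul (x y : Sp1xSp2) : Sp1xSp2 := (x.1 * y.1, x.2 * y.2)%g.

Fact pr_mulA : associative pr_mul.
Proof. by move=> x y z; rewrite /pr_mul /= !mulgA. Qed.
Fact pr_mul1 : left_id pr_one pr_mul.
Proof. by case=> x y; rewrite /pr_mul /= !mul1g. Qed.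
Fact pr_mulr1 : right_id pr_one pr_mul.
Proof. by case=> x y; rewrite /pr_mul /= !mulg1. Qed.
Fact pr_mulV : left_inverse pr_one pr_inv pr_mul.
Proof. by case=> x y; rewrite /pr_mul /= !mulVg. Qed.
Fact pr_mulrV : right_inverse pr_one pr_inv pr_mul.
Proof. by case=> x y; rewrite /pr_mul /= !mulgV. Qed.

HB.instance Definition _ := isGroup.Build Sp1xSp2
  pr_mulA pr_mul1 pr_mulr1 pr_mulV pr_mulrV.

Definition prN1 : Sp1xSp2 := (sp1_N1 R, sp2_N1 R).

Lemma prN1C (x : Sp1xSp2) : (x * prN1 = prN1 * x)%g.
Proof.
case: x => a g; congr (_, _); apply/val_inj => /=.
  case: a => -[a b] /= _; rewrite /qmul /= conjc0 conjcN1.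
  by rewrite !(mulr0, mul0r, mulrN1, mulN1r, subr0, addr0, add0r).
by rewrite mulmxN mulNmx mul1mx mulmx1.
Qed.

Lemma prN1K : (prN1 * prN1 = 1)%g.
Proof.
congr (_, _); apply/val_inj => /=.
  rewrite /qmul /= conjc0 conjcN1.
  by rewrite !(mulr0, mul0r, mulrNN, mulr1, subr0, addr0, add0r).
by rewrite mulmxN mulNmx mul1mx opprK.
Qed.

(* equality modulo the subgroup {(1, 1), (-1, -1)} *)
Definition pm_eq (x y : Sp1xSp2) := (x == y) || (x == y * prN1)%g.

Fact pm_eq_refl : reflexive pm_eq.
Proof. by move=> x; rewrite /pm_eq eqxx. Qed.
Fact pm_eq_sym : symmetric pm_eq.
Proof.
move=> x y; rewrite /pm_eq eq_sym; congr (_ || _).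
by apply/eqP/eqP => ->; rewrite -mulgA prN1K mulg1.
Qed.
Fact pm_eq_trans : transitive pm_eq.
Proof.
move=> y x z /orP[/eqP->//|/eqP->] /orP[] /eqP->; rewrite /pm_eq ?eqxx ?orbT //.
by rewrite -mulgA prN1K mulg1 eqxx.
Qed.
Canonical pm_equiv := EquivRel pm_eq pm_eq_refl pm_eq_sym pm_eq_trans.

Definition Sp1Sp2 := {eq_quot pm_eq}.
HB.instance Definition _ : EqQuotient _ pm_eq Sp1Sp2 := EqQuotient.on Sp1Sp2.
HB.instance Definition _ := Choice.on Sp1Sp2.

Definition cls (x : Sp1xSp2) : Sp1Sp2 := \pi_Sp1Sp2 x.

Lemma cls_surj x : exists y, x = cls y.
Proof. by exists (repr x); rewrite /cls reprK. Qed.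

Lemma cls_eqP (x y : Sp1xSp2) :
  reflect (x = y \/ x = y * prN1)%g (cls x == cls y).
Proof. by rewrite /cls piE; apply: (iffP orP) => -[] /eqP; auto. Qed.

Definition q_one : Sp1Sp2 := cls 1%g.
Definition q_inv (x : Sp1Sp2) : Sp1Sp2 := cls (repr x)^-1%g.
Definition q_mul (x y : Sp1Sp2) : Sp1Sp2 := cls (repr x * repr y)%g.

Lemma repr_cls (x : Sp1xSp2) :
  (repr (cls x) = x \/ repr (cls x) = x * prN1)%g.
Proof. by apply/cls_eqP; rewrite /cls reprK. Qed.

Lemma cls_N1 (x : Sp1xSp2) : cls (x * prN1)%g = cls x.
Proof. by apply/eqP/cls_eqP; right. Qed.

Lemma q_mulE x y : q_mul (cls x) (cls y) = cls (x * y)%g.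
Proof.
rewrite /q_mul; case: (repr_cls x) (repr_cls y) => -> [] -> //.
- by rewrite mulgA cls_N1.
- by rewrite -mulgA -prN1C mulgA cls_N1.
- by rewrite mulgA cls_N1 -mulgA -prN1C mulgA cls_N1.
Qed.

Lemma q_invE x : q_inv (cls x) = cls x^-1%g.
Proof.
rewrite /q_inv; case: (repr_cls x) => -> //.
have NV : (prN1^-1 = prN1)%g by apply: (mulgI prN1); rewrite mulgV prN1K.
by rewrite prN1C invgM NV cls_N1.
Qed.

Fact q_mulA : associative q_mul.
Proof.
move=> x y z; have [[x' ->] [y' ->] [z' ->]] := And3 (cls_surj x) (cls_surj y) (cls_surj z).
by rewrite !q_mulE mulgA.
Qed.
Fact q_mul1 : left_id q_one q_mul.
Proof. by move=> x; have [x' ->] := cls_surj x; rewrite /q_one q_mulE mul1g. Qed.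
Fact q_mulr1 : right_id q_one q_mul.
Proof. by move=> x; have [x' ->] := cls_surj x; rewrite /q_one q_mulE mulg1. Qed.
Fact q_mulV : left_inverse q_one q_inv q_mul.
Proof. by move=> x; have [x' ->] := cls_surj x; rewrite q_invE q_mulE mulVg. Qed.
Fact q_mulrV : right_inverse q_one q_inv q_mul.
Proof. by move=> x; have [x' ->] := cls_surj x; rewrite q_invE q_mulE mulgV. Qed.

HB.instance Definition _ := isGroup.Build Sp1Sp2
  q_mulA q_mul1 q_mulr1 q_mulV q_mulrV.

End Sp1Sp2.

Section Action.
Variable R : realType.
Local Notation C4 := 'cV[R[i]]_4.
Local Notation R8 := 'rV[R]_8.

(* z_k = x_(2k) + i x_(2k+1) *)
Definition toC (x : R8) : C4 :=
  \col_k (x 0 (inord k.*2) +i* x 0 (inord k.*2.+1)).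
Definition ofC (z : C4) : R8 :=
  \row_m (if odd m then complex.Im (z (inord m./2) 0) else complex.Re (z (inord m./2) 0)).

Lemma ofCK : cancel ofC toC.
Proof.
move=> z; apply/colP => k; rewrite !mxE.
have k4 := ltn_ord k.
have k8 : (k.*2.+1 < 8)%N by rewrite -doubleS -[8%N]/(4.*2) leq_double.
rewrite !inordK ?(ltnW k8)//= odd_double /= uphalf_double doubleK inord_val.
by case: (z k 0).
Qed.

Lemma toCK : cancel toC ofC.
Proof.
move=> x; apply/rowP => m; rewrite !mxE.
have m4 : (m./2 < 4)%N by rewrite ltn_half_double ltn_ord.
have E := odd_double_half m; rewrite !inordK //.
by case: ifP => om /=; congr (x 0 _); apply: val_inj => /=;
  rewrite om in E; have := ltn_ord m; rewrite -{1}E => m8; rewrite inordK.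
Qed.

Lemma toC_linear (a : R) (x y : R8) : toC (a *: x + y) = a%:C *: toC x + toC y.
Proof.
apply/colP => k; rewrite !mxE; apply/eqP.
by rewrite eq_complex /= !mul0r subr0 addr0 !eqxx.
Qed.

Lemma ofC_linear (a : R) (x y : C4) :
  ofC (a%:C *: x + y) = a *: ofC x + ofC y.
Proof. by apply: (can_inj toCK); rewrite toC_linear !ofCK. Qed.

Definition sp1_act (a : quat R) (u : C4) : C4 :=
  a.1 *: u + a.2 *: (Jmx R *m map_mx conjc u).

Lemma sp1_act_linear q (a : R) (x y : C4) :
  sp1_act q (a%:C *: x + y) = a%:C *: sp1_act q x + sp1_act q y.
Proof.
rewrite /sp1_act map_mxD map_mxZ /= conjc_real mulmxDr -scalemxAr !scalerDr.
rewrite !scalerA ![a%:C * _]mulrC !addrA; congr (_ + _).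
by rewrite addrAC.
Qed.

Definition pr_act (x : Sp1xSp2 R) (v : R8) : R8 :=
  ofC (sp1_act (sp1val x.1) (sp2val x.2 *m toC v)).

Lemma pr_act_linear x : linear (pr_act x).
Proof.
move=> a u v; rewrite /pr_act toC_linear mulmxDr -scalemxAr sp1_act_linear.
by rewrite ofC_linear.
Qed.

Definition act (x : Sp1Sp2 R) : R8 -> R8 := pr_act (repr x).

HB.instance Definition _ x := GRing.isLinear.Build R R8 R8 *:%R (act x)
  (pr_act_linear (repr x)).

Lemma actE x v : act (cls x) v = pr_act x v.
Proof.
rewrite /act; have [->//|->] := repr_cls x.
rewrite /pr_act /=; congr ofC; rewrite mulmxN mulmx1 /sp1_act /qmul /=.
rewrite conjc0 conjcN1 !(mulr0, subr0, add0r, mulrN1, mulNmx).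
by rewrite map_mxN mulmxN !scalerN !scaleNr !opprK.
Qed.

Lemma Sp2_conjJ (g : Sp2 R) : Jmx R *m map_mx conjc g = g *m Jmx R.
Proof.
case: g => g /= /andP[/eqP gU /eqP gJ].
have E : g^T *m map_mx conjc g = 1%:M.
  have := congr1 trmx (mulmx1C gU).
  by rewrite trmx_mul trmx1 /adjmx trmxK.
have E' := mulmx1C E.
have : g^T *m (Jmx R *m g) *m (Jmx R)^T = g^T *m map_mx conjc g.
  by rewrite E mulmxA gJ Jsqr.
rewrite -mulmxA => /(congr1 (mulmx (map_mx conjc g))).
rewrite mulmxA E' mul1mx mulmxA E' mul1mx => <-.
by rewrite trJ !mulmxN !mulmxA JJ !mulNmx mul1mx opprK.
Qed.

Lemma map_conjJ : map_mx conjc (Jmx R) = Jmx R.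
Proof. exact/trmx_inj/adjJ. Qed.

Lemma sp1_actM (p q : quat R) u :
  sp1_act (qmul p q) u = sp1_act p (sp1_act q u).
Proof.
rewrite /sp1_act /qmul /= map_mxD !map_mxZ map_mxM /= map_conjJ.
have -> : map_mx conjc (map_mx conjc u) = u.
  by apply/matrixP=> i j; rewrite !mxE conjcK.
rewrite mulmxDr -!scalemxAr mulmxA JJ mulNmx mul1mx !scalerDr !scalerA scalerN.
by rewrite !scalerDl scaleNr -!addrA; congr (_ + _); rewrite addrC addrA.
Qed.

Lemma sp1_act_Sp2 (g : Sp2 R) (q : quat R) u :
  sp1_act q (g *m u) = g *m sp1_act q u.
Proof.
by rewrite /sp1_act mulmxDr -!scalemxAr map_mxM !mulmxA Sp2_conjJ.
Qed.

Lemma actM x y v : act (x * y)%g v = act x (act y v).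
Proof.
have [[x' ->] [y' ->]] := conj (cls_surj x) (cls_surj y).
rewrite [(_ * _)%g]q_mulE !actE /pr_act ofCK /= sp1_actM -mulmxA.
by rewrite -[in RHS]sp1_act_Sp2.
Qed.

Lemma act1 v : act 1%g v = v.
Proof.
by rewrite [1%g]/(cls 1%g) actE /pr_act /= mul1mx /sp1_act /= scale1r scale0r
           addr0 toCK.
Qed.

(* the coordinates (z_1 + z_2 j, z_3 + z_4 j) of C^4 = H^2 *)
Definition toH (u : C4) : 'rV[quat R]_2 :=
  \row_p (u (inord p.*2) 0, u (inord p.*2.+1) 0).

Lemma JmulE (w : C4) (p : 'I_2) :
  ((Jmx R *m w) (inord p.*2) 0 = - w (inord p.*2.+1) 0) /\
  ((Jmx R *m w) (inord p.*2.+1) 0 = w (inord p.*2) 0).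
Proof.
have JE (v : 'cV[R[i]]_(2 + 2)) (i : 'I_2) :
    ((block_mx (Jprime R) 0 0 (Jprime R) *m v) (lshift 2 i) 0 =
       \sum_j Jprime R i j * v (lshift 2 j) 0) /\
    ((block_mx (Jprime R) 0 0 (Jprime R) *m v) (rshift 2 i) 0 =
       \sum_j Jprime R i j * v (rshift 2 j) 0).
  rewrite !mxE !big_split_ord /=; split.
    rewrite [X in _ + X]big1 ?addr0; first by apply: eq_bigr => j _; rewrite block_mxEul.
    by move=> j _; rewrite block_mxEur mxE mul0r.
  rewrite big1 ?add0r; first by apply: eq_bigr => j _; rewrite block_mxEdr.
  by move=> j _; rewrite block_mxEdl mxE mul0r.
have e (a b : 'I_4) : val a = val b -> a = b by exact: val_inj.
case: p => [[|[|p]] hp] //=.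
  have -> : inord 0 = lshift 2 (0 : 'I_2) :> 'I_4 by apply: e; rewrite /= inordK.
  have -> : inord 1 = lshift 2 (1 : 'I_2) :> 'I_4 by apply: e; rewrite /= inordK.
  have [E0 _] := JE w 0; have [E1 _] := JE w 1.
  split; [apply: etrans E0 _|apply: etrans E1 _];
    rewrite !big_ord_recl big_ord0 !mxE /= !(mul0r, mul1r, mulN1r, add0r, addr0) //;
    by congr (- w _ _); exact: val_inj.
have -> : inord 2 = rshift 2 (0 : 'I_2) :> 'I_4 by apply: e; rewrite /= inordK.
have -> : inord 3 = rshift 2 (1 : 'I_2) :> 'I_4 by apply: e; rewrite /= inordK.
have [_ E0] := JE w 0; have [_ E1] := JE w 1.
split; [apply: etrans E0 _|apply: etrans E1 _];
  rewrite !big_ord_recl big_ord0 !mxE /= !(mul0r, mul1r, mulN1r, add0r, addr0) //;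
  by congr (- w _ _); exact: val_inj.
Qed.

Lemma toH_sp1_act q u p : toH (sp1_act q u) 0 p = qmul q (toH u 0 p).
Proof.
have [E0 E1] := JmulE (map_mx conjc u) p.
rewrite [LHS]mxE [toH u 0 p]mxE /qmul /=; congr (_, _);
  rewrite mxE [X in X + _]mxE [X in _ + X]mxE ?E0 ?E1 mxE //.
by rewrite mulrN.
Qed.


(* A in Sp(2), as a quaternionic matrix, is the map q |-> q *m (conj A)^T on
   row vectors *)
Definition quat_rep (A : 'M[quat R]_2) (g : 'M[R[i]]_4) :=
  forall (u : C4) (p : 'I_2),
    toH (g *m u) 0 p = \sum_k qmul (toH u 0 k) (qconj (A p k)).

Definition Sp1xSp1 : set (Sp2 R) :=
  [set g | exists2 A, quat_rep A (sp2val g) & forall p k, p != k -> A p k = 0].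

Definition U2 : set (Sp2 R) :=
  [set g | exists2 A, quat_rep A (sp2val g) & forall p k, (A p k).2 = 0].

Definition U1 : set (Sp1 R) := [set a | (sp1val a).2 = 0].

Definition prod_image (G1 : set (Sp1 R)) (G2 : set (Sp2 R)) : set (Sp1Sp2 R) :=
  @cls R @` [set x | G1 x.1 /\ G2 x.2].

Definition K1 : set (Sp1Sp2 R) := prod_image [set: Sp1 R] Sp1xSp1.
Definition K2 : set (Sp1Sp2 R) := prod_image U1 U2.

Definition lcoset (K : set (Sp1Sp2 R)) (x : Sp1Sp2 R) : set (Sp1Sp2 R) :=
  [set (x * k)%g | k in K].
Definition coset_space (K : set (Sp1Sp2 R)) : set (set (Sp1Sp2 R)) :=
  range (lcoset K).

Definition act_vs (x : Sp1Sp2 R) (V : {vspace R8}) : {vspace R8} :=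
  (linfun (act x) @: V)%VS.

Definition plane_orbit (V : {vspace R8}) : set {vspace R8} :=
  range (act_vs^~ V).

Definition stabilizer (V : {vspace R8}) : set (Sp1Sp2 R) :=
  [set x | act_vs x V = V].

End Action.

Section Planes.
Variable R : realType.
Local Notation R8 := 'rV[R]_8.

Definition coord_plane (s : seq 'I_8) : {vspace R8} :=
  <<[seq (delta_mx ord0 k : R8) | k <- s]>>%VS.

Lemma coord_planeP (s : seq 'I_8) (v : R8) :
  reflect (forall k, k \notin s -> v 0 k = 0) (v \in coord_plane s).
Proof.
apply: (iffP idP) => [vs k ks|v0].
  have /coord_span -> : v \in <<in_tuple [seq (delta_mx ord0 k : R8) | k <- s]>>%VS.
    exact: vs.
  rewrite summxE big1 // => i _; rewrite mxE /= (nth_map k); last first.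
    by rewrite -(size_map (fun k => delta_mx ord0 k : R8)).
  rewrite mxE eqxx /=; case: eqVneq => [E|_]; last by rewrite mulr0.
  move: ks; rewrite {1}E mem_nth //.
  by rewrite -(size_map (fun k => delta_mx ord0 k : R8)).
rewrite (row_sum_delta v); apply: memv_suml => k _.
have [ks|/v0->] := boolP (k \in s); last by rewrite scale0r mem0v.
exact/memvZ/memv_span/map_f.
Qed.

Definition V1 : {vspace R8} := coord_plane [:: inord 0; inord 1; inord 2; inord 3].
Definition V2 : {vspace R8} := coord_plane [:: inord 0; inord 1; inord 4; inord 5].

Lemma toC_eq0 (v : R8) (k : 'I_4) : (toC v k 0 == 0) =
  (v 0 (inord k.*2) == 0) && (v 0 (inord k.*2.+1) == 0).
Proof. by rewrite mxE eq_complex. Qed.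

Let all8 (P : 'I_8 -> Prop) : P (inord 0) -> P (inord 1) -> P (inord 2) ->
  P (inord 3) -> P (inord 4) -> P (inord 5) -> P (inord 6) -> P (inord 7) ->
  forall k, P k.
Proof.
move=> h0 h1 h2 h3 h4 h5 h6 h7 k; rewrite -[k]inord_val.
by case: k => [[|[|[|[|[|[|[|[|k]]]]]]]] hk].
Qed.

Lemma mem_V1 (v : R8) : (v \in V1) = (toC v 2 0 == 0) && (toC v 3 0 == 0).
Proof.
rewrite !toC_eq0; apply/coord_planeP/idP => [v0|].
  by rewrite !v0 ?eqxx // !inE -!val_eqE /= !inordK.
move=> /andP[/andP[/eqP h4 /eqP h5] /andP[/eqP h6 /eqP h7]].
by apply: all8 => //; rewrite !inE eqxx ?orbT.
Qed.

Lemma mem_V2 (v : R8) : (v \in V2) = (toC v 1 0 == 0) && (toC v 3 0 == 0).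
Proof.
rewrite !toC_eq0; apply/coord_planeP/idP => [v0|].
  by rewrite !v0 ?eqxx // !inE -!val_eqE /= !inordK.
move=> /andP[/andP[/eqP h4 /eqP h5] /andP[/eqP h6 /eqP h7]].
by apply: all8 => //; rewrite !inE eqxx ?orbT.
Qed.

(* The class of (j, j 1_2): it acts on C^4 as the complex conjugation, hence
   stabilizes V2, but it does not belong to U(1)U(2). *)
Definition conj_elt : Sp1Sp2 R := cls (sp1_j R, (sp2_J R)^-1%g).

Lemma conj_eltE (v : R8) : toC (act conj_elt v) = map_mx conjc (toC v).
Proof.
rewrite actE /pr_act ofCK /= /sp1_act /= scale0r scale1r add0r.
by rewrite map_mxM /= adjJ trJ map_mxN map_conjJ -trJ mulmxA Jsqr mul1mx.
Qed.

Lemma conj_elt_V2 : stabilizer V2 conj_elt.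
Proof.
have sub (v : R8) : v \in V2 -> act conj_elt v \in V2.
  by rewrite !mem_V2 conj_eltE !mxE !conjc_eq0.
have conjK (v : R8) : act conj_elt (act conj_elt v) = v.
  apply: (can_inj (@toCK R)); rewrite !conj_eltE.
  by apply/colP => k; rewrite !mxE conjcK.
apply/eqP; rewrite eqEsubv; apply/andP; split; apply/subvP => v.
  by case/memv_imgP => w /sub wV ->; rewrite lfunE.
move=> /sub vV; apply/memv_imgP; exists (act conj_elt v) => //.
by rewrite lfunE /= conjK.
Qed.

Lemma conj_elt_notin_K2 : ~ K2 conj_elt.
Proof.
case=> -[a g] /= [a2 _] /eqP/cls_eqP[] /(congr1 (fun x => (sp1val x.1).2)) /=.
  by rewrite a2 => /eqP; rewrite eq_sym oner_eq0.
by rewrite a2 conjcN1 mul0r add0r mul1r => /eqP; rewrite eq_sym oppr_eq0 oner_eq0.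
Qed.

End Planes.

Section SquashedSphere.
Variable R : realType.
Local Notation R8 := 'rV[R]_8.
Implicit Types (x p u v w : R8) (A : set R8).

Definition dot u v : R := \sum_k u 0 k * v 0 k.

Definition S7 : set R8 := [set x | dot x x = 1].

Definition cstruct (i : 'I_3) x : R8 :=
  ofC (sp1_act (tnth [tuple quat_i R; quat_j R; quat_k R] i) (toC x)).

Definition xi (i : 'I_3) x : R8 := - cstruct i x.
Definition eta (i : 'I_3) x v : R := dot (xi i x) v.

(* For x in S7, (xi i x)_i is an orthonormal basis of the vertical space, so
   that on T_x S7 these are the g-orthogonal projections. *)
Definition ver x v : R8 := \sum_i eta i x v *: xi i x.
Definition hor x v : R8 := v - ver x v.

(* Exterior derivative of a 1-form on R^8.  The forms eta i are defined on R^8;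
   as d commutes with the restriction to S7, on vectors tangent to S7 this is
   the exterior derivative of the restriction of the form to S7. *)
Definition ext_d (a : R8 -> R8 -> R) x u v : R :=
  'D_u (fun y => a y v) x - 'D_v (fun y => a y u) x.

Definition omega (i : 'I_3) x u v : R :=
  2^-1 * ext_d (eta i) x (hor x u) (hor x v).

Definition wedge11 (a b : R8 -> R) u v : R := a u * b v - a v * b u.
Definition wedge12 (a : R8 -> R) (b : R8 -> R8 -> R) u v w : R :=
  a u * b v w - a v * b u w + a w * b u v.

Definition gtilde x u v : R :=
  (3 / 5) ^+ 2 * dot (ver x u) (ver x v)
  + (3 / Num.sqrt 5) ^+ 2 * dot (hor x u) (hor x v).

Definition phitilde x u v w : R :=
  27 / 25 *
  (5^-1 * wedge12 (eta 0 x) (wedge11 (eta 1 x) (eta 2 x)) u v w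
   + \sum_i wedge12 (eta i x) (omega i x) u v w).

(* f is infinitely differentiable on U: all its iterated directional
   derivatives are differentiable at the points of U. *)
Definition smooth_on (m : nat) (U : set R8) (f : R8 -> 'rV[R]_m) :=
  forall (s : seq R8) x, U x ->
    differentiable (foldr (fun v (h : R8 -> 'rV[R]_m) => 'D_v h) f s) x.

(* k-dimensional embedded submanifolds of R^8: locally, regular level sets *)
Definition submanifold (k : nat) A :=
  forall p, A p -> exists (U : set R8) (F : R8 -> 'rV[R]_(8 - k)),
    [/\ open U, U p, smooth_on U F, A `&` U = [set x | U x /\ F x = 0]
      & forall x, (A `&` U) x -> forall y, exists v, 'D_v F x = y].

(* velocities at p of the curves in A *)
Definition tangent A p : set R8 :=
  [set v | exists c : R -> R8,
     [/\ c 0 = p, \forall t \near 0, A (c t) & is_derive (0 : R) 1 c v]].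

Definition alternating3 (t : R8 -> R8 -> R8 -> R) :=
  [/\ forall a u u' v w, t (a *: u + u') v w = a * t u v w + t u' v w,
      forall u v w, t v u w = - t u v w
    & forall u v w, t u w v = - t u v w].

(* An orientation of a 3-dimensional submanifold A is given by a continuous
   3-form that does not vanish on any tangent space of A. *)
Definition orients A (t : R8 -> R8 -> R8 -> R8 -> R) :=
  [/\ forall p, A p -> alternating3 (t p),
      forall u v w, {within A, continuous (fun p => t p u v w)}
    & forall p, A p -> exists u v w,
        [/\ tangent A p u, tangent A p v, tangent A p w & t p u v w != 0]].

(* the volume form of the metric m for the orientation t *)
Definition vol_form (m : R8 -> R8 -> R8 -> R) (t : R8 -> R8 -> R8 -> R8 -> R)
    p u v w : R :=
  let e := tnth [tuple u; v; w] in
  Num.sg (t p u v w) * Num.sqrt (\det (\matrix_(i < 3, j < 3) m p (e i) (e j))).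

Definition associative3 A :=
  [/\ A `<=` S7, submanifold 3 A
    & exists2 t, orients A t &
        forall p u v w, A p -> tangent A p u -> tangent A p v -> tangent A p w ->
          phitilde p u v w = vol_form gtilde t p u v w].

Definition great_sphere (V : {vspace R8}) : set R8 := [set` V] `&` S7.

Definition assoc_planes : set {vspace R8} :=
  [set V | \dim V = 4%N /\ associative3 (great_sphere V)].

End SquashedSphere.

Arguments K1 R _ : clear implicits.
Arguments K2 R _ : clear implicits.
Arguments S7 R _ : clear implicits.
Arguments assoc_planes R _ : clear implicits.

(* Main.v *)
(** Let [B] be the imaginary part of the quaternionic Hermitian form of
    [R^8 = H^2], and let [p, u, v] be orthonormal in a 4-plane [V].  If [V] meets
    the sphere in an associative submanifold then the equality case of the
    Cauchy-Schwarz inequality shows that [V] contains the cross product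
      [(5 B(u,v) - 8 B(p,u) x B(p,v)) p + B(p,u) v - B(p,v) u].
    Take a 3-plane in [V] with an orthonormal basis [e_i] and an oriented
    orthonormal basis [n_i] of the imaginary quaternions such that
    [B(e_i, e_(i+1)) = m_(i+2) n_(i+2)] (singular value decomposition).  As the
    quaternionic dimension is 2, [m_i = cos t_i] with [t_1 + t_2 + t_3 = 0].
    Comparing the cross products of rotated bases gives
    [k_i n_i e_j + k_j n_j e_i] in [V] with [k_i = m_i - 2 m_j m_k], hence
    [k_i sin t_i = 0] for all [i], and then the [m_i] are [(+-1, +-1, +-1)] or a
    permutation of [(+-1, 0, 0)].  In the first case [V] is a quaternionic line,
    in the second case it is spanned by two Hermitian-orthogonal vectors over
    [R + R n] for a unit imaginary [n]; these are the orbits of [V1] and [V2].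
    The stabilizer of [V2] contains [K2] with index 2, so the bijection of
    [Sp(1)Sp(2)/K2] with the orbit of [V2] is obtained from the Cantor-Bernstein
    theorem. *)
From HB Require Import structures.
From mathcomp Require Import all_boot all_order all_algebra.
From mathcomp Require Import generic_quotient complex polyrcf ring lra.
From mathcomp Require Import all_classical all_reals all_analysis.
Require Import Defs.

Set Implicit Arguments.
Unset Strict Implicit.
Unset Printing Implicit Defensive.
Import Order.TTheory GRing.Theory Num.Theory.
Import numFieldNormedType.Exports.
Local Open Scope classical_set_scope.
Local Open Scope ring_scope.

(** * Singular values of a linear map between oriented Euclidean 3-spaces *)

Section Space3.
Variable R : rcfType.
Local Notation R3 := (R * R * R)%type.
Implicit Types u v w n m : R3.

(** At a unit [p] the squashed metric is 9/25 times q = 5 dt - 4 B(p,.).B(p,.) and the 3-form is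
    27/25 times [assoc_form], so associativity says that (5 [assoc_form])^2 is the Gram determinant
    of q. The cross product of the overview is the q-dual of 5 [assoc_form](u, v, .), whence the
    equality case of Cauchy-Schwarz. The condition t_1 + t_2 + t_3 = 0 is only a reading of the
    polynomial relation 1 - m_1^2 - m_2^2 - m_3^2 + 2 m_1 m_2 m_3 = 0; no angle occurs. The relation
    holds because the complement of a quaternionic line of H^2 is again such a line, so that
    |h(x,y)| = |x| |y| on it. For the converse an orientation must be exhibited as a continuous
    3-form; on both kinds of planes a multiple of [lin_form] serves, as it is linear in the base
    point. The obstacle in the second summand is that x K2 |-> x V2 is two-to-one. One injection
    needed for Cantor-Bernstein comes from choosing elements; the other must separate the two cosets
    over each plane, that is, antipodal points of S^2 = Sp(1)/U(1), which is achieved by squeezing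
    S^2 into an open hemisphere. *)

Definition dot3 u v : R := u.1.1 * v.1.1 + u.1.2 * v.1.2 + u.2 * v.2.

Definition cross3 u v : R3 :=
  (u.1.2 * v.2 - u.2 * v.1.2, u.2 * v.1.1 - u.1.1 * v.2,
   u.1.1 * v.1.2 - u.1.2 * v.1.1).

Definition posframe n1 n2 n3 :=
  [/\ dot3 n1 n1 = 1, dot3 n2 n2 = 1, dot3 n1 n2 = 0 & n3 = cross3 n1 n2].

Definition lin3 m1 m2 m3 v : R3 := v.1.1 *: m1 + v.1.2 *: m2 + v.2 *: m3.

Lemma R3_eq (u v : R3) :
  u.1.1 = v.1.1 -> u.1.2 = v.1.2 -> u.2 = v.2 -> u = v.
Proof. by case: u v => [[u1 u2] u3] [[v1 v2] v3] /= -> -> ->. Qed.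

Local Ltac ring3 := rewrite /dot3 /cross3 /lin3 /= /GRing.scale /=; ring.

Lemma dot3C u v : dot3 u v = dot3 v u.
Proof. by ring3. Qed.

Lemma dot3_ge0 u : 0 <= dot3 u u.
Proof. by rewrite /dot3 !addr_ge0 // -expr2 sqr_ge0. Qed.

Lemma dot3_eq0 u : (dot3 u u == 0) = (u == 0).
Proof.
apply/eqP/eqP => [|->]; last by rewrite /dot3 !mulr0 !addr0.
rewrite /dot3 -!expr2 => /eqP; rewrite !paddr_eq0 ?addr_ge0 ?sqr_ge0 //.
by rewrite !sqrf_eq0 => /andP[/andP[/eqP ? /eqP ?] /eqP ?]; exact: R3_eq.
Qed.

Lemma unit3 u : u != 0 -> exists2 r, r != 0 & dot3 (r *: u) (r *: u) = 1.
Proof.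
move=> u0; have d0 : 0 < dot3 u u by rewrite lt0r dot3_eq0 u0 dot3_ge0.
exists (Num.sqrt (dot3 u u))^-1; first by rewrite invr_eq0 gt_eqF // sqrtr_gt0.
have E := sqr_sqrtr (ltW d0); have s0 : Num.sqrt (dot3 u u) != 0.
  by rewrite gt_eqF // sqrtr_gt0.
rewrite -(divff (lt0r_neq0 d0)) -[X in _ / X]E.
by move: s0; set s := Num.sqrt _ => s0; rewrite /dot3 /= /GRing.scale /=; field.
Qed.

Lemma exists_perp3 u : dot3 u u = 1 -> exists2 v, dot3 v v = 1 & dot3 u v = 0.
Proof.
move=> u1; have [v v0 uv] : exists2 v, v != 0 & dot3 u v = 0.
  have [h|h] := eqVneq (u.1.1, u.1.2) 0.
    have [h1 h2] := (congr1 fst h, congr1 snd h); rewrite /= in h1 h2.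
    exists (1, 0, 0); last by rewrite /dot3 h1 h2 /=; ring.
    by apply/eqP => /(congr1 (fun v : R3 => v.1.1)) /= /eqP; rewrite oner_eq0.
  exists (- u.1.2, u.1.1, 0); last by ring3.
  apply: contraNneq h => h; have h1 := congr1 (fun v : R3 => v.1.1) h.
  have h2 := congr1 (fun v : R3 => v.1.2) h; rewrite /= in h1 h2.
  by rewrite h2 -[u.1.2]opprK h1 oppr0.
have [r _ rv] := unit3 v0; exists (r *: v) => //.
by rewrite -[RHS](mulr0 r) -uv; ring3.
Qed.

Lemma posframe_cycle n1 n2 n3 : posframe n1 n2 n3 -> posframe n2 n3 n1.
Proof.
case=> h1 h2 h12 ->.
have h3 : dot3 (cross3 n1 n2) (cross3 n1 n2) = 1.
  transitivity (dot3 n1 n1 * dot3 n2 n2 - dot3 n1 n2 ^+ 2); last by rewrite h1 h2 h12; ring.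
  by ring3.
have h23 : dot3 n2 (cross3 n1 n2) = 0 by ring3.
split=> //.
have E : cross3 n2 (cross3 n1 n2) = dot3 n2 n2 *: n1 - dot3 n1 n2 *: n2.
  by apply: R3_eq; ring3.
by rewrite E h2 h12 scale1r scale0r subr0.
Qed.

Lemma posframe_expand n1 n2 n3 v : posframe n1 n2 n3 ->
  v = dot3 n1 v *: n1 + dot3 n2 v *: n2 + dot3 n3 v *: n3.
Proof.
move=> fr; have [h1 h2 h12 E3] := fr.
have [_ h3 h23 E1] := posframe_cycle fr.
have [_ _ h31 E2] := posframe_cycle (posframe_cycle fr).
have D : dot3 n1 (cross3 n2 n3) = 1 by rewrite -E1.
(* Cramer's rule; the determinant is 1 by [D]. *)
have E : dot3 n1 (cross3 n2 n3) *: v = dot3 v (cross3 n2 n3) *: n1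
   + dot3 v (cross3 n3 n1) *: n2 + dot3 v (cross3 n1 n2) *: n3.
  by apply: R3_eq; ring3.
by move: E; rewrite D scale1r -E1 -E2 -E3 !(dot3C v).
Qed.

(** Two nonzero vectors, normalized, fix the frame, and the third is then a multiple of their cross
    product; vanishing vectors leave freedom in the frame. Since the [d]s may have any sign, a
    positive frame can always be reached. *)
Lemma orthogonal_posframe m1 m2 m3 :
  dot3 m1 m2 = 0 -> dot3 m2 m3 = 0 -> dot3 m3 m1 = 0 ->
  exists n1 n2 n3 (d1 d2 d3 : R), [/\ posframe n1 n2 n3,
    m1 = d1 *: n1, m2 = d2 *: n2 & m3 = d3 *: n3].
Proof.
have perpZ r u v : dot3 u v = 0 -> dot3 (r *: u) v = 0.
  by move=> E; rewrite -[RHS](mulr0 r) -E; ring3.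
have mulZ (r : R) u : r != 0 -> u = r^-1 *: (r *: u).
  by move=> r0; rewrite scalerA mulVf // scale1r.
have two k1 k2 k3 : dot3 k1 k2 = 0 -> dot3 k2 k3 = 0 -> dot3 k3 k1 = 0 ->
   k1 != 0 -> k2 != 0 ->
   exists n1 n2 n3 (d1 d2 d3 : R), [/\ posframe n1 n2 n3,
    k1 = d1 *: n1, k2 = d2 *: n2 & k3 = d3 *: n3].
  move=> e12 e23 e31 /unit3[r r0 h1] /unit3[s s0 h2].
  have fr : posframe (r *: k1) (s *: k2) (cross3 (r *: k1) (s *: k2)).
    by split=> //; apply: (perpZ); rewrite dot3C; apply: perpZ; rewrite dot3C.
  exists (r *: k1), (s *: k2), (cross3 (r *: k1) (s *: k2)), r^-1, s^-1.
  exists (dot3 (cross3 (r *: k1) (s *: k2)) k3).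
  split=> //; try exact: mulZ.
  have h13 : dot3 (r *: k1) k3 = 0 by apply: perpZ; rewrite dot3C.
  have h23 : dot3 (s *: k2) k3 = 0 by apply: perpZ.
  by rewrite [LHS](posframe_expand k3 fr) h13 h23 !scale0r !add0r.
have one k1 : exists n1 n2 n3 (d1 : R), posframe n1 n2 n3 /\ k1 = d1 *: n1.
  have [->|/unit3[r r0 h1]] := eqVneq k1 0.
    exists (1, 0, 0), (0, 1, 0), (0, 0, 1), 0; rewrite scale0r; split=> //.
    by split; rewrite /dot3 ?/cross3 /= ?mulr0 ?mul0r ?mulr1 ?addr0 ?add0r ?subr0 ?oppr0.
  have [v v1 uv] := exists_perp3 h1.
  by exists (r *: k1), v, (cross3 (r *: k1) v), r^-1; split=> //; exact: mulZ.
move=> e12 e23 e31; have [h1|h1] := eqVneq m1 0; last first.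
  have [h2|h2] := eqVneq m2 0; last exact: two.
  have [h3|h3] := eqVneq m3 0.
    have [n1 [n2 [n3 [d [fr E]]]]] := one m1.
    by exists n1, n2, n3, d, 0, 0; rewrite h2 h3 !scale0r.
  have [n3 [n1 [n2 [d3 [d1 [d2 [fr -> -> ->]]]]]]] := two _ _ _ e31 e12 e23 h3 h1.
  by exists n1, n2, n3, d1, d2, d3; split=> //; exact: posframe_cycle.
have [h2|h2] := eqVneq m2 0.
  have [n3 [n1 [n2 [d [fr E]]]]] := one m3.
  exists n1, n2, n3, 0, 0, d; rewrite h2 h1 !scale0r; split=> //.
  exact: posframe_cycle.
have [h3|h3] := eqVneq m3 0.
  have [n2 [n3 [n1 [d [fr E]]]]] := one m2.
  exists n1, n2, n3, 0, d, 0; rewrite h3 h1 !scale0r; split=> //.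
  by do 2!apply: posframe_cycle.
have [n2 [n3 [n1 [d2 [d3 [d1 [fr -> -> ->]]]]]]] := two _ _ _ e23 e31 e12 h2 h3.
exists n1, n2, n3, d1, d2, d3; split=> //.
by do 2!apply: posframe_cycle.
Qed.

(** A Jacobi rotation diagonalizing the Gram matrix of [u] and [v]: after rotation the inner product
    is c s D + (c^2 - s^2) b. *)
Lemma rotate_perp3 u v : exists c s : R,
  c ^+ 2 + s ^+ 2 = 1 /\ dot3 (c *: u + s *: v) (- s *: u + c *: v) = 0.
Proof.
set b := dot3 u v; set D := dot3 v v - dot3 u u.
suff [c [s [h1 h2]]] : exists c s : R,
    c ^+ 2 + s ^+ 2 = 1 /\ c * s * D + (c ^+ 2 - s ^+ 2) * b = 0.
  exists c, s; split=> //; rewrite -[RHS]h2 /b /D /dot3 /=.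
  by rewrite /GRing.scale /=; ring.
have [b0|b0] := eqVneq b 0; first by exists 1, 0; rewrite b0; split; ring.
set r := Num.sqrt (D ^+ 2 + 4 * b ^+ 2).
have hr : r ^+ 2 = D ^+ 2 + 4 * b ^+ 2.
  by rewrite sqr_sqrtr // addr_ge0 ?sqr_ge0 // mulr_ge0 ?sqr_ge0 ?ler0n.
(* The tangent of the angle: a root of the condition divided by c^2. *)
set t := (D + r) / (2 * b).
have ht : D * t + b * (1 - t ^+ 2) = 0.
  have E : D * t + b * (1 - t ^+ 2) = (D ^+ 2 + 4 * b ^+ 2 - r ^+ 2) / (4 * b).
    by rewrite /t; field.
  by rewrite E hr; field.
have t1 : 0 < 1 + t ^+ 2 by rewrite ltr_wpDr ?sqr_ge0.
set q := Num.sqrt (1 + t ^+ 2).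
have hq : q ^+ 2 = 1 + t ^+ 2 by rewrite sqr_sqrtr // ltW.
have q0 : q != 0 by rewrite gt_eqF // sqrtr_gt0.
exists q^-1, (t / q); split.
  by transitivity ((1 + t ^+ 2) / q ^+ 2); [field|rewrite hq divff // gt_eqF].
by transitivity ((D * t + b * (1 - t ^+ 2)) / q ^+ 2); [field|rewrite ht mul0r].
Qed.

(** The characteristic polynomial of the Gram matrix has degree 3, hence a root in a real closed
    field. The conclusion is the eigenvector equation for L^T L, tested against all [v], where L is
    [lin3 m1 m2 m3]. *)
Lemma symmetric_eigenvector m1 m2 m3 : exists o (l : R), dot3 o o = 1 /\
  forall v, dot3 (lin3 m1 m2 m3 o) (lin3 m1 m2 m3 v) = l * dot3 o v.
Proof.
pose m (i : 'I_3) := tnth [tuple m1; m2; m3] i.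
pose A : 'M[R]_3 := \matrix_(i, j) dot3 (m i) (m j).
have [|l] := @odd_poly_root _ (char_poly A); first by rewrite size_char_poly.
rewrite -eigenvalue_root_char => /eigenvalueP[x xA x0].
pose o : R3 := (x 0 0, x 0 1, x 0 (@Ordinal 3 2 isT)).
have E j : dot3 (lin3 m1 m2 m3 o) (m j) = l * x 0 j.
  have := congr1 (fun y : 'rV_3 => y 0 j) xA; rewrite !mxE => <-.
  rewrite !big_ord_recl big_ord0 !mxE /m !(tnth_nth 0) /= /lin3 /o /dot3 /=.
  have e1 : lift ord0 ord0 = 1 :> 'I_3 by exact: val_inj.
  have e2 : lift ord0 (lift ord0 ord0) = Ordinal (isT : (2 < 3)%N) :> 'I_3.
    exact: val_inj.
  have e0 : ord0 = 0 :> 'I_3 by exact: val_inj.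
  by rewrite e2 e1 e0 /GRing.scale /=; ring.
have o0 : o != 0.
  apply: contraNneq x0 => -[h0 h1 h2]; apply/eqP/rowP => j; rewrite mxE.
  case: j => [[|[|[|j]]] hj] //.
  - by rewrite -h0; congr (x _ _); exact: val_inj.
  - by rewrite -h1; congr (x _ _); exact: val_inj.
  - by rewrite -h2; congr (x _ _); exact: val_inj.
have [r r0 hr] := unit3 o0; exists (r *: o), l; split=> // v.
have [E0 [E1 E2]] := conj (E 0) (conj (E 1) (E (@Ordinal 3 2 isT))).
rewrite /m !(tnth_nth 0) /= in E0 E1 E2.
transitivity (r * (v.1.1 * dot3 (lin3 m1 m2 m3 o) m1 + v.1.2 * dot3 (lin3 m1 m2 m3 o) m2
    + v.2 * dot3 (lin3 m1 m2 m3 o) m3)).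
  by rewrite /lin3 /dot3 /= /GRing.scale /=; ring.
by rewrite E0 E1 E2 /dot3 /= /GRing.scale /=; ring.
Qed.

(** For an eigenvector [o1] of L^T L, the image of [o1] is orthogonal to the image of its
    complement; a rotation of that complement then makes the other two images orthogonal, and
    [orthogonal_posframe] supplies the target frame. *)
Lemma svd3 m1 m2 m3 : exists o1 o2 o3 n1 n2 n3 (d1 d2 d3 : R),
  [/\ posframe o1 o2 o3, posframe n1 n2 n3, lin3 m1 m2 m3 o1 = d1 *: n1,
      lin3 m1 m2 m3 o2 = d2 *: n2 & lin3 m1 m2 m3 o3 = d3 *: n3].
Proof.
have [ o1 [l [h1 hl]]] := symmetric_eigenvector m1 m2 m3.
have [v v1 v2] := exists_perp3 h1.
set L := lin3 m1 m2 m3; pose w := cross3 o1 v.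
have fr : posframe o1 v w by [].
have [_ w1 vw Ew] := posframe_cycle fr; have [_ _ wo _] := posframe_cycle (posframe_cycle fr).
have [c [s [cs p]]] := rotate_perp3 (L v) (L w).
have LD (x y : R) (a b : R3) : L (x *: a + y *: b) = x *: L a + y *: L b.
  by apply: R3_eq; rewrite /L /lin3 /= /GRing.scale /=; ring.
have fr' : posframe o1 (c *: v + s *: w) (- s *: v + c *: w).
  have dD (x y : R) (a b e : R3) : dot3 e (x *: a + y *: b) = x * dot3 e a + y * dot3 e b.
    by rewrite /dot3 /= /GRing.scale /=; ring.
  split=> //.
  - transitivity (c ^+ 2 * dot3 v v + s ^+ 2 * dot3 w w + 2 * c * s * dot3 v w).
      by ring3.
    by rewrite v1 w1 vw -[RHS]cs; ring.
  - by rewrite dD v2 (dot3C o1) wo !mulr0 addr0.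
  - have -> : cross3 o1 (c *: v + s *: w) = c *: cross3 o1 v - s *: cross3 w o1.
      by apply: R3_eq; rewrite /cross3 /= /GRing.scale /=; ring.
    have [_ _ _ <-] := posframe_cycle (posframe_cycle fr).
    by rewrite scaleNr addrC.
have [n1 [n2 [n3 [d1 [d2 [d3 [frn E1 E2 E3]]]]]]] :
    exists n1 n2 n3 (d1 d2 d3 : R), [/\ posframe n1 n2 n3,
    L o1 = d1 *: n1, L (c *: v + s *: w) = d2 *: n2 & L (- s *: v + c *: w) = d3 *: n3].
  have [_ _ h12 _] := fr'.
  have [_ _ h31 _] := posframe_cycle (posframe_cycle fr').
  apply: orthogonal_posframe.
  - by rewrite hl h12 mulr0.
  - by rewrite !LD.
  - by rewrite dot3C hl dot3C h31 mulr0.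
by exists o1, (c *: v + s *: w), (- s *: v + c *: w), n1, n2, n3, d1, d2, d3.
Qed.

End Space3.

(** * Left multiplication by quaternions *)

Section Coordinates.
Variable R : realType.
Local Notation R8 := 'rV[R]_8.
Local Notation R3 := (R * R * R)%type.
Implicit Types (x y z : R8) (a b : R3).

(** Explicit coordinates turn the identities between [dot], [Bform] and [im] into polynomial
    identities for [ring]. *)
Definition row8 (a0 a1 a2 a3 a4 a5 a6 a7 : R) : R8 :=
  \row_m nth 0 [:: a0; a1; a2; a3; a4; a5; a6; a7] m.

Lemma ord8P (P : 'I_8 -> Prop) : P (inord 0) -> P (inord 1) -> P (inord 2) ->
  P (inord 3) -> P (inord 4) -> P (inord 5) -> P (inord 6) -> P (inord 7) ->
  forall k, P k.
Proof.
move=> h0 h1 h2 h3 h4 h5 h6 h7 k; rewrite -[k]inord_val.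
by case: k => [[|[|[|[|[|[|[|[|k]]]]]]]] hk].
Qed.

Lemma row8E x : x = row8 (x 0 (inord 0)) (x 0 (inord 1)) (x 0 (inord 2))
  (x 0 (inord 3)) (x 0 (inord 4)) (x 0 (inord 5)) (x 0 (inord 6)) (x 0 (inord 7)).
Proof. by apply/rowP; apply: ord8P; rewrite [RHS]mxE inordK. Qed.

Lemma row8P x : exists a0 a1 a2 a3 a4 a5 a6 a7 : R, x = row8 a0 a1 a2 a3 a4 a5 a6 a7.
Proof. by do 8!eexists; exact: row8E. Qed.

Lemma dot_row8 (a0 a1 a2 a3 a4 a5 a6 a7 b0 b1 b2 b3 b4 b5 b6 b7 : R) :
  dot (row8 a0 a1 a2 a3 a4 a5 a6 a7) (row8 b0 b1 b2 b3 b4 b5 b6 b7) =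
  a0 * b0 + a1 * b1 + a2 * b2 + a3 * b3 + a4 * b4 + a5 * b5 + a6 * b6 + a7 * b7.
Proof. by rewrite /dot !big_ord_recl big_ord0 !mxE /= addr0 !addrA. Qed.

Lemma add_row8 (a0 a1 a2 a3 a4 a5 a6 a7 b0 b1 b2 b3 b4 b5 b6 b7 : R) :
  row8 a0 a1 a2 a3 a4 a5 a6 a7 + row8 b0 b1 b2 b3 b4 b5 b6 b7 =
  row8 (a0 + b0) (a1 + b1) (a2 + b2) (a3 + b3) (a4 + b4) (a5 + b5) (a6 + b6) (a7 + b7).
Proof. by apply/rowP; apply: ord8P; rewrite !mxE inordK. Qed.

Lemma scale_row8 (c a0 a1 a2 a3 a4 a5 a6 a7 : R) :
  c *: row8 a0 a1 a2 a3 a4 a5 a6 a7 =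
  row8 (c * a0) (c * a1) (c * a2) (c * a3) (c * a4) (c * a5) (c * a6) (c * a7).
Proof. by apply/rowP; apply: ord8P; rewrite !mxE inordK. Qed.

Definition lq (q : quat R) x : R8 := ofC (sp1_act q (toC x)).

Lemma lq_row8 (q0 q1 q2 q3 a0 a1 a2 a3 a4 a5 a6 a7 : R) :
  lq ((q0 +i* q1)%C, (q2 +i* q3)%C) (row8 a0 a1 a2 a3 a4 a5 a6 a7) =
  row8 (q0 * a0 - q1 * a1 - q2 * a2 - q3 * a3)
       (q0 * a1 + q1 * a0 + q2 * a3 - q3 * a2)
       (q0 * a2 - q1 * a3 + q2 * a0 + q3 * a1)
       (q0 * a3 + q1 * a2 - q2 * a1 + q3 * a0)
       (q0 * a4 - q1 * a5 - q2 * a6 - q3 * a7)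
       (q0 * a5 + q1 * a4 + q2 * a7 - q3 * a6)
       (q0 * a6 - q1 * a7 + q2 * a4 + q3 * a5)
       (q0 * a7 + q1 * a6 - q2 * a5 + q3 * a4).
Proof.
set q := (X in lq X _); rewrite /lq.
set x := row8 _ _ _ _ _ _ _ _.
have xE k : (k < 8)%N -> x 0 (inord k) = nth 0 [:: a0; a1; a2; a3; a4; a5; a6; a7] k.
  by move=> k8; rewrite mxE inordK.
have tE k : (k < 4)%N -> toC x (inord k) 0 =
   (nth 0 [:: a0; a1; a2; a3; a4; a5; a6; a7] k.*2 +i*
    nth 0 [:: a0; a1; a2; a3; a4; a5; a6; a7] k.*2.+1)%C.
  move=> k4; rewrite mxE inordK // !xE //.
    by rewrite -doubleS -[8%N]/(4.*2) leq_double.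
  by rewrite -[8%N]/(4.*2) ltn_double.
have := toH_sp1_act q (toC x) 1; rewrite [toH (sp1_act _ _) _ _]mxE [toH (toC x) _ _]mxE /= !tE //= => -[E2 E3].
have := toH_sp1_act q (toC x) 0; rewrite [toH (sp1_act _ _) _ _]mxE [toH (toC x) _ _]mxE /= !tE //= => -[E0 E1].
by apply/rowP; apply: ord8P; rewrite [LHS]mxE [RHS]mxE inordK //= ?E0 ?E1 ?E2 ?E3 /=; ring.
Qed.

Lemma cstruct_lq k x : cstruct k x = lq (tnth [tuple quat_i R; quat_j R; quat_k R] k) x.
Proof. by []. Qed.

Definition Bform x y : R3 :=
  (dot (cstruct 0 x) y, dot (cstruct 1 x) y, dot (cstruct 2 x) y).

Definition im a x : R8 :=
  lq ((0 +i* a.1.1)%C, (a.1.2 +i* a.2)%C) x.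

Lemma cstruct_row8 (a0 a1 a2 a3 a4 a5 a6 a7 : R) :
  let x := row8 a0 a1 a2 a3 a4 a5 a6 a7 in
  [/\ cstruct 0 x = row8 (- a1) a0 (- a3) a2 (- a5) a4 (- a7) a6,
      cstruct 1 x = row8 (- a2) a3 a0 (- a1) (- a6) a7 a4 (- a5)
    & cstruct 2 x = row8 (- a3) (- a2) a1 a0 (- a7) (- a6) a5 a4].
Proof.
split.
- rewrite cstruct_lq [tnth _ _]/= -[quat_i R]/((0 +i* 1)%C, (0 +i* 0)%C) lq_row8.
  by congr row8; ring.
- rewrite cstruct_lq [tnth _ _]/= -[quat_j R]/((0 +i* 0)%C, (1 +i* 0)%C) lq_row8.
  by congr row8; ring.
- rewrite cstruct_lq [tnth _ _]/= -[quat_k R]/((0 +i* 0)%C, (0 +i* 1)%C) lq_row8.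
  by congr row8; ring.
Qed.

Lemma Bform_row8 (a0 a1 a2 a3 a4 a5 a6 a7 b0 b1 b2 b3 b4 b5 b6 b7 : R) :
  Bform (row8 a0 a1 a2 a3 a4 a5 a6 a7) (row8 b0 b1 b2 b3 b4 b5 b6 b7) =
  (- a1 * b0 + a0 * b1 - a3 * b2 + a2 * b3 - a5 * b4 + a4 * b5 - a7 * b6 + a6 * b7,
   - a2 * b0 + a3 * b1 + a0 * b2 - a1 * b3 - a6 * b4 + a7 * b5 + a4 * b6 - a5 * b7,
   - a3 * b0 - a2 * b1 + a1 * b2 + a0 * b3 - a7 * b4 - a6 * b5 + a5 * b6 + a4 * b7).
Proof.
have /= [e0 e1 e2] := cstruct_row8 a0 a1 a2 a3 a4 a5 a6 a7.
by rewrite /Bform e0 e1 e2 !dot_row8; congr (_, _, _); ring.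
Qed.

Lemma dotC x y : dot x y = dot y x.
Proof. by apply: eq_bigr => k _; rewrite mulrC. Qed.
Lemma dotDl x y z : dot (x + y) z = dot x z + dot y z.
Proof. by rewrite /dot -big_split; apply: eq_bigr => k _; rewrite mxE mulrDl. Qed.
Lemma dotZl (r : R) x z : dot (r *: x) z = r * dot x z.
Proof. by rewrite /dot mulr_sumr; apply: eq_bigr => k _; rewrite mxE mulrA. Qed.
Lemma dotDr x y z : dot x (y + z) = dot x y + dot x z.
Proof. by rewrite !(dotC x) dotDl. Qed.
Lemma dotZr (r : R) x z : dot x (r *: z) = r * dot x z.
Proof. by rewrite !(dotC x) dotZl. Qed.
Lemma dotNl x y : dot (- x) y = - dot x y.
Proof. by rewrite -scaleN1r dotZl mulN1r. Qed.
Lemma dot0l x : dot 0 x = 0.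
Proof. by rewrite -{1}(scale0r x) dotZl mul0r. Qed.

Lemma dot_ge0 x : 0 <= dot x x.
Proof. by apply: sumr_ge0 => k _; rewrite -expr2 sqr_ge0. Qed.

Lemma dot_eq0 x : dot x x = 0 -> x = 0.
Proof.
move=> /eqP; rewrite psumr_eq0 => [/allP h|k _]; last by rewrite -expr2 sqr_ge0.
apply/rowP => k; rewrite mxE; have := h k (mem_index_enum _).
by rewrite -expr2 sqrf_eq0 => /eqP.
Qed.

Lemma BformDl x y z : Bform (x + y) z = Bform x z + Bform y z.
Proof.
have [? [? [? [? [? [? [? [? ->]]]]]]]] := row8P x.
have [? [? [? [? [? [? [? [? ->]]]]]]]] := row8P y.
have [? [? [? [? [? [? [? [? ->]]]]]]]] := row8P z.
by rewrite add_row8 !Bform_row8; apply: R3_eq => /=; ring.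
Qed.

Lemma BformZl (r : R) x z : Bform (r *: x) z = r *: Bform x z.
Proof.
have [? [? [? [? [? [? [? [? ->]]]]]]]] := row8P x.
have [? [? [? [? [? [? [? [? ->]]]]]]]] := row8P z.
by rewrite scale_row8 !Bform_row8; apply: R3_eq; rewrite /= /GRing.scale /=; ring.
Qed.

Lemma BformC x y : Bform y x = - Bform x y.
Proof.
have [? [? [? [? [? [? [? [? ->]]]]]]]] := row8P x.
have [? [? [? [? [? [? [? [? ->]]]]]]]] := row8P y.
by rewrite !Bform_row8; apply: R3_eq => /=; ring.
Qed.

Lemma Bform_xx x : Bform x x = 0.
Proof.
have [? [? [? [? [? [? [? [? ->]]]]]]]] := row8P x.
by rewrite !Bform_row8; apply: R3_eq => /=; ring.
Qed.

Lemma imDl a b x : im (a + b) x = im a x + im b x.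
Proof.
case: a b => [[? ?] ?] [[? ?] ?].
have [? [? [? [? [? [? [? [? ->]]]]]]]] := row8P x.
by rewrite /im !lq_row8 add_row8; congr row8 => /=; ring.
Qed.
Lemma imZl (r : R) a x : im (r *: a) x = r *: im a x.
Proof.
have [? [? [? [? [? [? [? [? ->]]]]]]]] := row8P x.
by rewrite /im !lq_row8 scale_row8; congr row8; rewrite /= /GRing.scale /=; ring.
Qed.
Lemma imDr a x y : im a (x + y) = im a x + im a y.
Proof.
have [? [? [? [? [? [? [? [? ->]]]]]]]] := row8P x.
have [? [? [? [? [? [? [? [? ->]]]]]]]] := row8P y.
by rewrite /im add_row8 !lq_row8 add_row8; congr row8 => /=; ring.
Qed.
Lemma imZr (r : R) a x : im a (r *: x) = r *: im a x.
Proof.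
have [? [? [? [? [? [? [? [? ->]]]]]]]] := row8P x.
by rewrite /im scale_row8 !lq_row8 scale_row8; congr row8 => /=; ring.
Qed.
Lemma im0l x : im 0 x = 0.
Proof. by rewrite -{1}(scale0r (0 : R3)) imZl scale0r. Qed.

Lemma im_im a b x : im a (im b x) = - dot3 a b *: x + im (cross3 a b) x.
Proof.
have [? [? [? [? [? [? [? [? ->]]]]]]]] := row8P x.
rewrite /im !lq_row8 scale_row8 add_row8; congr row8;
  by rewrite /dot3 /cross3 /=; ring.
Qed.

Lemma dot_im a x y : dot (im a x) y = dot3 a (Bform x y).
Proof.
have [? [? [? [? [? [? [? [? ->]]]]]]]] := row8P x.
have [? [? [? [? [? [? [? [? ->]]]]]]]] := row8P y.
by rewrite /im lq_row8 dot_row8 Bform_row8 /dot3 /=; ring.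
Qed.

Lemma Bform_imr a x y : Bform x (im a y) = dot x y *: a + cross3 a (Bform x y).
Proof.
have [? [? [? [? [? [? [? [? ->]]]]]]]] := row8P x.
have [? [? [? [? [? [? [? [? ->]]]]]]]] := row8P y.
rewrite /im lq_row8 dot_row8 !Bform_row8; apply: R3_eq;
  by rewrite /cross3 /= /GRing.scale /=; ring.
Qed.

Lemma lqE (q0 q1 q2 q3 : R) x :
  lq ((q0 +i* q1)%C, (q2 +i* q3)%C) x = q0 *: x + im (q1, q2, q3) x.
Proof.
have [? [? [? [? [? [? [? [? ->]]]]]]]] := row8P x.
by rewrite /im !lq_row8 scale_row8 add_row8; congr row8 => /=; ring.
Qed.

Lemma imE a x : im a x = a.1.1 *: cstruct 0 x + a.1.2 *: cstruct 1 x + a.2 *: cstruct 2 x.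
Proof.
have [a0 [a1 [a2 [a3 [a4 [a5 [a6 [a7 ->]]]]]]]] := row8P x.
have /= [-> -> ->] := cstruct_row8 a0 a1 a2 a3 a4 a5 a6 a7.
by rewrite /im lq_row8 !scale_row8 !add_row8; congr row8; ring.
Qed.

Lemma lqM p q x : lq (qmul p q) x = lq p (lq q x).
Proof. by rewrite /lq ofCK sp1_actM. Qed.

Lemma toC_lq q x : toC (lq q x) = sp1_act q (toC x).
Proof. by rewrite /lq ofCK. Qed.

Lemma BformE x y : Bform x y =
  (dot (cstruct 0 x) y, dot (cstruct 1 x) y, dot (cstruct 2 x) y).
Proof. by []. Qed.

Lemma dotE x y : dot x y = \sum_k x 0 k * y 0 k.
Proof. by []. Qed.

End Coordinates.

Global Opaque dot cstruct lq im Bform.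

(** * The quaternionic Hermitian form *)

Section Hermitian.
Variable R : realType.
Local Notation R8 := 'rV[R]_8.
Local Notation R3 := (R * R * R)%type.
Implicit Types (p x y u v : R8) (a b : R3).

Definition qcoord x (i : 'I_2) : quat R := toH (toC x) 0 i.

Definition hq x y : quat R :=
  qmul (qcoord y 0) (qconj (qcoord x 0)) + qmul (qcoord y 1) (qconj (qcoord x 1)).

Lemma qcoord_row8 (a0 a1 a2 a3 a4 a5 a6 a7 : R) :
  let x := row8 a0 a1 a2 a3 a4 a5 a6 a7 in
  qcoord x 0 = ((a0 +i* a1)%C, (a2 +i* a3)%C) /\
  qcoord x 1 = ((a4 +i* a5)%C, (a6 +i* a7)%C).
Proof. by rewrite /qcoord !mxE /= !inordK. Qed.

Lemma qcoord_inj x y : (forall i, qcoord x i = qcoord y i) -> x = y.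
Proof.
have [? [? [? [? [? [? [? [? ->]]]]]]]] := row8P x.
have [? [? [? [? [? [? [? [? ->]]]]]]]] := row8P y.
move=> h; move: (h 0) (h 1); do !rewrite (proj1 (qcoord_row8 _ _ _ _ _ _ _ _)).
do !rewrite (proj2 (qcoord_row8 _ _ _ _ _ _ _ _)).
by move=> [-> -> -> ->] [-> -> -> ->].
Qed.

Lemma qcoord_lq q x i : qcoord (lq q x) i = qmul q (qcoord x i).
Proof. by rewrite /qcoord toC_lq toH_sp1_act. Qed.

Lemma hqE x y : hq x y =
  ((dot x y +i* (Bform x y).1.1)%C, ((Bform x y).1.2 +i* (Bform x y).2)%C).
Proof.
have [? [? [? [? [? [? [? [? ->]]]]]]]] := row8P x.
have [? [? [? [? [? [? [? [? ->]]]]]]]] := row8P y.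
rewrite /hq; do !rewrite (proj1 (qcoord_row8 _ _ _ _ _ _ _ _)).
do !rewrite (proj2 (qcoord_row8 _ _ _ _ _ _ _ _)).
rewrite dot_row8 Bform_row8 /qmul /qconj /=; congr (_, _);
  apply/eqP; rewrite eq_complex /=; apply/andP; split; apply/eqP; ring.
Qed.

Lemma hq0P x y : hq x y = 0 <-> dot x y = 0 /\ Bform x y = 0.
Proof.
rewrite hqE; split=> [[h1 h2 h3 h4]|[-> ->]] //=.
by split; [exact: h1|apply: R3_eq; [exact: h2|exact: h3|exact: h4]].
Qed.

(* A horizontal vector x is determined by its first coordinate, since
   x2 conj(p2) = - x1 conj(p1). *)
Lemma qmul_orthogonal (p1 p2 x1 x2 y1 y2 : quat R) :
  qmul x1 (qconj p1) + qmul x2 (qconj p2) = 0 ->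
  qmul y1 (qconj p1) + qmul y2 (qconj p2) = 0 ->
  qmul (qnorm2 p2, 0) (qmul y1 (qconj x1) + qmul y2 (qconj x2)) =
  qmul (qnorm2 p1 + qnorm2 p2, 0) (qmul y1 (qconj x1)).
Proof.
have cancel (p y x : quat R) : qmul (qmul y (qconj p)) (qconj (qmul x (qconj p))) =
    qmul (qnorm2 p, 0) (qmul y (qconj x)).
  rewrite /qmul /qconj /qnorm2 /=; congr (_, _);
    do 4!rewrite ?(rmorphD, rmorphN, rmorphM, conjc0, conjcK) /=; ring.
have qN (a b : quat R) : qmul (- a) (qconj (- b)) = qmul a (qconj b).
  by rewrite /qmul /qconj /=; congr (_, _); rewrite !(rmorphN) /= ?conjcK; ring.
move=> /eqP; rewrite addrC addr_eq0 => /eqP hx /eqP; rewrite addrC addr_eq0 => /eqP hy.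
have := cancel p2 y2 x2; rewrite hx hy qN cancel => E.
have qD (a b c : quat R) : qmul a (b + c) = qmul a b + qmul a c.
  by rewrite /qmul /=; congr (_, _); rewrite !(rmorphD) /=; ring.
rewrite qD -E; move: (qmul y1 _) (qnorm2 p1) (qnorm2 p2) => [z1 z2] n1 n2.
rewrite /qmul /= !mul0r !subr0 !addr0; apply/eqP; rewrite xpair_eqE /=.
by apply/andP; split; apply/eqP; rewrite mulrDl addrC.
Qed.

Lemma qnorm2_orthogonal (p1 p2 x1 x2 y1 y2 : quat R) : qnorm2 p2 != 0 ->
  qmul x1 (qconj p1) + qmul x2 (qconj p2) = 0 ->
  qmul y1 (qconj p1) + qmul y2 (qconj p2) = 0 ->
  qnorm2 (qmul y1 (qconj x1) + qmul y2 (qconj x2)) =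
  (qnorm2 x1 + qnorm2 x2) * (qnorm2 y1 + qnorm2 y2).
Proof.
move=> p0 hx hy.
have nr (a : quat R) : conjc (qnorm2 a) = qnorm2 a.
  by rewrite /qnorm2 !(rmorphD, rmorphM) /= !conjcK; ring.
have self z1 z2 : qmul z1 (qconj p1) + qmul z2 (qconj p2) = 0 ->
    qnorm2 p2 * (qnorm2 z1 + qnorm2 z2) = (qnorm2 p1 + qnorm2 p2) * qnorm2 z1.
  move=> hz; have := congr1 fst (qmul_orthogonal hz hz).
  by rewrite !qmulKC /qmul /= !(mul0r, subr0).
have := congr1 (@qnorm2 R) (qmul_orthogonal hx hy).
rewrite !qnorm2M qnorm2C.
have nn (s : R[i]) : conjc s = s -> qnorm2 (s, 0 : R[i]) = s ^+ 2.
  by move=> hs; rewrite /qnorm2 /= hs mul0r addr0 expr2.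
rewrite (nn _ (nr p2)) (nn (qnorm2 p1 + qnorm2 p2)); last first.
  by rewrite [conjc _](rmorphD _ (qnorm2 p1) (qnorm2 p2)) /= !nr.
move=> E.
apply: (mulfI (expf_neq0 2 p0)); rewrite E.
transitivity ((qnorm2 p2 * (qnorm2 x1 + qnorm2 x2)) * (qnorm2 p2 * (qnorm2 y1 + qnorm2 y2))).
  by rewrite !self //; ring.
by ring.
Qed.

Lemma qnorm2_real (a0 a1 a2 a3 : R) : qnorm2 ((a0 +i* a1)%C, (a2 +i* a3)%C) =
  (a0 ^+ 2 + a1 ^+ 2 + a2 ^+ 2 + a3 ^+ 2)%:C%C.
Proof.
by rewrite /qnorm2 /=; apply/eqP; rewrite eq_complex /=; apply/andP; split; apply/eqP; ring.
Qed.

Lemma qnorm2_qcoord x : qnorm2 (qcoord x 0) + qnorm2 (qcoord x 1) = (dot x x)%:C%C.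
Proof.
have [? [? [? [? [? [? [? [? ->]]]]]]]] := row8P x.
rewrite (proj1 (qcoord_row8 _ _ _ _ _ _ _ _)) (proj2 (qcoord_row8 _ _ _ _ _ _ _ _)).
by rewrite dot_row8 !qnorm2_real; apply/eqP; rewrite eq_complex /=; apply/andP; split; apply/eqP; ring.
Qed.

(** The complement of a nonzero [p] in H^2 is a quaternionic line, where |h(x,y)| = |x| |y|; the
    left side is |h(x,y)|^2 split into imaginary and real parts. *)
Lemma Bform_orthogonal_norm p x y : p != 0 -> hq p x = 0 -> hq p y = 0 ->
  dot3 (Bform x y) (Bform x y) + dot x y ^+ 2 = dot x x * dot y y.
Proof.
move=> p0 hx hy.
have key : qnorm2 (hq x y) = (dot x x)%:C%C * (dot y y)%:C%C.
  rewrite -!qnorm2_qcoord /hq.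
  (* Recovering a horizontal vector from its first coordinate requires the second coordinate of [p]
     to be nonzero; if it vanishes, the two coordinates exchange roles. *)
  have [n0|n0] := eqVneq (qnorm2 (qcoord p 1)) 0; last exact: qnorm2_orthogonal n0 hx hy.
  have n1 : qnorm2 (qcoord p 0) != 0.
    apply: contraNneq p0 => n1; have := qnorm2_qcoord p.
    rewrite n0 n1 addr0 => /eqP; rewrite eq_sym eq_complex /= eqxx andbT.
    by move=> /eqP/dot_eq0->.
  rewrite addrC [qnorm2 (qcoord x 0) + _]addrC [qnorm2 (qcoord y 0) + _]addrC.
  by apply: (qnorm2_orthogonal (p1 := qcoord p 1) n1); rewrite addrC; [exact: hx|exact: hy].
have {key} := congr1 (@complex.Re R) key; rewrite hqE qnorm2_real.
move: (Bform x y) (dot x y) (dot x x) (dot y y) => [[b1 b2] b3] d dx dy /=.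
by rewrite /dot3 /= mulr0 subr0 => <-; ring.
Qed.

End Hermitian.

(** * Quaternionic Hermitian spaces *)

(** Positivity of the right side of [Gcross_norm] when [a] and [b] are orthogonal, with D = |d|^2, x
    = |a|^2, y = |b|^2. *)
Lemma quad_gt0 (R : realFieldType) (D x y : R) : 0 <= D -> x <= 1 -> y <= 1 ->
  0 < 4 * D + (5 - 4 * x) * (5 - 4 * y).
Proof.
move=> D0 x1 y1; have : 0 < (5 - 4 * x) * (5 - 4 * y) by apply: mulr_gt0; lra.
by move: (_ * (5 - _)) => t; lra.
Qed.

Section QForm.
Variables (R : realType) (V : lmodType R).
Local Notation R3 := (R * R * R)%type.

(* The real part dt and the imaginary part B of a quaternionic Hermitian form,
   with the left action im of imaginary quaternions.  The last axiom holds
   because the quaternionic dimension is at most 2. *)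
Record qform (dt : V -> V -> R) (im : R3 -> V -> V) (B : V -> V -> R3) : Prop := QForm {
  qf_dtC : forall x y, dt x y = dt y x;
  qf_dtDl : forall x y z, dt (x + y) z = dt x z + dt y z;
  qf_dtZl : forall r x z, dt (r *: x) z = r * dt x z;
  qf_dt_ge0 : forall x, 0 <= dt x x;
  qf_dt0 : forall x, dt x x = 0 -> x = 0;
  qf_BC : forall x y, B y x = - B x y;
  qf_BDl : forall x y z, B (x + y) z = B x z + B y z;
  qf_BZl : forall r x z, B (r *: x) z = r *: B x z;
  qf_imDl : forall a b x, im (a + b) x = im a x + im b x;
  qf_imZl : forall r a x, im (r *: a) x = r *: im a x;
  qf_imDr : forall a x y, im a (x + y) = im a x + im a y;
  qf_imZr : forall r a x, im a (r *: x) = r *: im a x;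
  qf_im_im : forall a b x, im a (im b x) = - dot3 a b *: x + im (cross3 a b) x;
  qf_dt_im : forall a x y, dt (im a x) y = dot3 a (B x y);
  qf_B_im : forall a x y, B x (im a y) = dt x y *: a + cross3 a (B x y);
  qf_norm : forall p x y, p != 0 -> dt p x = 0 -> B p x = 0 -> dt p y = 0 ->
    B p y = 0 -> dot3 (B x y) (B x y) + dt x y ^+ 2 = dt x x * dt y y }.

Variables (dt : V -> V -> R) (im : R3 -> V -> V) (B : V -> V -> R3).
Hypothesis qf : qform dt im B.
Implicit Types (a b : R3) (p u v x y z : V).

Let dtC := qf_dtC qf.
Let dtDl := qf_dtDl qf.
Let dtZl := qf_dtZl qf.
Let BC := qf_BC qf.
Let BDl := qf_BDl qf.
Let BZl := qf_BZl qf.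
Let dt_im := qf_dt_im qf.
Let B_im := qf_B_im qf.

Lemma qf_dtDr x y z : dt x (y + z) = dt x y + dt x z.
Proof. by rewrite !(dtC x) dtDl. Qed.
Lemma qf_dtZr r x z : dt x (r *: z) = r * dt x z.
Proof. by rewrite !(dtC x) dtZl. Qed.
Lemma qf_dtNl x z : dt (- x) z = - dt x z.
Proof. by rewrite -scaleN1r dtZl mulN1r. Qed.
Lemma qf_dtNr x z : dt x (- z) = - dt x z.
Proof. by rewrite -scaleN1r qf_dtZr mulN1r. Qed.
Lemma qf_dt0l x : dt 0 x = 0.
Proof. by rewrite -(scale0r (0 : V)) dtZl mul0r. Qed.
Lemma qf_BDr x y z : B x (y + z) = B x y + B x z.
Proof. by rewrite (BC (y + z)) BDl opprD (BC y) (BC z). Qed.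
Lemma qf_BZr r x z : B x (r *: z) = r *: B x z.
Proof. by rewrite (BC (r *: z)) BZl -scalerN (BC z). Qed.
Lemma qf_Bxx x : B x x = 0.
Proof.
have /(congr1 (+%R^~ (B x x))) := BC x x; rewrite addNr => E.
have : (2 : R) *: B x x = 0 by rewrite -[2]/(1 + 1) scalerDl scale1r.
by move/eqP; rewrite scaler_eq0 pnatr_eq0 => /eqP.
Qed.
Lemma qf_imNl a x : im (- a) x = - im a x.
Proof. by rewrite -[- a]scaleN1r (qf_imZl qf) scaleN1r. Qed.
Lemma qf_im0l x : im 0 x = 0.
Proof. by rewrite -(scale0r (0 : R3)) (qf_imZl qf) scale0r. Qed.

Let dtE := (dtDl, qf_dtDr, qf_dtNl, qf_dtNr, dtZl, qf_dtZr).

Lemma qf_dt_im_im a b x y :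
  dt (im a x) (im b y) = dot3 a b * dt x y + dot3 a (cross3 b (B x y)).
Proof. by rewrite dt_im B_im /dot3 /= /GRing.scale /=; ring. Qed.

Lemma qf_B_im_self p a : dt p p = 1 -> B p (im a p) = a.
Proof.
move=> p1; rewrite B_im qf_Bxx p1 scale1r; case: a => [[? ?] ?].
by apply: R3_eq; rewrite /cross3 /=; ring.
Qed.

Lemma qf_dt_im_self p a : dt p (im a p) = 0.
Proof. by rewrite dtC dt_im qf_Bxx /dot3 /= !mulr0 !addr0. Qed.

Definition qf_hor p u : V := u - im (B p u) p.

Lemma qf_dt_hor p u v : dt p p = 1 ->
  dt (qf_hor p u) (qf_hor p v) = dt u v - dot3 (B p u) (B p v).
Proof.
move=> p1; rewrite /qf_hor !dtE (dtC u (im _ _)) !dt_im qf_B_im_self //.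
by rewrite (dot3C (B p v)); ring.
Qed.

Lemma qf_B_hor p u v : dt p p = 1 -> dt p u = 0 -> dt p v = 0 ->
  B (qf_hor p u) (qf_hor p v) = B u v - cross3 (B p u) (B p v).
Proof.
move=> p1 pu pv.
rewrite /qf_hor -!qf_imNl BDl !qf_BDr (BC v (im _ _)) !B_im (BC p (im _ _)) qf_B_im_self //.
rewrite (dtC u p) pu (dtC v p) pv dt_im qf_Bxx (BC p u) (BC p v).
move: (B p u) (B p v) (B u v) => [[? ?] ?] [[? ?] ?] [[? ?] ?].
by apply: R3_eq; rewrite /cross3 /dot3 /= /GRing.scale /=; ring.
Qed.

(** This is [qf_norm] for the horizontal parts of [u] and [v]; quaternionic dimension 2 enters the
    abstract argument only here. *)
Lemma qf_B_norm p u v : dt p p = 1 -> dt p u = 0 -> dt p v = 0 ->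
  let a := B p u in let b := B p v in let d := B u v - cross3 a b in
  dot3 d d + (dt u v - dot3 a b) ^+ 2 = (dt u u - dot3 a a) * (dt v v - dot3 b b).
Proof.
move=> p1 pu pv a b d.
have hor w : dt p w = 0 -> dt p (qf_hor p w) = 0.
  by move=> pw; rewrite !dtE qf_dt_im_self pw subrr.
have horB w : B p (qf_hor p w) = 0.
  by rewrite /qf_hor -scaleN1r qf_BDr qf_BZr qf_B_im_self // scaleN1r subrr.
have p0 : p != 0 by apply: contra_eqN p1 => /eqP->; rewrite qf_dt0l eq_sym oner_eq0.
have := qf_norm qf p0 (hor u pu) (horB u) (hor v pv) (horB v).
by rewrite !qf_dt_hor // qf_B_hor.
Qed.

(* Up to a scalar, the cross product of u and v for the G2-structure on the
   tangent space at p of the squashed sphere. *)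
Definition Gcross p u v : V :=
  im (5 *: B u v - 8 *: cross3 (B p u) (B p v)) p + im (B p u) v - im (B p v) u.

(** As [d] is B(p, G) for the cross product G, this is the identity |u x v|^2 = |u|^2 |v|^2 -
    (u.v)^2 for the form 5 dt - 4 B(p,.).B(p,.). It is a consequence of 25 times [qf_B_norm]. *)
Lemma Gcross_norm p u v : dt p p = 1 -> dt p u = 0 -> dt p v = 0 ->
  dt u u = 1 -> dt v v = 1 -> dt u v = 0 ->
  let a := B p u in let b := B p v in
  let d := 5 *: B u v - 6 *: cross3 a b in
  5 * dt (Gcross p u v) (Gcross p u v) =
  4 * dot3 d d + (5 - 4 * dot3 a a) * (5 - 4 * dot3 b b) - 16 * dot3 a b ^+ 2.
Proof.
move=> p1 pu pv u1 v1 uv a b d; have := qf_B_norm p1 pu pv.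
rewrite /= u1 v1 uv /d /Gcross -/a -/b.
rewrite -[- im b u]qf_imNl !dtE !qf_dt_im_im.
rewrite (dtC v p) (dtC u p) (dtC v u) p1 pu pv u1 v1 uv !qf_Bxx.
rewrite (BC p u) (BC p v) (BC u v) -/a -/b.
move: a b (B u v) {d} => [[a1 a2] a3] [[b1 b2] b3] [[c1 c2] c3].
rewrite /dot3 /cross3 /= /GRing.scale /= => /(congr1 (fun t : R => 25 * t)) /eqP.
rewrite -subr_eq0 => /eqP E.
by apply/eqP; rewrite -subr_eq0; apply/eqP; rewrite -[RHS]E; ring.
Qed.

Lemma qf_ext x y : (forall z, dt x z = dt y z) -> x = y.
Proof.
move=> h; apply/eqP; rewrite -subr_eq0; apply/eqP/(qf_dt0 qf).
by rewrite dtDl qf_dtNl h subrr.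
Qed.

(* B(e_i, e_{i+1}) = m_{i+2} n_{i+2}: the vectors n_i, e_i and the scalars m_i are
   a singular value decomposition of B on the span of the e_i. *)
Definition svd_frame e1 e2 e3 (n1 n2 n3 : R3) (m1 m2 m3 : R) :=
  [/\ posframe n1 n2 n3, [/\ dt e1 e1 = 1, dt e2 e2 = 1 & dt e3 e3 = 1],
      [/\ dt e1 e2 = 0, dt e2 e3 = 0 & dt e3 e1 = 0]
    & [/\ B e2 e3 = m1 *: n1, B e3 e1 = m2 *: n2 & B e1 e2 = m3 *: n3]].

Lemma svd_frame_cycle e1 e2 e3 n1 n2 n3 m1 m2 m3 :
  svd_frame e1 e2 e3 n1 n2 n3 m1 m2 m3 -> svd_frame e2 e3 e1 n2 n3 n1 m2 m3 m1.
Proof. by case=> /posframe_cycle ? [? ? ?] [? ? ?] [? ? ?]. Qed.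

Section SVDFrame.
Variables (e1 e2 e3 : V) (n1 n2 n3 : R3) (m1 m2 m3 : R).
Hypothesis fr : svd_frame e1 e2 e3 n1 n2 n3 m1 m2 m3.

(** Apart from the term in c s, the value is c^2 times that at (1, 0) plus s^2 times that at (0, 1).
    The mixed term is thus a new vector of the plane. *)
Lemma Gcross_svd_frame (c s : R) : c ^+ 2 + s ^+ 2 = 1 ->
  Gcross (c *: e1 + s *: e2) (- s *: e1 + c *: e2) e3 =
  (c ^+ 2 * (5 * m1 - 8 * m2 * m3) + s ^+ 2 * m1) *: im n1 e1
  + (s ^+ 2 * (5 * m2 - 8 * m1 * m3) + c ^+ 2 * m2) *: im n2 e2 + m3 *: im n3 e3
  + (4 * c * s) *: ((m1 - 2 * m2 * m3) *: im n1 e2 + (m2 - 2 * m1 * m3) *: im n2 e1).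
Proof.
move=> cs; have [pf _ _ [B1 B2 B3]] := fr; have [_ _ _ N3] := pf.
have [_ _ _ N1] := posframe_cycle pf.
have [_ _ _ N2] := posframe_cycle (posframe_cycle pf).
have Epu : B (c *: e1 + s *: e2) (- s *: e1 + c *: e2) = m3 *: n3.
  rewrite BDl !qf_BDr !BZl !qf_BZr !qf_Bxx (BC e1 e2) B3 !scaler0 addr0 add0r.
  rewrite -[RHS]scale1r -cs; move: (m3 *: n3) => b.
  by apply: R3_eq; rewrite /= /GRing.scale /=; ring.
have Epv : B (c *: e1 + s *: e2) e3 = (s * m1) *: n1 - (c * m2) *: n2.
  rewrite BDl !BZl (BC e3 e1) B1 B2.
  by apply: R3_eq; rewrite /= /GRing.scale /=; ring.
have Euv : B (- s *: e1 + c *: e2) e3 = (c * m1) *: n1 + (s * m2) *: n2.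
  rewrite BDl !BZl (BC e3 e1) B1 B2.
  by apply: R3_eq; rewrite /= /GRing.scale /=; ring.
have Ex : cross3 (m3 *: n3) ((s * m1) *: n1 - (c * m2) *: n2) =
    (c * m2 * m3) *: n1 + (s * m1 * m3) *: n2.
  transitivity ((c * m2 * m3) *: cross3 n2 n3 + (s * m1 * m3) *: cross3 n3 n1).
    by apply: R3_eq; rewrite /cross3 /= /GRing.scale /=; ring.
  by rewrite -N1 -N2.
apply: qf_ext => z; rewrite /Gcross Epu Epv Euv Ex !dtE !dt_im !BDl !BZl.
move: (B e1 z) (B e2 z) (B e3 z) => [[? ?] ?] [[? ?] ?] [[? ?] ?].
by rewrite /dot3 /= /GRing.scale /=; ring.
Qed.

Lemma svd_frame_table :
  [/\ dot3 n1 n1 = 1, dot3 n2 n2 = 1 & dot3 n3 n3 = 1] /\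
  [/\ dot3 n1 n2 = 0, dot3 n2 n3 = 0 & dot3 n3 n1 = 0] /\
  [/\ cross3 n1 n2 = n3, cross3 n2 n3 = n1 & cross3 n3 n1 = n2].
Proof.
have [pf _ _ _] := fr; have [d1 d2 d12 N3] := pf.
have [_ d3 d23 N1] := posframe_cycle pf.
by have [_ _ d31 N2] := posframe_cycle (posframe_cycle pf).
Qed.

Lemma svd_frame_dot_le1 : m3 ^+ 2 <= 1.
Proof.
have [_ [h1 h2 _] [h12 _ _] [_ _ B3]] := fr.
have [[d1 d2 d3] [_ _]] := svd_frame_table.
have := qf_dt_ge0 qf (e2 - m3 *: im n3 e1).
rewrite !dtE (dtC e2 (im _ _)) dt_im qf_dt_im_im qf_Bxx h1 h2 d3 B3.
have -> : dot3 n3 (m3 *: n3) = m3 * dot3 n3 n3.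
  by rewrite /dot3 /= /GRing.scale /=; ring.
have -> : dot3 n3 (cross3 n3 0) = 0 by rewrite /dot3 /cross3 /=; ring.
by rewrite d3; lra.
Qed.

(** In such a frame |e2 - m3 n3 e1|^2 = 1 - m3^2. *)
Lemma svd_frame_extremal : m3 ^+ 2 = 1 -> e2 = m3 *: im n3 e1.
Proof.
move=> h; have [_ [h1 h2 _] [h12 _ _] [_ _ B3]] := fr.
have [[d1 d2 d3] [_ _]] := svd_frame_table.
apply/eqP; rewrite -subr_eq0; apply/eqP/(qf_dt0 qf).
rewrite !dtE (dtC e2 (im _ _)) dt_im qf_dt_im_im qf_Bxx h1 h2 d3 B3.
have -> : dot3 n3 (m3 *: n3) = m3 * dot3 n3 n3.
  by rewrite /dot3 /= /GRing.scale /=; ring.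
have -> : dot3 n3 (cross3 n3 0) = 0 by rewrite /dot3 /cross3 /=; ring.
by rewrite d3; lra.
Qed.

(** [qf_B_norm] at p = e1 reads (m1 - m2 m3)^2 = (1 - m2^2)(1 - m3^2). *)
Lemma svd_frame_rel : 1 - m1 ^+ 2 - m2 ^+ 2 - m3 ^+ 2 + 2 * m1 * m2 * m3 = 0.
Proof.
have [_ [h1 h2 h3] [h12 h23 h31] [B1 B2 B3]] := fr.
have [[d1 d2 d3] [[d12 d23 d31] [c12 c23 c31]]] := svd_frame_table.
have h13 : dt e1 e3 = 0 by rewrite dtC.
have := qf_B_norm h1 h12 h13; rewrite /= h2 h3 h23 (BC e3 e1) B1 B2 B3.
have -> : m1 *: n1 - cross3 (m3 *: n3) (- (m2 *: n2)) = (m1 - m2 * m3) *: n1.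
  transitivity (m1 *: n1 - (m2 * m3) *: cross3 n2 n3); last by rewrite c23 -scalerBl.
  by congr (_ - _); apply: R3_eq; rewrite /cross3 /= /GRing.scale /=; ring.
have dE (r s : R) (n n' : R3) : dot3 (r *: n) (s *: n') = r * s * dot3 n n'.
  by rewrite /dot3 /= /GRing.scale /=; ring.
by rewrite -[- (m2 *: n2)]scaleNr !dE (dot3C n3 n2) d1 d2 d3 d23; lra.
Qed.

Hypothesis P : V -> Prop.
Hypothesis PD : forall x y, P x -> P y -> P (x + y).
Hypothesis PZ : forall (r : R) x, P x -> P (r *: x).
Hypothesis Pe : [/\ P e1, P e2 & P e3].
Hypothesis PG : forall p u v, P p -> P u -> P v -> dt p p = 1 -> dt u u = 1 ->
  dt v v = 1 -> dt p u = 0 -> dt p v = 0 -> dt u v = 0 -> P (Gcross p u v).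
(** The form in which dim P <= 4 is used: the part of [P] orthogonal to the frame is at most a
    line. *)
Hypothesis P4 : forall x y, P x -> P y -> (dt x e1 = 0 /\ dt x e2 = 0 /\ dt x e3 = 0) ->
  (dt y e1 = 0 /\ dt y e2 = 0 /\ dt y e3 = 0) -> dt x y = 0 -> x = 0 \/ y = 0.

Lemma svd_frame_Gcross_in (c s : R) : c ^+ 2 + s ^+ 2 = 1 ->
  P (Gcross (c *: e1 + s *: e2) (- s *: e1 + c *: e2) e3).
Proof.
move=> cs; have [_ [h1 h2 h3] [h12 h23 h31] _] := fr; have [P1 P2 P3] := Pe.
by apply: PG; rewrite ?dtE ?(dtC e2 e1) ?(dtC e1 e3) ?h1 ?h2 ?h3 ?h12 ?h23 ?h31;
  try (by []); try (by apply: PD; apply: PZ); try (by ring); rewrite -[RHS]cs; ring.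
Qed.

Lemma svd_frame_normal : P ((5 * m1 - 8 * m2 * m3) *: im n1 e1 + m2 *: im n2 e2 + m3 *: im n3 e3).
Proof.
have cs : 1 ^+ 2 + 0 ^+ 2 = 1 :> R by ring.
have := svd_frame_Gcross_in cs; rewrite Gcross_svd_frame //.
by rewrite expr1n expr0n /= !mul1r !mul0r mulr0 scale0r !addr0 add0r.
Qed.

(** [N], the cross product of the frame, is a nonzero normal to the frame inside [P]. The mixed
    vector [Y] is orthogonal to [N], e1 and e2, so in dimension 4 it must be a multiple of e3; the
    equation says that its component off e3 has norm 0. *)
Lemma svd_frame_eq : let k1 := m1 - 2 * m2 * m3 in let k2 := m2 - 2 * m1 * m3 in
  k1 ^+ 2 * (1 - m1 ^+ 2) + k2 ^+ 2 * (1 - m2 ^+ 2) = 2 * k1 * k2 * (m3 - m1 * m2).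
Proof.
move=> k1 k2.
have [_ [h1 h2 h3] [h12 h23 h31] [B1 B2 B3]] := fr.
have [[d1 d2 d3] [[d12 d23 d31] [c12 c23 c31]]] := svd_frame_table.
have h21 : dt e2 e1 = 0 by rewrite dtC.
have h32 : dt e3 e2 = 0 by rewrite dtC.
have h13 : dt e1 e3 = 0 by rewrite dtC.
have C1 : B e3 e2 = - m1 *: n1 by rewrite BC B1 scaleNr.
have C2 : B e1 e3 = - m2 *: n2 by rewrite BC B2 scaleNr.
have C3 : B e2 e1 = - m3 *: n3 by rewrite BC B3 scaleNr.
have d21 : dot3 n2 n1 = 0 by rewrite dot3C.
have d32 : dot3 n3 n2 = 0 by rewrite dot3C.
have d13 : dot3 n1 n3 = 0 by rewrite dot3C.
have crC a b : cross3 a b = - 1 *: cross3 b a.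
  by apply: R3_eq; rewrite /cross3 /= /GRing.scale /=; ring.
have c21 : cross3 n2 n1 = -1 *: n3 by rewrite crC c12.
have c32 : cross3 n3 n2 = -1 *: n1 by rewrite crC c23.
have c13 : cross3 n1 n3 = -1 *: n2 by rewrite crC c31.
have cxx a : cross3 a a = 0 by apply: R3_eq; rewrite /cross3 /=; ring.
have crZ (r : R) a b : cross3 a (r *: b) = r *: cross3 a b.
  by apply: R3_eq; rewrite /cross3 /= /GRing.scale /=; ring.
have cr0 a : cross3 a 0 = 0 by apply: R3_eq; rewrite /cross3 /=; ring.
have dZ (r : R) a b : dot3 a (r *: b) = r * dot3 a b.
  by rewrite /dot3 /= /GRing.scale /=; ring.
have d0 a : dot3 a 0 = 0 by rewrite /dot3 /=; ring.
pose tab := (h1, h2, h3, h12, h23, h31, h21, h32, h13, B1, B2, B3, C1, C2, C3,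
  d1, d2, d3, d12, d23, d31, d21, d32, d13, c12, c23, c31, c21, c32, c13, qf_Bxx, cxx, crZ, cr0, dZ, d0).
pose Y := k1 *: im n1 e2 + k2 *: im n2 e1.
pose N := (5 * m1 - 8 * m2 * m3) *: im n1 e1 + m2 *: im n2 e2 + m3 *: im n3 e3.
have [P1 P2 P3] := Pe.
have PN : P N by exact: svd_frame_normal.
have PY : P Y.
  pose G (c s : R) := Gcross (c *: e1 + s *: e2) (- s *: e1 + c *: e2) e3.
  (* The rational rotation (3/5, 4/5) has c^2 = 9/25, s^2 = 16/25 and 4 c s = 48/25, so subtracting
     the pure terms leaves 48/25 times [Y]. *)
  have -> : Y = (25 / 48) *: (G (3 / 5) (4 / 5) + ((- (9 / 25)) *: G 1 0 + (- (16 / 25)) *: G 0 1)).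
    apply: qf_ext => z; rewrite /G !Gcross_svd_frame; try by field.
    rewrite /Y !dtE -/k1 -/k2.
    by move: (dt (im n1 e1) z) (dt (im n2 e2) z) (dt (im n3 e3) z) (dt (im n1 e2) z) (dt (im n2 e1) z) => *; field.
  by apply: PZ; apply: PD; [|apply: PD; apply: PZ]; apply: svd_frame_Gcross_in; field.
(* The subtracted coefficient is the inner product of [Y] with e3. *)
pose Y' := Y + (- (k1 * m1 - k2 * m2)) *: e3.
have PY' : P Y' by apply: PD => //; exact: PZ.
have Y0 : Y' = 0.
  have [] // := P4 PY' PN.
  - by do !split; rewrite /Y' /Y !dtE !dt_im !tab; ring.
  - by do !split; rewrite /N !dtE !dt_im !tab; ring.
  - rewrite /Y' /Y /N !dtE !qf_dt_im_im (dtC e3 (im n1 _)) (dtC e3 (im n2 _)) (dtC e3 (im n3 _)).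
    by rewrite !dt_im; rewrite !tab; ring.
  (* The alternative N = 0 is impossible: B(e1,e2) and B(e1,e3) are orthogonal of norm at most 1, so
     [quad_gt0] makes the norm of the cross product positive. *)
  move=> N0; have := Gcross_norm h1 h12 h13 h2 h3 h23.
  have -> : Gcross e1 e2 e3 = N.
    have := Gcross_svd_frame (c := 1) (s := 0); rewrite !scale1r oppr0 !scale0r !addr0 !add0r => ->.
      by rewrite expr1n expr0n /= !mul1r !mul0r mulr0 scale0r !addr0 add0r.
    by ring.
  rewrite /= N0 qf_dt0l mulr0 C2 B3; move: (5 *: _ - 6 *: _) => d.
  have -> : dot3 (m3 *: n3) (- m2 *: n2) = 0 by rewrite dZ dot3C dZ d23 !mulr0.
  have -> : dot3 (m3 *: n3) (m3 *: n3) = m3 ^+ 2 by rewrite dZ dot3C dZ d3; ring.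
  have -> : dot3 (- m2 *: n2) (- m2 *: n2) = m2 ^+ 2 by rewrite dZ dot3C dZ d2; ring.
  have m3_le := svd_frame_dot_le1.
  have m2_le : m2 ^+ 2 <= 1.
    have := qf_dt_ge0 qf (e1 - m2 *: im n2 e3).
    rewrite !dtE (dtC e1 (im _ _)) dt_im qf_dt_im_im; rewrite !tab.
    lra.
  have := dot3_ge0 d; move: (dot3 d d) m3_le m2_le => D.
  by move=> x1 y1 D0 E; have := quad_gt0 D0 x1 y1; rewrite {1}E expr0n /= mulr0 subr0 ltxx.
have : dt Y' Y' = 0 by rewrite Y0 qf_dt0l.
rewrite /Y' /Y !dtE !qf_dt_im_im (dtC e3 (im n1 _)) (dtC e3 (im n2 _)) !dt_im.
rewrite !tab => E.
apply/eqP; rewrite -subr_eq0; apply/eqP; rewrite -[RHS]E; ring.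
Qed.

End SVDFrame.

End QForm.

(* With m_i = cos t_i and t_1 + t_2 + t_3 = 0, the hypotheses say that the numbers
   k_i sin t_i have pairwise vanishing sums, hence vanish. *)
Lemma singular_values_cases (R : realFieldType) (m1 m2 m3 : R) :
  let k1 := m1 - 2 * m2 * m3 in let k2 := m2 - 2 * m3 * m1 in
  let k3 := m3 - 2 * m1 * m2 in
  1 - m1 ^+ 2 - m2 ^+ 2 - m3 ^+ 2 + 2 * m1 * m2 * m3 = 0 ->
  k1 ^+ 2 * (1 - m1 ^+ 2) + k2 ^+ 2 * (1 - m2 ^+ 2) = 2 * k1 * k2 * (m3 - m1 * m2) ->
  k2 ^+ 2 * (1 - m2 ^+ 2) + k3 ^+ 2 * (1 - m3 ^+ 2) = 2 * k2 * k3 * (m1 - m2 * m3) ->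
  k3 ^+ 2 * (1 - m3 ^+ 2) + k1 ^+ 2 * (1 - m1 ^+ 2) = 2 * k3 * k1 * (m2 - m3 * m1) ->
  [\/ [/\ m1 ^+ 2 = 1, m2 ^+ 2 = 1 & m3 ^+ 2 = 1],
      [/\ m1 ^+ 2 = 1, m2 = 0 & m3 = 0],
      [/\ m2 ^+ 2 = 1, m3 = 0 & m1 = 0]
    | [/\ m3 ^+ 2 = 1, m1 = 0 & m2 = 0]].
Proof.
move=> k1 k2 k3 rel; set x1 := k1 ^+ 2 * _; set x2 := k2 ^+ 2 * _; set x3 := k3 ^+ 2 * _.
move=> e12 e23 e31.
(* By the relation, (c - a b)^2 = (1 - a^2)(1 - b^2), so (y + z)^2 = 4 y z. *)
have same (a b c j l y z : R) : 1 - a ^+ 2 - b ^+ 2 - c ^+ 2 + 2 * a * b * c = 0 ->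
    y = j ^+ 2 * (1 - a ^+ 2) -> z = l ^+ 2 * (1 - b ^+ 2) ->
    y + z = 2 * j * l * (c - a * b) -> y = z.
  move=> r Ey Ez E; apply/eqP; rewrite -subr_eq0 -sqrf_eq0; apply/eqP.
  transitivity ((y + z) ^+ 2 - 4 * y * z); first by ring.
  rewrite E Ey Ez; transitivity ((-4) * j ^+ 2 * l ^+ 2 * (1 - a ^+ 2 - b ^+ 2 - c ^+ 2 + 2 * a * b * c)).
    by ring.
  by rewrite r mulr0.
have x12 : x1 = x2 by apply: (same _ _ _ _ _ _ _ rel erefl erefl).
have x23 : x2 = x3.
  by apply: (same m2 m3 m1 k2 k3) => //; rewrite -[RHS]rel; ring.
have x0 : x1 = 0.
  have h1 : x1 = k1 * k2 * (m3 - m1 * m2) by move: e12; rewrite -x12; lra.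
  have h2 : x1 = k2 * k3 * (m1 - m2 * m3) by move: e23; rewrite -x23 -x12; lra.
  have h3 : x1 = k3 * k1 * (m2 - m3 * m1) by move: e31; rewrite -x23 -x12; lra.
  have E1 : x1 ^+ 3 = k1 * k2 * (m3 - m1 * m2) * (k2 * k3 * (m1 - m2 * m3)) * (k3 * k1 * (m2 - m3 * m1)).
    by rewrite -h1 -h2 -h3; ring.
  have E2 : x1 ^+ 3 = x1 * x2 * x3 by rewrite -x23 -x12; ring.
  (* The three factors m_k - m_i m_j stand for - sin t_i sin t_j, so their product is the negative
     of the product of the 1 - m_i^2 modulo the relation: x1^3 is its own opposite. *)
  have : x1 ^+ 3 + x1 ^+ 3 = (k1 * k2 * k3) ^+ 2 * (1 - m1 * m2 * m3)
      * (1 - m1 ^+ 2 - m2 ^+ 2 - m3 ^+ 2 + 2 * m1 * m2 * m3).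
    by rewrite {1}E1 E2 /x1 /x2 /x3; ring.
  rewrite rel mulr0 => /eqP; rewrite -mulr2n mulrn_eq0 /= expf_eq0 /=.
  by move/eqP.
have alt (k m x : R) : x = k ^+ 2 * (1 - m ^+ 2) -> x = 0 -> k = 0 \/ m ^+ 2 = 1.
  move=> -> /eqP; rewrite mulf_eq0 sqrf_eq0 => /orP[/eqP|]; first by left.
  by rewrite subr_eq0 eq_sym => /eqP; right.
have a1 := alt k1 m1 x1 erefl x0.
have a2 : k2 = 0 \/ m2 ^+ 2 = 1 by apply: (alt _ _ x2) => //; rewrite -x12.
have a3 : k3 = 0 \/ m3 ^+ 2 = 1 by apply: (alt _ _ x3) => //; rewrite -x23 -x12.
(* If a^2 = 1, the relation forces c = a b, and then b - 2 c a = - b. *)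
have one (a b c : R) : a ^+ 2 = 1 -> 1 - a ^+ 2 - b ^+ 2 - c ^+ 2 + 2 * a * b * c = 0 ->
   b - 2 * c * a = 0 \/ b ^+ 2 = 1 -> (b ^+ 2 = 1 /\ c ^+ 2 = 1) \/ (b = 0 /\ c = 0).
  move=> a1' r ab; have E : c = a * b.
    apply/eqP; rewrite -subr_eq0 -sqrf_eq0; apply/eqP.
    transitivity ((a ^+ 2 - 1) * b ^+ 2 + 1 - a ^+ 2 - (1 - a ^+ 2 - b ^+ 2 - c ^+ 2 + 2 * a * b * c)).
      by ring.
    by rewrite r a1'; ring.
  case: ab => h; last by left; split=> //; rewrite E exprMn a1' h mulr1.
  have b0 : b = 0.
    transitivity (- (b - 2 * c * a) - 2 * b * (a ^+ 2 - 1)); first by rewrite E; ring.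
    by rewrite h a1'; ring.
  by right; split=> //; rewrite E b0 mulr0.
have [q1|q1] := eqVneq (m1 ^+ 2) 1.
  case: (one m1 m2 m3 q1) => [||[]|[]]; try by []; try by constructor 1.
  by constructor 2.
have [q2|q2] := eqVneq (m2 ^+ 2) 1.
  case: (one m2 m3 m1 q2) => [||[]|[]]; try by []; try by constructor 1.
  - by rewrite -[RHS]rel; ring.
  - by constructor 3.
have [q3|q3] := eqVneq (m3 ^+ 2) 1.
  case: (one m3 m1 m2 q3) => [||[]|[]]; try by [].
  - by rewrite -[RHS]rel; ring.
  - by move=> q; rewrite q eqxx in q1.
  - by constructor 4.
case: a1 => [a1|a1]; last by rewrite a1 eqxx in q1.
case: a2 => [a2|a2]; last by rewrite a2 eqxx in q2.
case: a3 => [a3|a3]; last by rewrite a3 eqxx in q3.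
(* If all k_i vanish, each m_i^2 is 2 t; the relation gives t = 1/4, against t^2 = (2 t)^3. *)
exfalso; pose t := m1 * m2 * m3.
have f1 : m1 ^+ 2 = 2 * t.
  by apply/eqP; rewrite -subr_eq0; apply/eqP; transitivity (m1 * k1); [rewrite /k1 /t|rewrite a1]; ring.
have f2 : m2 ^+ 2 = 2 * t.
  by apply/eqP; rewrite -subr_eq0; apply/eqP; transitivity (m2 * k2); [rewrite /k2 /t|rewrite a2]; ring.
have f3 : m3 ^+ 2 = 2 * t.
  by apply/eqP; rewrite -subr_eq0; apply/eqP; transitivity (m3 * k3); [rewrite /k3 /t|rewrite a3]; ring.
have g1 : t = 1 / 4.
  have : 1 - m1 ^+ 2 - m2 ^+ 2 - m3 ^+ 2 + 2 * t = 0 by rewrite -[RHS]rel /t; ring.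
  by rewrite f1 f2 f3; lra.
have : t ^+ 2 = (2 * t) ^+ 3.
  by transitivity (m1 ^+ 2 * m2 ^+ 2 * m3 ^+ 2); [rewrite /t|rewrite f1 f2 f3]; ring.
by rewrite g1; lra.
Qed.

(** * Subspaces closed under the cross product *)

Section Classification.
Variables (R : realType) (V : lmodType R).
Local Notation R3 := (R * R * R)%type.
Variables (dt : V -> V -> R) (im : R3 -> V -> V) (B : V -> V -> R3).
Hypothesis qf : qform dt im B.
Variable P : V -> Prop.
Hypothesis PD : forall x y, P x -> P y -> P (x + y).
Hypothesis PZ : forall (r : R) x, P x -> P (r *: x).
Hypothesis PG : forall p u v, P p -> P u -> P v -> dt p p = 1 -> dt u u = 1 ->
  dt v v = 1 -> dt p u = 0 -> dt p v = 0 -> dt u v = 0 -> P (Gcross im B p u v).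
Hypothesis Pspan : forall e1 e2 e3 e4, P e1 -> P e2 -> P e3 -> P e4 ->
  [/\ dt e1 e1 = 1, dt e2 e2 = 1, dt e3 e3 = 1 & dt e4 e4 = 1] ->
  [/\ dt e1 e2 = 0, dt e1 e3 = 0 & dt e1 e4 = 0] ->
  [/\ dt e2 e3 = 0, dt e2 e4 = 0 & dt e3 e4 = 0] ->
  forall x, P x -> exists r1 r2 r3 r4, x = r1 *: e1 + r2 *: e2 + r3 *: e3 + r4 *: e4.

Definition quaternionic_line e := dt e e = 1 /\
  forall x, P x <-> exists r a, x = r *: e + im a e.

Definition complex_plane n e f :=
  [/\ dot3 n n = 1, dt e e = 1, dt f f = 1, dt e f = 0 /\ B e f = 0 &
   forall x, P x <-> exists r s r' s',
     x = r *: e + s *: im n e + r' *: f + s' *: im n f].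

Let dtC := qf_dtC qf.
Let dtDl := qf_dtDl qf.
Let dtZl := qf_dtZl qf.
Let BC := qf_BC qf.
Let BDl := qf_BDl qf.
Let BZl := qf_BZl qf.
Let dt_im := qf_dt_im qf.
Let dtDr := qf_dtDr qf.
Let dtZr := qf_dtZr qf.

Lemma span4_orthogonal e1 e2 e3 x y : P e1 -> P e2 -> P e3 -> P x -> P y ->
  [/\ dt e1 e1 = 1, dt e2 e2 = 1 & dt e3 e3 = 1] ->
  [/\ dt e1 e2 = 0, dt e2 e3 = 0 & dt e3 e1 = 0] ->
  (dt x e1 = 0 /\ dt x e2 = 0 /\ dt x e3 = 0) ->
  (dt y e1 = 0 /\ dt y e2 = 0 /\ dt y e3 = 0) -> dt x y = 0 -> x = 0 \/ y = 0.
Proof.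
move=> P1 P2 P3 Px Py [h1 h2 h3] [h12 h23 h31] [x1 [x2 x3]] [y1 [y2 y3]] xy.
have [->|x0] := eqVneq x 0; [by left|right].
have d0 : 0 < dt x x.
  by rewrite lt0r (qf_dt_ge0 qf) andbT; apply: contraNneq x0 => /(qf_dt0 qf)->.
pose r := (Num.sqrt (dt x x))^-1.
have rx : dt (r *: x) (r *: x) = 1.
  rewrite dtZl dtZr mulrA -expr2 exprVn sqr_sqrtr ?mulVf ?gt_eqF //; exact: ltW.
have [] := Pspan P1 P2 P3 (PZ r Px) (And4 h1 h2 h3 rx) _ _ Py.
- by split; rewrite ?dtZr // dtC ?h31 ?dtZl ?x1 ?mulr0.
- by split; rewrite ?dtZr // dtC ?dtZl ?x2 ?x3 ?mulr0.
move=> r1 [r2 [r3 [r4 E]]]; apply: (qf_dt0 qf); rewrite {2}E !dtDr !dtZr y1 y2 y3 (dtC y x) xy.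
by rewrite !mulr0 !addr0.
Qed.

(** An alternating map on an oriented Euclidean 3-space is a linear map L of the cross product: B(f
    v, f w) = L(v x w). [svd3] for L gives the frames, as o1 x o2 = o3 cyclically. *)
Lemma exists_svd_frame e1 e2 e3 : P e1 -> P e2 -> P e3 ->
  [/\ dt e1 e1 = 1, dt e2 e2 = 1 & dt e3 e3 = 1] ->
  [/\ dt e1 e2 = 0, dt e2 e3 = 0 & dt e3 e1 = 0] ->
  exists f1 f2 f3 n1 n2 n3 m1 m2 m3, [/\ P f1, P f2, P f3 &
    svd_frame dt B f1 f2 f3 n1 n2 n3 m1 m2 m3].
Proof.
move=> P1 P2 P3 [h1 h2 h3] [h12 h23 h31].
have [ o1 [ o2 [ o3 [n1 [n2 [n3 [m1 [m2 [m3 [fo fn E1 E2 E3]]]]]]]]]] := svd3 (B e2 e3) (B e3 e1) (B e1 e2).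
pose f (v : R3) : V := v.1.1 *: e1 + v.1.2 *: e2 + v.2 *: e3.
have fP (v : R3) : P (f v) by do !apply: PD; apply: PZ.
have fdt v w : dt (f v) (f w) = dot3 v w.
  rewrite /f !(dtDl, dtDr, dtZl, dtZr) h1 h2 h3 h12 h23 h31.
  by rewrite (dtC e2 e1) (dtC e3 e2) (dtC e1 e3) h12 h23 h31 /dot3; ring.
have fB v w : B (f v) (f w) = lin3 (B e2 e3) (B e3 e1) (B e1 e2) (cross3 v w).
  rewrite /f !(BDl, qf_BDr qf, BZl, qf_BZr qf) !(qf_Bxx qf).
  rewrite (BC e1 e2) (BC e2 e3) (BC e3 e1) /lin3.
  by apply: R3_eq; rewrite /cross3 /= /GRing.scale /=; ring.
have [q1 q2 q12 q3] := fo; have [_ q3' q23 q1'] := posframe_cycle fo.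
have [_ _ q31 q2'] := posframe_cycle (posframe_cycle fo).
exists (f o1), (f o2), (f o3), n1, n2, n3, m1, m2, m3; split; try exact: fP.
by split=> //; split; rewrite ?fdt // fB -?q1' -?q2' -?q3.
Qed.

(** Extremality puts e2 and e3 on the quaternionic line of e1. The missing direction n1 e1 comes
    from the normal vector, which collapses to (5 - 8 + 1 + 1) m1 = - m1 times n1 e1 because m2 m3 =
    m1. *)
Lemma svd_frame_line e1 e2 e3 n1 n2 n3 m1 m2 m3 : P e1 -> P e2 -> P e3 ->
  svd_frame dt B e1 e2 e3 n1 n2 n3 m1 m2 m3 ->
  m1 ^+ 2 = 1 -> m2 ^+ 2 = 1 -> m3 ^+ 2 = 1 -> quaternionic_line e1.
Proof.
move=> P1 P2 P3 fr q1 q2 q3; have [pf [h1 h2 h3] [h12 h23 h31] [B1 B2 B3]] := fr.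
have E2 := svd_frame_extremal qf fr q3.
have E3 := svd_frame_extremal qf (svd_frame_cycle (svd_frame_cycle fr)) q2.
have [[d1 d2 d3] [[d12 d23 d31] [c12 c23 c31]]] := svd_frame_table fr.
have i3 : im n3 e1 = m3 *: e2 by rewrite E2 scalerA -expr2 q3 scale1r.
have i2 : im n2 e1 = - m2 *: e3.
  rewrite E3 (qf_imZr qf) (qf_im_im qf) d2 scaleNr scale1r.
  have -> : cross3 n2 n2 = 0 by apply: R3_eq; rewrite /cross3 /=; ring.
  by rewrite (qf_im0l qf) addr0 scalerN scaleNr.
have e3E : e3 = - m2 *: im n2 e1 by rewrite i2 scalerA mulrNN -expr2 q2 scale1r.
have PN := svd_frame_normal qf fr PD PZ (And3 P1 P2 P3) PG.
have mm : m2 * m3 = m1.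
  have rel := svd_frame_rel qf fr; rewrite q1 q2 q3 in rel.
  have : m1 * (m1 * m2 * m3) = m1 * 1 by congr (_ * _); lra.
  by rewrite mulr1 !mulrA -expr2 q1 mul1r.
have Pi1 : P (im n1 e1).
  have E : (5 * m1 - 8 * m2 * m3) *: im n1 e1 + m2 *: im n2 e2 + m3 *: im n3 e3 =
     (- m1) *: im n1 e1.
    rewrite {1}E2 e3E !(qf_imZr qf) !(qf_im_im qf) d23 (dot3C n3) d23 c23.
    have -> : cross3 n3 n2 = -1 *: n1.
      by rewrite -c23; apply: R3_eq; rewrite /cross3 /= /GRing.scale /=; ring.
    rewrite (qf_imZl qf) oppr0 !scale0r !add0r !scalerA -!scalerDl; congr (_ *: _).
    by rewrite -mm; ring.
  rewrite E in PN; have := PZ (- m1) PN.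
  by rewrite scalerA mulrNN -expr2 q1 scale1r.
have Pi2 : P (im n2 e1) by rewrite i2; exact: PZ.
have Pi3 : P (im n3 e1) by rewrite i3; exact: PZ.
have ii a b : dt (im a e1) (im b e1) = dot3 a b.
  rewrite (qf_dt_im_im qf) h1 (qf_Bxx qf) mulr1.
  by rewrite [X in _ + X](_ : _ = 0) ?addr0 // /dot3 /cross3 /=; ring.
have i0 a : dt e1 (im a e1) = 0.
  by rewrite dtC dt_im (qf_Bxx qf) /dot3 /= !mulr0 !addr0.
split=> // x; split=> [|[r [a ->]]].
  move/(Pspan P1 Pi1 Pi2 Pi3); case.
  - by split; rewrite ?ii.
  - by split.
  - by split; rewrite ii // dot3C.
  move=> r1 [r2 [r3 [r4 ->]]]; exists r1, (r2 *: n1 + r3 *: n2 + r4 *: n3).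
  by rewrite !(qf_imDl qf) !(qf_imZl qf) !addrA.
rewrite (posframe_expand a pf) !(qf_imDl qf) !(qf_imZl qf).
by do !apply: PD; apply: PZ.
Qed.

(** Here the normal vector is 5 m1 n1 e1 and extremality gives e3 = m1 n1 e2, so that n1 e1 and n1
    e2 both lie in [P]. *)
Lemma svd_frame_plane e1 e2 e3 n1 n2 n3 m1 m2 m3 : P e1 -> P e2 -> P e3 ->
  svd_frame dt B e1 e2 e3 n1 n2 n3 m1 m2 m3 ->
  m1 ^+ 2 = 1 -> m2 = 0 -> m3 = 0 -> complex_plane n1 e1 e2.
Proof.
move=> P1 P2 P3 fr q1 q2 q3; have [pf [h1 h2 h3] [h12 h23 h31] [B1 B2 B3]] := fr.
have E3 := svd_frame_extremal qf (svd_frame_cycle fr) q1.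
have [[d1 d2 d3] _] := svd_frame_table fr.
have PN := svd_frame_normal qf fr PD PZ (And3 P1 P2 P3) PG.
have Pi1 : P (im n1 e1).
  move: PN; rewrite q2 q3 !scale0r !addr0 mulr0 subr0 => /(PZ (m1 / 5)).
  have -> : m1 / 5 *: (5 * m1 *: im n1 e1) = m1 ^+ 2 *: im n1 e1.
    by rewrite scalerA; congr (_ *: _); field.
  by rewrite q1 scale1r.
have Pi2 : P (im n1 e2).
  by have := PZ m1 P3; rewrite E3 scalerA -expr2 q1 scale1r.
have B0 : B e1 e2 = 0 by rewrite B3 q3 scale0r.
have ii x y : dt (im n1 x) (im n1 y) = dt x y.
  rewrite (qf_dt_im_im qf) d1 mul1r.
  by rewrite [X in _ + X](_ : _ = 0) ?addr0 // /dot3 /cross3 /=; ring.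
have i0 x : dt x (im n1 x) = 0.
  by rewrite dtC dt_im (qf_Bxx qf) /dot3 /= !mulr0 !addr0.
have j0 : dt (im n1 e1) e2 = 0 by rewrite dt_im B0 /dot3 /= !mulr0 !addr0.
have j1 : dt e1 (im n1 e2) = 0.
  by rewrite dtC dt_im BC B0 oppr0 /dot3 /= !mulr0 !addr0.
split=> // x; split=> [|[r [s [r' [s' ->]]]]].
  move/(Pspan P1 Pi1 P2 Pi2); case; try by [].
  - by split; rewrite ?ii.
  - by split; rewrite ?ii.
  by move=> r1 [r2 [r3 [r4 ->]]]; exists r1, r2, r3, r4.
by do !apply: PD; apply: PZ.
Qed.

Lemma Gcross_closed_classification e1 e2 e3 : P e1 -> P e2 -> P e3 ->
  [/\ dt e1 e1 = 1, dt e2 e2 = 1 & dt e3 e3 = 1] ->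
  [/\ dt e1 e2 = 0, dt e2 e3 = 0 & dt e3 e1 = 0] ->
  (exists e, quaternionic_line e) \/ (exists n e f, complex_plane n e f).
Proof.
move=> P1 P2 P3 h h'.
have [f1 [f2 [f3 [n1 [n2 [n3 [m1 [m2 [m3 [F1 F2 F3 fr]]]]]]]]]] := exists_svd_frame P1 P2 P3 h h'.
have key a1 a2 a3 k1 k2 k3 d1 d2 d3 : P a1 -> P a2 -> P a3 ->
    svd_frame dt B a1 a2 a3 k1 k2 k3 d1 d2 d3 ->
    let l1 := d1 - 2 * d2 * d3 in let l2 := d2 - 2 * d1 * d3 in
    l1 ^+ 2 * (1 - d1 ^+ 2) + l2 ^+ 2 * (1 - d2 ^+ 2) = 2 * l1 * l2 * (d3 - d1 * d2).
  move=> A1 A2 A3 fa; apply: (svd_frame_eq qf fa PD PZ (And3 A1 A2 A3) PG) => x y Px Py.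
  have [_ g g' _] := fa; exact: span4_orthogonal Px Py g g'.
have fr2 := svd_frame_cycle fr; have fr3 := svd_frame_cycle fr2.
have rel := svd_frame_rel qf fr.
have := key _ _ _ _ _ _ _ _ _ F1 F2 F3 fr; have := key _ _ _ _ _ _ _ _ _ F2 F3 F1 fr2.
have := key _ _ _ _ _ _ _ _ _ F3 F1 F2 fr3.
rewrite /= => K3 K2 K1; case: (@singular_values_cases _ m1 m2 m3) => //.
- by rewrite -!(mulrAC _ m1 m3) in K1 *.
- by rewrite -!(mulrAC _ m2 m1) in K2 *.
- by rewrite -!(mulrAC _ m3 m2) in K3 *.
- by case=> q1 q2 q3; left; exists f1; exact: svd_frame_line fr q1 q2 q3.
- by case=> q1 q2 q3; right; exists n1, f1, f2; exact: svd_frame_plane fr q1 q2 q3.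
- by case=> q1 q2 q3; right; exists n2, f2, f3; exact: svd_frame_plane fr2 q1 q2 q3.
- by case=> q1 q2 q3; right; exists n3, f3, f1; exact: svd_frame_plane fr3 q1 q2 q3.
Qed.

End Classification.

(** * Four-planes of R^8 *)

Section FourPlanes.
Variable R : realType.
Local Notation R8 := 'rV[R]_8.
Local Notation R3 := (R * R * R)%type.
Implicit Types (x y u v w : R8) (W : {vspace R8}).

Lemma R8_qform : qform (@dot R) (@im R) (@Bform R).
Proof.
split.
- exact: dotC.
- exact: dotDl.
- exact: dotZl.
- exact: dot_ge0.
- exact: dot_eq0.
- exact: BformC.
- exact: BformDl.
- exact: BformZl.
- exact: imDl.
- exact: imZl.
- exact: imDr.
- exact: imZr.
- exact: im_im.
- exact: dot_im.
- exact: Bform_imr.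
- by move=> p x y p0 px Bpx py Bpy; apply: (Bform_orthogonal_norm p0); apply/hq0P.
Qed.

Lemma dot_suml (I : finType) (F : I -> R8) y : dot (\sum_i F i) y = \sum_i dot (F i) y.
Proof. by elim/big_ind2: _ => [|a b c d <- <-|//]; rewrite ?dot0l ?dotDl. Qed.

Lemma orthogonal_free n (X : n.-tuple R8) :
  (forall i j : 'I_n, i != j -> dot X`_i X`_j = 0) ->
  (forall i : 'I_n, X`_i != 0) -> free X.
Proof.
move=> o0 nz; apply/freeP => k E i; have := congr1 (fun x => dot x X`_i) E.
rewrite /= dot0l dot_suml.
rewrite (bigD1 i) //= big1 ?addr0 => [|j ji]; last by rewrite dotZl o0 ?mulr0.
rewrite dotZl => /eqP; rewrite mulf_eq0 => /orP[/eqP//|/eqP/dot_eq0 x0].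
by have := nz i; rewrite x0 eqxx.
Qed.

(** Rank-nullity for the map of inner products with the members of [s]. *)
Lemma exists_unit_orthogonal W (s : seq R8) : (size s < \dim W)%N ->
  exists v, [/\ v \in W, dot v v = 1 & forall w, w \in s -> dot v w = 0].
Proof.
move=> sW; pose g v : 'rV[R]_(size s) := \row_i dot v s`_i.
have gl : linear g by move=> a u v; apply/rowP => i; rewrite !mxE dotDl dotZl.
pose gL := GRing.isLinear.Build R R8 'rV[R]_(size s) *:%R g gl.
pose g' : {linear R8 -> 'rV[R]_(size s)} := HB.pack g gL.
have dk : (0 < \dim (W :&: lker (linfun g')))%N.
  have := limg_ker_dim (linfun g') W.
  have : (\dim (linfun g' @: W) <= size s)%N.
    by apply: leq_trans (dimvS (subvf _)) _; rewrite dimvf dim_matrix mul1r.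
  by move=> h1 h2; move: sW; rewrite -h2 addnC; case: (\dim (_ :&: _)) => //; rewrite addn0 ltnNge h1.
pose x := vpick (W :&: lker (linfun g')); have x0 : x != 0.
  by rewrite /x vpick0 -dimv_eq0 -lt0n.
have : x \in (W :&: lker (linfun g'))%VS by exact: memv_pick.
rewrite memv_cap memv_ker lfunE /= => /andP[xW /eqP gx].
have d0 : 0 < dot x x.
  by rewrite lt0r dot_ge0 andbT; apply: contraNneq x0 => /dot_eq0->.
exists ((Num.sqrt (dot x x))^-1 *: x); split; first exact: memvZ.
  by rewrite dotZl dotZr mulrA -expr2 exprVn sqr_sqrtr ?mulVf ?gt_eqF // ltW.
move=> w ws; have := congr1 (fun y : 'rV_(size s) => y 0 (Ordinal (etrans (index_mem w s) ws))) gx.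
by rewrite !mxE /= nth_index // dotZl => ->; rewrite mulr0.
Qed.

Lemma frame_span W e1 e2 e3 e4 : \dim W = 4%N ->
  e1 \in W -> e2 \in W -> e3 \in W -> e4 \in W ->
  [/\ dot e1 e1 = 1, dot e2 e2 = 1, dot e3 e3 = 1 & dot e4 e4 = 1] ->
  [/\ dot e1 e2 = 0, dot e1 e3 = 0 & dot e1 e4 = 0] ->
  [/\ dot e2 e3 = 0, dot e2 e4 = 0 & dot e3 e4 = 0] ->
  forall x, x \in W -> exists r1 r2 r3 r4 : R,
    x = r1 *: e1 + r2 *: e2 + r3 *: e3 + r4 *: e4.
Proof.
move=> dW W1 W2 W3 W4 [h1 h2 h3 h4] [h12 h13 h14] [h23 h24 h34] x xW.
pose X := [tuple e1; e2; e3; e4].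
have fX : free X.
  apply: orthogonal_free => [i j|i].
    case: i j => [[|[|[|[|i]]]] hi] [[|[|[|[|j]]]] hj] //= _; by rewrite // dotC.
  have nz e : dot e e = 1 -> e != 0.
    by move=> h; apply: contra_eqN h => /eqP->; rewrite dot0l eq_sym oner_eq0.
  by case: i => [[|[|[|[|i]]]] hi] //=; exact: nz.
have XW : (<<X>> = W)%VS.
  apply/eqP; rewrite eqEdim dW (eqP fX) /= leqnn andbT.
  by apply/span_subvP => y; rewrite !inE => /or4P[] /eqP->.
rewrite -XW in xW; have := coord_span xW; rewrite !big_ord_recl big_ord0 /= => ->.
exists (coord X ord0 x), (coord X (lift ord0 ord0) x).
exists (coord X (lift ord0 (lift ord0 ord0)) x).
exists (coord X (lift ord0 (lift ord0 (lift ord0 ord0))) x).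
by rewrite addr0 !addrA.
Qed.

Local Notation qline W := (quaternionic_line (@dot R) (@im R) (fun x => x \in W)).
Local Notation cplane W := (complex_plane (@dot R) (@im R) (@Bform R) (fun x => x \in W)).

Definition Gcross_closed W := forall p u v, p \in W -> u \in W -> v \in W ->
  dot p p = 1 -> dot u u = 1 -> dot v v = 1 ->
  dot p u = 0 -> dot p v = 0 -> dot u v = 0 -> Gcross (@im R) (@Bform R) p u v \in W.

Lemma Gcross_closed_cases W : \dim W = 4%N -> Gcross_closed W ->
  (exists e, qline W e) \/ (exists n e f, cplane W n e f).
Proof.
move=> dW GW.
have [e1 [W1 h1 _]] := @exists_unit_orthogonal W [::] ltac:(by rewrite dW).
have [e2 [W2 h2 p2]] := @exists_unit_orthogonal W [:: e1] ltac:(by rewrite dW).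
have [e3 [W3 h3 p3]] := @exists_unit_orthogonal W [:: e1; e2] ltac:(by rewrite dW).
apply: (Gcross_closed_classification R8_qform _ _ GW _ W1 W2 W3).
- by move=> x y; exact: memvD.
- by move=> r x; exact: memvZ.
- by move=> *; exact: (frame_span dW).
- by [].
- by split; [rewrite dotC p2|rewrite dotC p3|rewrite p3]; rewrite ?inE ?eqxx ?orbT.
Qed.

End FourPlanes.

(** * Associativity in terms of the Hermitian form *)

Section AssociativeForm.
Variables (R : realType) (V : lmodType R).
Local Notation R3 := (R * R * R)%type.
Variables (dt : V -> V -> R) (im : R3 -> V -> V) (B : V -> V -> R3).
Hypothesis qf : qform dt im B.
Implicit Types (p u v w x y z : V) (a b : R3).

(* On vectors tangent to the sphere at p, the squashed metric is 9/25 times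
   squash_form and the 3-form is 27/25 times assoc_form. *)
Definition squash_form p x y : R := 5 * dt x y - 4 * dot3 (B p x) (B p y).

Definition assoc_form p u v w : R :=
  dot3 (B p u) (B v w) - dot3 (B p v) (B u w) + dot3 (B p w) (B u v)
  - 16 / 5 * dot3 (B p u) (cross3 (B p v) (B p w)).

Definition gram_det (q : V -> V -> R) u v w : R :=
  q u u * (q v v * q w w - q v w ^+ 2) - q u v * (q u v * q w w - q v w * q u w)
  + q u w * (q u v * q v w - q v v * q u w).

Let dtC := qf_dtC qf.
Let dtDl := qf_dtDl qf.
Let dtZl := qf_dtZl qf.
Let BC := qf_BC qf.
Let BDl := qf_BDl qf.
Let BZl := qf_BZl qf.
Let dt_im := qf_dt_im qf.
Let B_im := qf_B_im qf.
Let dtDr := qf_dtDr qf.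
Let dtZr := qf_dtZr qf.
Let BDr := qf_BDr qf.
Let BZr := qf_BZr qf.
Let dtE := (dtDl, dtDr, qf_dtNl qf, qf_dtNr qf, dtZl, dtZr).
Let Bxx := qf_Bxx qf.

Let B_im_self := qf_B_im_self qf.
Let dt_im_self := qf_dt_im_self qf.

Lemma B_norm_le p x : dt p p = 1 -> dt p x = 0 -> dot3 (B p x) (B p x) <= dt x x.
Proof.
move=> p1 px; have := qf_dt_ge0 qf (x - im (B p x) p).
rewrite !dtE (dtC x (im _ _)) !dt_im B_im_self //.
by move: (dt x x) (dot3 _ _) => s t; lra.
Qed.

Lemma squash_formC p x y : squash_form p x y = squash_form p y x.
Proof. by rewrite /squash_form dtC dot3C. Qed.
Lemma squash_formDl p x y z : squash_form p (x + y) z = squash_form p x z + squash_form p y z.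
Proof. by rewrite /squash_form dtDl BDr /dot3 /=; ring. Qed.
Lemma squash_formZl p r x z : squash_form p (r *: x) z = r * squash_form p x z.
Proof. by rewrite /squash_form dtZl BZr /dot3 /= /GRing.scale /=; ring. Qed.

Lemma squash_form_eq0 p x : dt p p = 1 -> dt p x = 0 -> squash_form p x x = 0 -> x = 0.
Proof.
move=> p1 px; have := B_norm_le p1 px; have := qf_dt_ge0 qf x; rewrite /squash_form.
move=> h1 h2 h3; apply: (qf_dt0 qf); move: h1 h2 h3.
by move: (dt x x) (dot3 _ _) => s t; lra.
Qed.

Lemma squash_form_ge0 p x : dt p p = 1 -> dt p x = 0 -> 0 <= squash_form p x x.
Proof.
move=> p1 px; have := B_norm_le p1 px; have := qf_dt_ge0 qf x; rewrite /squash_form.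
by move: (dt x x) (dot3 _ _) => s t; lra.
Qed.

Lemma squash_form_gt0 p x : dt p p = 1 -> dt p x = 0 -> x != 0 -> 0 < squash_form p x x.
Proof.
move=> p1 px x0; rewrite lt0r squash_form_ge0 // andbT.
by apply: contraNneq x0 => /(squash_form_eq0 p1 px)->.
Qed.

Lemma squash_minor_gt0 p u v : dt p p = 1 -> dt p u = 0 -> dt p v = 0 ->
  dt u u = 1 -> dt v v = 1 -> dt u v = 0 ->
  0 < squash_form p u u * squash_form p v v - squash_form p u v ^+ 2.
Proof.
move=> p1 pu pv u1 v1 uv; set D := _ - _.
have nz x y : dt x y != 0 -> x != 0.
  by apply: contraNneq => ->; rewrite (qf_dt0l qf).
have qu0 : 0 < squash_form p u u.
  by apply: squash_form_gt0 => //; apply: (nz _ u); rewrite u1 oner_eq0.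
(* A multiple of the component of [v] orthogonal to [u] for the squashed form. *)
pose y := squash_form p u u *: v + (- squash_form p u v) *: u.
have py : dt p y = 0 by rewrite !dtE pu pv !mulr0 addr0.
have y0 : y != 0.
  apply: (nz _ v); rewrite !dtE v1 uv mulr0 addr0 mulr1; exact: lt0r_neq0.
have := squash_form_gt0 p1 py y0.
have -> : squash_form p y y = squash_form p u u * D.
  rewrite squash_formDl !squash_formZl !(squash_formC p _ y) !squash_formDl !squash_formZl.
  by rewrite (squash_formC p v u) /D; ring.
by rewrite pmulr_rgt0.
Qed.

Lemma gram_det_ge0 p u v w : dt p p = 1 -> [/\ dt p u = 0, dt p v = 0 & dt p w = 0] ->
  dt u u = 1 -> dt v v = 1 -> dt u v = 0 -> 0 <= gram_det (squash_form p) u v w.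
Proof.
move=> p1 [pu pv pw] u1 v1 uv; have := squash_minor_gt0 p1 pu pv u1 v1 uv.
set q := squash_form p; set D := _ - _ => D0.
pose y := D *: w + (q u v * q v w - q u w * q v v) *: u
  + (q u v * q u w - q v w * q u u) *: v.
have py : dt p y = 0 by rewrite !dtE pu pv pw !mulr0 !addr0.
have := squash_form_ge0 p1 py; have -> : squash_form p y y = D * gram_det q u v w.
  rewrite !squash_formDl !squash_formZl !(squash_formC p _ y) !squash_formDl !squash_formZl.
  rewrite (squash_formC p v u) (squash_formC p w u) (squash_formC p w v) -/q.
  by rewrite /gram_det /D; ring.
by rewrite pmulr_rge0.
Qed.

(** The origin of the coefficients 5 and 8 of [Gcross]: they make it represent 5 [assoc_form p u v]
    through the squashed form. *)
Lemma squash_form_Gcross p u v w : dt p p = 1 -> dt p u = 0 -> dt p v = 0 ->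
  squash_form p (Gcross im B p u v) w = 5 * assoc_form p u v w.
Proof.
move=> p1 pu pv; rewrite /squash_form /assoc_form /Gcross -(qf_imNl qf) !dtE !dt_im !BDr.
rewrite B_im_self // !B_im pu pv.
move: (B p u) (B p v) (B u v) (B p w) (B u w) (B v w).
move=> [[? ?] ?] [[? ?] ?] [[? ?] ?] [[? ?] ?] [[? ?] ?] [[? ?] ?].
by rewrite /dot3 /cross3 /= /GRing.scale /=; field.
Qed.

(** The cross product G is q-orthogonal to [u] and [v] with q(G,G) = D. The hypothesis makes
    Cauchy-Schwarz an equality for G and the component of [w] orthogonal to [u], [v], so the two are
    proportional. *)
Lemma Gcross_span p u v w :
  dt p p = 1 -> [/\ dt u u = 1, dt v v = 1 & dt w w = 1] ->
  [/\ dt p u = 0, dt p v = 0 & dt p w = 0] ->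
  [/\ dt u v = 0, dt u w = 0 & dt v w = 0] ->
  (5 * assoc_form p u v w) ^+ 2 = gram_det (squash_form p) u v w ->
  exists r s t, Gcross im B p u v = r *: u + s *: v + t *: w.
Proof.
move=> p1 [u1 v1 w1] [pu pv pw] [uv uw vw]; rewrite -squash_form_Gcross //.
set G := Gcross im B p u v; pose q := squash_form p; rewrite -/q.
have qGu : q G u = 0.
  rewrite /q squash_form_Gcross // /assoc_form Bxx (BC u v).
  by rewrite /dot3 /cross3 /=; ring.
have qGv : q G v = 0.
  rewrite /q squash_form_Gcross // /assoc_form Bxx.
  by rewrite /dot3 /cross3 /=; ring.
have quu : q u u = 5 - 4 * dot3 (B p u) (B p u) by rewrite /q /squash_form u1 mulr1.
have qvv : q v v = 5 - 4 * dot3 (B p v) (B p v) by rewrite /q /squash_form v1 mulr1.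
have quv : q u v = - 4 * dot3 (B p u) (B p v) by rewrite /q /squash_form uv; ring.
pose D := q u u * q v v - q u v ^+ 2.
have pG : dt p G = 0.
  rewrite dtC /G /Gcross -(qf_imNl qf) !dtE !dt_im Bxx (BC p u) (BC p v).
  by rewrite /dot3 /=; ring.
have GG : q G G = D.
  have -> : q G G = 5 * dt G G - 4 * dot3 (B p G) (B p G) by [].
  rewrite (Gcross_norm qf p1 pu pv u1 v1 uv) /D quu qvv quv.
  have -> : B p G = 5 *: B u v - 6 *: cross3 (B p u) (B p v).
    rewrite /G /Gcross -(qf_imNl qf) !BDr B_im_self // !B_im pu pv.
    by apply: R3_eq; rewrite /cross3 /= /GRing.scale /=; ring.
  by ring.
clearbody G.
have qDl x y z : q (x + y) z = q x z + q y z by exact: squash_formDl.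
have qZl r x z : q (r *: x) z = r * q x z by exact: squash_formZl.
have qC x y : q x y = q y x by exact: squash_formC.
have qDr x y z : q x (y + z) = q x y + q x z by rewrite !(qC x) qDl.
have qZr r x z : q x (r *: z) = r * q x z by rewrite !(qC x) qZl.
pose qE := (qDl, qDr, qZl, qZr).
have D0 : 0 < D by exact: squash_minor_gt0.
set t := q G w => tE.
(* By Cramer's rule, w' is D times the q-orthogonal projection of [w] off [u] and [v]; its square
   norm is D times the Gram determinant. *)
pose al := q u v * q v w - q u w * q v v; pose be := q u v * q u w - q v w * q u u.
pose w' := D *: w + al *: u + be *: v.
have y0 : w' + (- t) *: G = 0.
  apply: (squash_form_eq0 p1); first by rewrite /w' !dtE pu pv pw pG; ring.
  rewrite -/q /w' !qE (qC u G) (qC v G) (qC w G) qGu qGv GG -/t (qC v u) (qC w u) (qC w v).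
  transitivity (D * (gram_det q u v w - t ^+ 2)); last by rewrite tE subrr mulr0.
  by rewrite /gram_det /al /be /D; ring.
(* Otherwise w' = 0, although its Euclidean inner product with [w] is D > 0. *)
have t0 : t != 0.
  apply: contraTneq D0 => t0; rewrite -(_ : dt (w' + (- t) *: G) w = D).
    by rewrite y0 (qf_dt0l qf) ltxx.
  by rewrite t0 /w' !dtE w1 uw vw; ring.
exists (t^-1 * al), (t^-1 * be), (t^-1 * D).
have /(congr1 (fun x => t^-1 *: x)) : t *: G = w'.
  by apply/eqP; rewrite -subr_eq0 -oppr_eq0 opprB -scaleNr y0.
rewrite scalerA mulVf // scale1r => ->; rewrite /w' !scalerDr !scalerA.
by rewrite -addrA addrC.
Qed.

(* Unlike assoc_form, this expression of the 3-form is valid on all of V. *)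
Definition phi_form p u v w : R :=
  dot3 (B p u) (B (qf_hor im B p v) (qf_hor im B p w))
  - dot3 (B p v) (B (qf_hor im B p u) (qf_hor im B p w))
  + dot3 (B p w) (B (qf_hor im B p u) (qf_hor im B p v))
  - 5^-1 * dot3 (B p u) (cross3 (B p v) (B p w)).

Lemma phi_form_tangent p u v w : dt p p = 1 -> dt p u = 0 -> dt p v = 0 -> dt p w = 0 ->
  phi_form p u v w = assoc_form p u v w.
Proof.
move=> p1 pu pv pw; rewrite /phi_form /assoc_form !(qf_B_hor qf) //.
by rewrite /dot3 /cross3 /=; field.
Qed.

(* On the planes of interest the 3-form is a constant multiple of this form,
   which is linear in p. *)
Definition lin_form p u v w : R :=
  dot3 (B p u) (B v w) - dot3 (B p v) (B u w) + dot3 (B p w) (B u v).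

Lemma lin_form_alternating p :
  [/\ forall r u u' v w, lin_form p (r *: u + u') v w = r * lin_form p u v w + lin_form p u' v w,
      forall u v w, lin_form p v u w = - lin_form p u v w
    & forall u v w, lin_form p u w v = - lin_form p u v w].
Proof.
split=> [r u u' v w|u v w|u v w]; rewrite /lin_form.
- by rewrite BDr BZr !BDl !BZl /dot3 /= /GRing.scale /=; ring.
- by rewrite (BC u v) /dot3 /=; ring.
- by rewrite (BC v w) /dot3 /=; ring.
Qed.

Lemma lin_form_linear r p q u v w :
  lin_form (r *: p + q) u v w = r * lin_form p u v w + lin_form q u v w.
Proof. by rewrite /lin_form !BDl !BZl /dot3 /= /GRing.scale /=; ring. Qed.

Section Examples.
Variable P : V -> Prop.
Hypothesis PD : forall x y, P x -> P y -> P (x + y).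
Hypothesis PZ : forall (r : R) x, P x -> P (r *: x).

Lemma im_mult e (r s : R) a b : s *: (r *: e + im a e) + im b (r *: e + im a e) =
  (s * r - dot3 b a) *: e + im (s *: a + r *: b + cross3 b a) e.
Proof.
apply: (qf_ext qf) => z; rewrite (qf_imDr qf) (qf_imZr qf) (qf_im_im qf) !dtE !dt_im.
by move: (dt e z) (B e z) => d c; rewrite /dot3 /= /GRing.scale /=; ring.
Qed.

(** Any unit vector of the line can replace [e]; this lets the tangent space at [p] be written as
    the vectors im a p. *)
Lemma quaternionic_line_base e p : quaternionic_line dt im P e -> P p ->
  dt p p = 1 -> quaternionic_line dt im P p.
Proof.
move=> [e1 eP] Pp p1; split=> // x.
have /eP[r [a pE]] := Pp.
have ra : r * r + dot3 a a = 1.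
  rewrite -p1 pE !dtE dt_im_self dtC dt_im_self (qf_dt_im_im qf) e1 Bxx.
  by rewrite /dot3 /cross3 /=; ring.
have eE : e = r *: p + im (- a) p.
  rewrite pE im_mult.
  have -> : r * r - dot3 (- a) a = 1 by rewrite -ra /dot3 /=; ring.
  rewrite [X in im X](_ : _ = 0) ?(qf_im0l qf) ?addr0 ?scale1r //.
  by apply: R3_eq; rewrite /cross3 /= /GRing.scale /=; ring.
split=> [/eP[s [b ->]]|[s [b ->]]].
  by rewrite {1 2}eE im_mult; do 2!eexists.
by apply/eP; rewrite pE im_mult; do 2!eexists.
Qed.

Lemma B_im_im p a b : dt p p = 1 -> B (im a p) (im b p) = cross3 a b.
Proof.
move=> p1; rewrite B_im dt_im Bxx BC B_im_self //.
by apply: R3_eq; rewrite /dot3 /cross3 /= /GRing.scale /=; ring.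
Qed.

(** For u, v, w = a p, b p, c p, with T the triple product of a, b, c, [lin_form] is 3 T and
    [assoc_form] is 3 T - 16/5 T = - T/5, whence the factor -1/15. The squashed form is the standard
    inner product of a, b, c, so its Gram determinant is T^2. *)
Lemma quaternionic_line_assoc e p u v w : quaternionic_line dt im P e ->
  P p -> dt p p = 1 -> P u -> P v -> P w -> dt p u = 0 -> dt p v = 0 -> dt p w = 0 ->
  (5 * assoc_form p u v w) ^+ 2 = gram_det (squash_form p) u v w /\
  assoc_form p u v w = - 15^-1 * lin_form p u v w.
Proof.
move=> le Pp p1 Pu Pv Pw pu pv pw; have [_ lp] := quaternionic_line_base le Pp p1.
have T x : P x -> dt p x = 0 -> exists a, x = im a p.
  move=> /lp[r [a ->]]; rewrite !dtE p1 dt_im_self mulr1 addr0 => ->.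
  by exists a; rewrite scale0r add0r.
have [[a ->] [b ->] [c ->]] := And3 (T u Pu pu) (T v Pv pv) (T w Pw pw).
have S (x y : R3) : squash_form p (im x p) (im y p) = dot3 x y.
  rewrite /squash_form !B_im_self // (qf_dt_im_im qf) p1 Bxx.
  by rewrite /dot3 /cross3 /=; ring.
rewrite /gram_det !S /assoc_form /lin_form !B_im_self // !B_im_im //.
by rewrite /dot3 /cross3 /=; split; field.
Qed.

Lemma quaternionic_line_nonzero e p : quaternionic_line dt im P e -> P p -> dt p p = 1 ->
  exists u v w, [/\ P u /\ dt p u = 0, P v /\ dt p v = 0, P w /\ dt p w = 0
    & assoc_form p u v w != 0].
Proof.
move=> le Pp p1; have [_ lp] := quaternionic_line_base le Pp p1.
have Pim a : P (im a p) /\ dt p (im a p) = 0.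
  split; last exact: dt_im_self.
  by apply/lp; exists 0, a; rewrite scale0r add0r.
exists (im (1, 0, 0) p), (im (0, 1, 0) p), (im (0, 0, 1) p); split=> //.
rewrite /assoc_form !B_im_self // !B_im_im //.
rewrite (_ : _ - _ = - 5^-1) ?oppr_eq0 ?invr_eq0 ?pnatr_eq0 //.
by rewrite /dot3 /cross3 /=; field.
Qed.

Hypothesis Pspan : forall e1 e2 e3 e4, P e1 -> P e2 -> P e3 -> P e4 ->
  [/\ dt e1 e1 = 1, dt e2 e2 = 1, dt e3 e3 = 1 & dt e4 e4 = 1] ->
  [/\ dt e1 e2 = 0, dt e1 e3 = 0 & dt e1 e4 = 0] ->
  [/\ dt e2 e3 = 0, dt e2 e4 = 0 & dt e3 e4 = 0] ->
  forall x, P x -> exists r1 r2 r3 r4, x = r1 *: e1 + r2 *: e2 + r3 *: e3 + r4 *: e4.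

Section Unitary.
Variables (n : R3) (e f : V).
Hypothesis n1 : dot3 n n = 1.
Hypothesis e1 : dt e e = 1.
Hypothesis f1 : dt f f = 1.
Hypothesis ef : dt e f = 0.
Hypothesis Bef : B e f = 0.

Lemma unitary_dt : [/\ dt (im n e) (im n e) = 1, dt (im n f) (im n f) = 1,
  dt e (im n e) = 0 & dt f (im n f) = 0] /\
  [/\ dt e (im n f) = 0, dt (im n e) f = 0 & dt (im n e) (im n f) = 0].
Proof.
do !split; rewrite ?dt_im_self ?(dtC e (im n f)) // ?(qf_dt_im_im qf) ?dt_im ?(BC e f)
  ?Bxx ?Bef ?e1 ?f1 ?ef ?n1; rewrite /dot3 /cross3 /=; ring.
Qed.

Lemma unitary_B : [/\ B e (im n e) = n, B f (im n f) = n, B e (im n f) = 0,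
  B (im n e) f = 0 & B (im n e) (im n f) = 0].
Proof.
have [_ [_ h _]] := unitary_dt.
have E : B (im n e) f = 0.
  rewrite BC B_im (BC e f) Bef dtC ef.
  by apply: R3_eq; rewrite /cross3 /= /GRing.scale /=; ring.
split; rewrite ?B_im_self // B_im ?E ?ef ?Bef ?h;
  by apply: R3_eq; rewrite /cross3 /= /GRing.scale /=; ring.
Qed.

Lemma unitary_coord (r s t k r' s' t' k' : R) :
  let x := r *: e + s *: im n e + t *: f + k *: im n f in
  let y := r' *: e + s' *: im n e + t' *: f + k' *: im n f in
  dt x y = r * r' + s * s' + t * t' + k * k' /\
  B x y = (r * s' - s * r' + t * k' - k * t') *: n.
Proof.
have [[d1 d2 d3 d4] [d5 d6 d7]] := unitary_dt; have [b1 b2 b3 b4 b5] := unitary_B.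
move=> x y; split.
  rewrite /x /y !dtE (dtC (im n f) (im n e)) (dtC (im n f) f) (dtC f (im n e)).
  rewrite (dtC f e) (dtC (im n f) e) (dtC (im n e) e).
  by rewrite e1 f1 ef d1 d2 d3 d4 d5 d6 d7; ring.
rewrite /x /y !(BDl, BDr, BZl, BZr) (BC e (im n e)) (BC f (im n f)) (BC e f) (BC e (im n f)).
rewrite (BC (im n e) f) (BC (im n e) (im n f)) !Bxx Bef b1 b2 b3 b4 b5.
by apply: R3_eq; rewrite /= /GRing.scale /=; ring.
Qed.

End Unitary.

Lemma complex_plane_base n e f p : complex_plane dt im B P n e f -> P p ->
  dt p p = 1 -> exists f', complex_plane dt im B P n p f'.
Proof.
move=> [n1 e1 f1 [ef Bef] eP] Pp p1.
have /eP[r [s [t [k pE]]]] := Pp.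
have C := unitary_coord n1 e1 f1 ef Bef.
have nn x : im n (im n x) = - x.
  rewrite (qf_im_im qf) n1 scaleN1r [X in im X](_ : _ = 0) ?(qf_im0l qf) ?addr0 //.
  by apply: R3_eq; rewrite /cross3 /=; ring.
(* With p = alpha e + beta f over R + R n, this is - conj(beta) e + conj(alpha) f. *)
pose f' := (- t) *: e + k *: im n e + r *: f + (- s) *: im n f.
have N (a b c d : R) : im n (a *: e + b *: im n e + c *: f + d *: im n f) =
   (- b) *: e + a *: im n e + (- d) *: f + c *: im n f.
  rewrite !(qf_imDr qf) !(qf_imZr qf) !nn; apply: (qf_ext qf) => z.
  by rewrite !dtE; ring.
have rE : r * r + s * s + t * t + k * k = 1 by rewrite -p1 pE; have [-> _] := C r s t k r s t k.
exists f'; have P4 r0 s0 t0 k0 : P (r0 *: e + s0 *: im n e + t0 *: f + k0 *: im n f).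
  by apply/eP; do 4!eexists.
have f'1 : dt f' f' = 1.
  by have [-> _] := C (- t) k r (- s) (- t) k r (- s); rewrite -rE; ring.
have pf' : dt p f' = 0.
  by rewrite pE; have [-> _] := C r s t k (- t) k r (- s); ring.
have Bpf' : B p f' = 0.
  rewrite pE; have [_ ->] := C r s t k (- t) k r (- s).
  by rewrite (_ : _ - _ = 0) ?scale0r //; ring.
have [[d1 d2 d3 d4] [d5 d6 d7]] := unitary_dt n1 p1 f'1 pf' Bpf'.
have Pip : P (im n p) by rewrite pE N.
have Pif : P (im n f') by rewrite /f' N.
have Pf : P f' by exact: P4.
split=> // x; split=> [Px|[r0 [s0 [t0 [k0 ->]]]]].
  exact: (Pspan Pp Pip Pf Pif (And4 p1 d1 f'1 d2) (And3 d3 pf' d5) (And3 d6 d7 d4) Px).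
by do !apply: PD; apply: PZ.
Qed.

(** All values of [B] on the plane are multiples of [n], so the triple product term of [assoc_form]
    vanishes. In the basis n p, f', n f' the squashed form is diag(1, 5, 5), with Gram determinant
    25 times the square of the coordinate determinant. *)
Lemma complex_plane_assoc n e f p u v w : complex_plane dt im B P n e f ->
  P p -> dt p p = 1 -> P u -> P v -> P w -> dt p u = 0 -> dt p v = 0 -> dt p w = 0 ->
  (5 * assoc_form p u v w) ^+ 2 = gram_det (squash_form p) u v w /\
  assoc_form p u v w = lin_form p u v w.
Proof.
move=> cp Pp p1 Pu Pv Pw pu pv pw.
have [f' [n1 _ f1 [pf Bpf] lp]] := complex_plane_base cp Pp p1.
have C := unitary_coord n1 p1 f1 pf Bpf.
have E0 : p = 1 *: p + 0 *: im n p + 0 *: f' + 0 *: im n f'.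
  by rewrite !scale0r !addr0 scale1r.
have T x : P x -> dt p x = 0 -> exists s t k, x = 0 *: p + s *: im n p + t *: f' + k *: im n f'.
  move=> /lp[r [s [t [k ->]]]]; rewrite {1}E0; have [-> _] := C 1 0 0 0 r s t k.
  by rewrite !mul0r mul1r !addr0 => ->; exists s, t, k.
have [[s1 [t1 [k1 uE]]] [s2 [t2 [k2 vE]]] [s3 [t3 [k3 wE]]]] := And3 (T u Pu pu) (T v Pv pv) (T w Pw pw).
have Bp s t k : B p (0 *: p + s *: im n p + t *: f' + k *: im n f') = s *: n.
  rewrite {1}E0; have [_ ->] := C 1 0 0 0 0 s t k; congr (_ *: _); ring.
have S s t k s' t' k' : squash_form p (0 *: p + s *: im n p + t *: f' + k *: im n f')
    (0 *: p + s' *: im n p + t' *: f' + k' *: im n f') = s * s' + 5 * (t * t' + k * k').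
  rewrite /squash_form !Bp; have [-> _] := C 0 s t k 0 s' t' k'.
  have -> : dot3 (s *: n) (s' *: n) = s * s' * dot3 n n by rewrite /dot3 /= /GRing.scale /=; ring.
  by rewrite n1; ring.
rewrite /gram_det /assoc_form /lin_form uE vE wE !S !Bp.
have [_ ->] := C 0 s1 t1 k1 0 s2 t2 k2; have [_ ->] := C 0 s2 t2 k2 0 s3 t3 k3.
have [_ ->] := C 0 s1 t1 k1 0 s3 t3 k3.
have dn (r s : R) : dot3 (r *: n) (s *: n) = r * s.
  by rewrite -[RHS]mulr1 -n1 /dot3 /= /GRing.scale /=; ring.
have cn (r s : R) : cross3 (r *: n) (s *: n) = 0 *: n.
  by apply: R3_eq; rewrite /cross3 /= /GRing.scale /=; ring.
by rewrite cn !dn; split; field.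
Qed.

Lemma complex_plane_nonzero n e f p : complex_plane dt im B P n e f -> P p -> dt p p = 1 ->
  exists u v w, [/\ P u /\ dt p u = 0, P v /\ dt p v = 0, P w /\ dt p w = 0
    & assoc_form p u v w != 0].
Proof.
move=> cp Pp p1.
have [f' [n1 _ f1 [pf Bpf] lp]] := complex_plane_base cp Pp p1.
have [[d1 d2 d3 d4] [d5 d6 d7]] := unitary_dt n1 p1 f1 pf Bpf.
have [b1 b2 b3 b4 b5] := unitary_B n1 p1 f1 pf Bpf.
have Pc (r s t k : R) : P (r *: p + s *: im n p + t *: f' + k *: im n f').
  by apply/lp; do 4!eexists.
exists (im n p), f', (im n f'); split.
- by have := Pc 0 1 0 0; rewrite scale1r !scale0r !addr0 add0r.
- by have := Pc 0 0 1 0; rewrite scale1r !scale0r !addr0 !add0r.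
- by have := Pc 0 0 0 1; rewrite scale1r !scale0r !add0r.
rewrite /assoc_form b1 b2 b3 Bpf b4 b5 n1.
by rewrite (_ : _ - _ = 1) ?oner_eq0 // /dot3 /cross3 /=; field.
Qed.

End Examples.

End AssociativeForm.

(** * The squashed metric and the 3-form *)

Lemma sum3 (M : zmodType) (F : 'I_3 -> M) : \sum_i F i = F 0 + F 1 + F 2.
Proof.
rewrite !big_ord_recl big_ord0 addr0 addrA.
by congr (F _ + F _ + F _); exact: val_inj.
Qed.

Lemma opp_lincomb3 (K : ringType) (M : lmodType K) (a b c : K) (x y z : M) :
  - a *: - x + - b *: - y + - c *: - z = a *: x + b *: y + c *: z.
Proof. by rewrite !scaleNr !scalerN !opprK. Qed.

Section Squashed.
Variable R : realType.
Local Notation R8 := 'rV[R]_8.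
Local Notation R3 := (R * R * R)%type.
Local Notation phi_form := (phi_form (@im R) (@Bform R)).
Local Notation assoc_form := (assoc_form (@Bform R)).
Local Notation squash_form := (squash_form (@dot R) (@Bform R)).
Local Notation qhor := (qf_hor (@im R) (@Bform R)).
Implicit Types (p x y u v w : R8).

(** The difference quotient of an additive homogeneous map is constant for nonzero increments, so no
    continuity has to be assumed. *)
Lemma is_derive_linear (V W : normedModType R) (f : V -> W) (x u : V) :
  (forall (r : R) (y z : V), f (r *: y + z) = r *: f y + f z) -> is_derive x u f (f u).
Proof.
move=> fl.
have E : (fun h => h^-1 *: ((f \o shift x) (h *: u) - f x)) @ 0^' --> f u.
  apply: cvg_near_cst; near=> h; rewrite /= /shift /= fl addrK scalerA mulVf ?scale1r //.
  by near: h; exact: nbhs_dnbhs_neq.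
by apply: DeriveDef; [apply/cvg_ex; exists (f u)|apply: cvg_lim].
Unshelve. all: by end_near. Qed.

Lemma etaE p v : [/\ eta 0 p v = - (Bform p v).1.1, eta 1 p v = - (Bform p v).1.2
  & eta 2 p v = - (Bform p v).2].
Proof.
have E i : eta i p v = - dot (cstruct i p) v by rewrite /eta /xi (dotNl (cstruct i p) v).
by rewrite (BformE p v) (E 0) (E 1) (E 2).
Qed.

Lemma eta_linear i v (r : R) x y : eta i (r *: x + y) v = r * eta i x v + eta i y v.
Proof.
have [e0 e1 e2] := etaE x v; have [e3 e4 e5] := etaE y v.
have := etaE (r *: x + y) v; rewrite (BformDl (r *: x) y v) (BformZl r x v).
move: e0 e1 e2 e3 e4 e5; move: (Bform x v) (Bform y v) => [[a b] c] [[a' b'] c'] /=.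
move=> e0 e1 e2 e3 e4 e5 [e6 e7 e8].
case: i => [[|[|[|i]]] hi] //.
- have -> : Ordinal hi = 0 by exact: val_inj.
  by rewrite e0 e3 e6 opprD mulrN.
- have -> : Ordinal hi = 1 by exact: val_inj.
  by rewrite e1 e4 e7 opprD mulrN.
- have -> : Ordinal hi = 2 by exact: val_inj.
  by rewrite e2 e5 e8 opprD mulrN.
Qed.

Lemma etaC i x y : eta i y x = - eta i x y.
Proof.
have [e0 e1 e2] := etaE x y; have [e3 e4 e5] := etaE y x.
case: i => [[|[|[|i]]] hi] //.
- have -> : Ordinal hi = 0 by exact: val_inj.
  by rewrite e0 e3 (BformC x y).
- have -> : Ordinal hi = 1 by exact: val_inj.
  by rewrite e1 e4 (BformC x y).
- have -> : Ordinal hi = 2 by exact: val_inj.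
  by rewrite e2 e5 (BformC x y).
Qed.

Lemma verE p v : ver p v = im (Bform p v) p.
Proof.
have [e0 e1 e2] := etaE p v.
rewrite /ver (sum3 (fun i => eta i p v *: xi i p)) e0 e1 e2 /xi (imE (Bform p v) p).
move: (Bform p v) (cstruct 0 p) (cstruct 1 p) (cstruct 2 p) => [[a b] c] x y z.
exact: opp_lincomb3.
Qed.

Lemma horE p v : hor p v = qhor p v.
Proof. by rewrite /hor verE. Qed.

(** [eta] is linear in the base point and antisymmetric, so its exterior derivative is twice
    itself. *)
Lemma omegaE i p u v : omega i p u v = eta i (hor p u) (hor p v).
Proof.
rewrite /omega /ext_d.
have D (a b : R8) : 'D_a (fun y => eta i y b) p = eta i a b.
  by have [_ ->] := @is_derive_linear _ _ (fun y => eta i y b) p a (@eta_linear i b).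
rewrite !D (etaC i (hor p u) (hor p v)); move: (eta i (hor p u) (hor p v)) => t.
by rewrite opprK -mulr2n -[t *+ 2]mulr_natl mulKf ?pnatr_eq0.
Qed.

Lemma phitildeE p u v w : phitilde p u v w = 27 / 25 * phi_form p u v w.
Proof.
rewrite /phitilde; congr (_ * _); rewrite sum3 /wedge12 /wedge11 !omegaE !horE.
rewrite /phi_form.
move: (etaE p u) (etaE p v) (etaE p w) (etaE (qhor p u) (qhor p v)).
move: (etaE (qhor p u) (qhor p w)) (etaE (qhor p v) (qhor p w)).
move: (qhor p u) (qhor p v) (qhor p w) => x y z.
move: (Bform p u) (Bform p v) (Bform p w) (Bform x y) (Bform x z) (Bform y z).
move=> [[? ?] ?] [[? ?] ?] [[? ?] ?] [[? ?] ?] [[? ?] ?] [[? ?] ?].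
move: (@eta R) => e [-> -> ->] [-> -> ->] [-> -> ->] [-> -> ->] [-> -> ->] [-> -> ->].
by rewrite /dot3 /cross3 /=; ring.
Qed.

Lemma phitilde_tangent p u v w : dot p p = 1 -> dot p u = 0 -> dot p v = 0 ->
  dot p w = 0 -> phitilde p u v w = 27 / 25 * assoc_form p u v w.
Proof. by move=> *; rewrite phitildeE (phi_form_tangent (R8_qform R)). Qed.

Lemma gtildeE p u v : dot p p = 1 -> gtilde p u v = 9 / 25 * squash_form p u v.
Proof.
move=> p1; rewrite /gtilde !verE !horE (qf_dt_hor (R8_qform R)) //.
rewrite (qf_dt_im_im (R8_qform R)) p1 Bform_xx /squash_form.
have -> : (3 / Num.sqrt 5) ^+ 2 = 9 / 5 :> R.
  by rewrite exprMn exprVn sqr_sqrtr ?ler0n //; field.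
by move: (dot u v) (Bform p u) (Bform p v) => d [[? ?] ?] [[? ?] ?]; rewrite /dot3 /cross3 /=; field.
Qed.

Lemma det_mx33 (M : 'M[R]_3) : \det M =
  M 0 0 * (M 1 1 * M 2 2 - M 1 2 * M 2 1) - M 0 1 * (M 1 0 * M 2 2 - M 1 2 * M 2 0)
  + M 0 2 * (M 1 0 * M 2 1 - M 1 1 * M 2 0).
Proof.
pose a i j := M (inord i) (inord j).
have Ma i j : M i j = a i j by rewrite /a !inord_val.
rewrite (expand_det_row M 0) !big_ord_recl big_ord0 /cofactor.
rewrite !(expand_det_row _ ord0) !big_ord_recl !big_ord0 /cofactor !det_mx11 !mxE.
by rewrite !Ma /= /bump /=; ring.
Qed.

Lemma det_gtilde p u v w : dot p p = 1 ->
  \det (\matrix_(i < 3, j < 3) gtilde p (tnth [tuple u; v; w] i) (tnth [tuple u; v; w] j)) =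
  (9 / 25) ^+ 3 * gram_det (squash_form p) u v w.
Proof.
move=> p1; rewrite det_mx33 !mxE !(tnth_nth 0) /= !gtildeE // /gram_det.
rewrite (squash_formC (R8_qform R) p v u) (squash_formC (R8_qform R) p w u).
by rewrite (squash_formC (R8_qform R) p w v); field.
Qed.

End Squashed.

(** * Great spheres *)

Section GreatSpheres.
Variable R : realType.
Local Notation R8 := 'rV[R]_8.
Implicit Types (p x y u v w : R8) (W : {vspace R8}).

(** The [l]s are an orthonormal basis of the orthogonal complement. *)
Lemma dim4_equations W : \dim W = 4%N -> exists l : 'I_4 -> R8,
  (forall i j, dot (l i) (l j) = (i == j)%:R) /\
  (forall x, x \in W <-> forall j, dot (l j) x = 0).
Proof.
move=> dW.
have d8 : \dim (fullv : {vspace R8}) = 8%N by rewrite dimvf dim_matrix.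
have [e1 [W1 h1 _]] := @exists_unit_orthogonal _ W [::] ltac:(by rewrite dW).
have [e2 [W2 h2 p2]] := @exists_unit_orthogonal _ W [:: e1] ltac:(by rewrite dW).
have [e3 [W3 h3 p3]] := @exists_unit_orthogonal _ W [:: e1; e2] ltac:(by rewrite dW).
have [e4 [W4 h4 p4]] := @exists_unit_orthogonal _ W [:: e1; e2; e3] ltac:(by rewrite dW).
pose s := [:: e1; e2; e3; e4].
have [l1 [_ m1 q1]] := @exists_unit_orthogonal _ fullv s ltac:(by rewrite d8).
have [l2 [_ m2 q2]] := @exists_unit_orthogonal _ fullv (l1 :: s) ltac:(by rewrite d8).
have [l3 [_ m3 q3]] := @exists_unit_orthogonal _ fullv (l2 :: l1 :: s) ltac:(by rewrite d8).
have [l4 [_ m4 q4]] := @exists_unit_orthogonal _ fullv (l3 :: l2 :: l1 :: s) ltac:(by rewrite d8).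
pose l := tnth [tuple l1; l2; l3; l4].
have lp e : e \in s -> forall j, dot (l j) e = 0.
  move=> es; case=> [[|[|[|[|j]]]] hj] //; rewrite /l (tnth_nth 0) /=.
  - exact: q1.
  - by apply: q2; rewrite in_cons es orbT.
  - by apply: q3; rewrite in_cons in_cons es !orbT.
  - by apply: q4; rewrite in_cons in_cons in_cons es !orbT.
have lo i j : dot (l i) (l j) = (i == j)%:R.
  have a1 : dot l2 l1 = 0 by rewrite q2 ?inE ?eqxx.
  have a2 : dot l3 l1 = 0 by rewrite q3 ?inE ?eqxx ?orbT.
  have a3 : dot l3 l2 = 0 by rewrite q3 ?inE ?eqxx ?orbT.
  have a4 : dot l4 l1 = 0 by rewrite q4 ?inE ?eqxx ?orbT.
  have a5 : dot l4 l2 = 0 by rewrite q4 ?inE ?eqxx ?orbT.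
  have a6 : dot l4 l3 = 0 by rewrite q4 ?inE ?eqxx ?orbT.
  case: i j => [[|[|[|[|i]]]] hi] [[|[|[|[|j]]]] hj] //; rewrite /l !(tnth_nth 0) /= //;
    by rewrite dotC.
exists l; split=> //.
have WE x : x \in W -> forall j, dot (l j) x = 0.
  move=> xW j; have [] := frame_span dW W1 W2 W3 W4 _ _ _ xW.
  - by split.
  - by split; rewrite dotC; [rewrite p2|rewrite p3|rewrite p4]; rewrite ?inE ?eqxx ?orbT.
  - by split; rewrite dotC; [rewrite p3|rewrite p4|rewrite p4]; rewrite ?inE ?eqxx ?orbT.
  move=> r1 [r2 [r3 [r4 ->]]].
  rewrite (dotDr (l j)) (dotDr (l j)) (dotDr (l j)) !(dotZr _ (l j)) !lp ?inE ?eqxx ?orbT //.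
  by rewrite !mulr0 !addr0.
pose g x : 'rV[R]_4 := \row_j dot (l j) x.
have gl : linear g by move=> a u v; apply/rowP => i; rewrite !mxE dotDr dotZr.
pose gL := GRing.isLinear.Build R R8 'rV[R]_4 *:%R g gl.
pose g' : {linear R8 -> 'rV[R]_4} := HB.pack g gL.
have gK x : (x \in lker (linfun g')) = (g x == 0) by rewrite memv_ker lfunE.
have WK : (W <= lker (linfun g'))%VS.
  apply/subvP => x xW; rewrite gK; apply/eqP/rowP => j; rewrite !mxE; exact: WE.
have im4 : limg (linfun g') = fullv.
  apply/vspaceP => y; rewrite memvf; apply/idP/memv_imgP.
  exists (\sum_j y 0 j *: l j); first exact: memvf.
  rewrite lfunE /=; apply/rowP => i; rewrite mxE dotC dot_suml (bigD1 i) //= big1.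
    by rewrite dotZl lo eqxx mulr1 addr0.
  by move=> j ji; rewrite dotZl lo (negbTE ji) mulr0.
have dK : \dim (lker (linfun g')) = 4%N.
  have := limg_ker_dim (linfun g') fullv; rewrite capfv im4 d8 dimvf dim_matrix mul1r.
  by move/eqP; rewrite -[8%N]/(4 + 4)%N eqn_add2r => /eqP.
have WKE : W = lker (linfun g') by apply/eqP; rewrite eqEdim WK dK dW.
move=> x; split=> [|h]; first exact: WE.
by rewrite WKE gK; apply/eqP/rowP => j; rewrite !mxE h.
Qed.

Lemma is_derive_coord x v k : is_derive x v (fun y : R8 => y 0 k) (v 0 k).
Proof. by apply: (is_derive_linear (f := fun y : R8 => y 0 k : R)) => r y z; rewrite !mxE. Qed.

Lemma is_derive_dotr l x v : is_derive x v (fun y => dot l y) (dot l v).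
Proof. by apply: (is_derive_linear (f := fun y => dot l y)) => r y z; rewrite dotDr dotZr. Qed.

Section Curve.
Variables (V : normedModType R) (c : V -> R8) (t h : V) (v : R8).
Hypothesis dc : forall k, is_derive t h (fun s => c s 0 k) (v 0 k).

Lemma is_derive_dot_curve l : is_derive t h (fun s => dot l (c s)) (dot l v).
Proof.
have -> : (fun s => dot l (c s)) = \sum_k (l 0 k \*: (fun s => c s 0 k)).
  by apply/funext => s; rewrite dotE fct_sumE.
rewrite dotE; apply: is_derive_sum => k; exact: is_deriveZ.
Qed.

Lemma is_derive_norm_curve : is_derive t h (fun s => dot (c s) (c s)) (2 * dot (c t) v).
Proof.
have -> : (fun s => dot (c s) (c s)) = \sum_k ((fun s => c s 0 k) * (fun s => c s 0 k)).
  by apply/funext => s; rewrite dotE fct_sumE.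
have -> : 2 * dot (c t) v = \sum_k (c t 0 k *: v 0 k + c t 0 k *: v 0 k).
  by rewrite dotE mulr_sumr; apply: eq_bigr => k _; rewrite mulr2n mulrDl mul1r.
by apply: is_derive_sum => k; exact: is_deriveM.
Qed.

End Curve.

(** The defining equations are constant along a curve in the sphere, so their derivatives vanish.
    Conversely a nonzero [u] is the velocity of the great circle cos(kt) p + sin(kt)/k u with k =
    |u|. *)
Lemma tangent_great_sphere W p u : \dim W = 4%N -> great_sphere W p ->
  tangent (great_sphere W) p u <-> u \in W /\ dot p u = 0.
Proof.
move=> dW [pW p1]; rewrite /= in pW p1; split.
  move=> [c [c0 cA [dc cv]]].
  have ck k : is_derive (0 : R) 1 (fun s => c s 0 k) (u 0 k).
    have dk : derivable (fun s => c s 0 k) 0 1 by move/derivable_mxP: dc; exact.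
    apply: (is_derive_eq (derivableP dk)).
    by rewrite -cv derive_mx // mxE.
  have [l [_ lW]] := dim4_equations dW; split.
    apply/lW => j; have [_ <-] := is_derive_dot_curve ck (l j).
    rewrite -[RHS](@derive_cst R R R (0 : R) (0 : R) 1); apply: near_eq_derive.
    by near do (rewrite /cst; apply: (iffLR (lW _))); apply: filterS cA => s [].
  have [_] := is_derive_norm_curve ck; rewrite c0.
  have -> : 'D_1 (fun s => dot (c s) (c s)) 0 = 'D_1 (cst (1 : R)) (0 : R).
    by apply: near_eq_derive; apply: filterS cA => s [].
  rewrite derive_cst => /eqP; rewrite eq_sym mulf_eq0 pnatr_eq0 /=.
  by move/eqP.
move=> [uW pu]; have [u0|u0] := eqVneq u 0.
  exists (cst p); rewrite u0; split=> //; first by near=> t; split.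
  exact: is_derive_cst.
have d0 : 0 < dot u u.
  by rewrite lt0r dot_ge0 andbT; apply: contraNneq u0 => /dot_eq0->.
pose k := Num.sqrt (dot u u); have k2 : k ^+ 2 = dot u u by rewrite sqr_sqrtr // ltW.
have k0 : k != 0 by rewrite gt_eqF // sqrtr_gt0.
pose c (t : R) : R8 := cos (k * t) *: p + (sin (k * t) / k) *: u.
exists c; split.
- by rewrite /c !mulr0 cos0 sin0 mul0r scale1r scale0r addr0.
- near=> t; split; first by rewrite /= /c; apply: memvD; exact: memvZ.
  rewrite /= /S7 /= /c dotDl !dotDr !dotZl !dotZr (dotC u p) pu p1 -k2.
  rewrite !mulr0 addr0 add0r mulr1 -!expr2 -(cos2Dsin2 (k * t)).
  by congr (_ + _); move: (sin _) => s; field.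
have dk : is_derive (0 : R) 1 (fun t => k * t) k.
  apply: (is_derive_eq (is_derive_linear _ _ _)); last by rewrite mulr1.
  by move=> r y z; rewrite /= mulrDr /GRing.scale /=; ring.
have dcos : is_derive (0 : R) 1 (fun t => cos (k * t)) 0.
  have := @is_derive1_comp _ cos (fun t => k * t) 0 _ _ (is_derive_cos _) dk.
  by rewrite mulr0 sin0 oppr0 mul0r.
have dsin : is_derive (0 : R) 1 (fun t => sin (k * t)) k.
  have := @is_derive1_comp _ sin (fun t => k * t) 0 _ _ (is_derive_sin _) dk.
  by rewrite mulr0 cos0 mul1r.
have ck j : is_derive (0 : R) 1 (fun t => c t 0 j) (u 0 j).
  have -> : (fun t => c t 0 j) = (p 0 j \*: (fun t => cos (k * t))) + ((u 0 j / k) \*: (fun t => sin (k * t))).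
    by apply/funext => t; rewrite /c !mxE /= /GRing.scale /=; rewrite !fctE /= /GRing.scale /=; ring.
  apply: (is_derive_eq (is_deriveD (is_deriveZ _ dcos) (is_deriveZ _ dsin))).
  by rewrite /GRing.scale /= mulr0 add0r divfK.
have dc : derivable c (0 : R) 1.
  by apply/derivable_mxP => i j; rewrite ord1; have [] := ck j.
apply: DeriveDef => //; rewrite derive_mx //; apply/rowP => j; rewrite mxE.
by have [_ ->] := ck j.
Unshelve. all: by end_near. Qed.

(** A family of maps stable under directional derivatives and containing the equations of a great
    sphere; smoothness then follows by induction on the list of directions. *)
Definition quadratic_map m (c : 'I_m -> R) (l : 'I_m -> R8) (k : 'I_m -> R) x : 'rV[R]_m :=
  \row_j (c j + dot (l j) x + k j * dot x x).

Lemma is_derive_quadratic_map m (c : 'I_m -> R) l k x v :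
  is_derive x v (quadratic_map c l k) (\row_j (dot (l j) v + 2 * k j * dot x v)).
Proof.
have cj j : is_derive x v (fun y => quadratic_map c l k y 0 j) (dot (l j) v + 2 * k j * dot x v).
  have -> : (fun y => quadratic_map c l k y 0 j) =
      (cst (c j) + (fun y => dot (l j) y)) + (k j \*: (fun y : R8 => dot y y)).
    by apply/funext => y; rewrite mxE.
  have dn := is_derive_norm_curve (c := id) (fun i => is_derive_coord x v i).
  apply: (is_derive_eq (is_deriveD (is_deriveD (is_derive_cst _ _ _) (is_derive_dotr _ _ _)) (is_deriveZ _ dn))).
  by rewrite add0r; congr (_ + _); rewrite /GRing.scale /= mulrA (mulrC (k j)).
have dc : derivable (quadratic_map c l k) x v.
  by apply/derivable_mxP => i j; rewrite ord1; have [] := cj j.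
apply: DeriveDef => //; rewrite derive_mx //; apply/rowP => j; rewrite !mxE.
by have [_ ->] := cj j.
Qed.

Lemma differentiable_quadratic_map m (c : 'I_m -> R) l k x :
  differentiable (quadratic_map c l k) x.
Proof.
have dcoord i : differentiable (fun y : R8 => y 0 i) x by exact: differentiable_coord.
have ddot a : differentiable (fun y => dot a y) x.
  have -> : (fun y => dot a y) = \sum_i (a 0 i *: (fun y : R8 => y 0 i)).
    by apply/funext => y; rewrite dotE fct_sumE.
  by apply: differentiable_sum => i; exact: differentiableZ.
have dnorm : differentiable (fun y : R8 => dot y y) x.
  have -> : (fun y => dot y y) = \sum_i ((fun y : R8 => y 0 i) * (fun y : R8 => y 0 i)).
    by apply/funext => y; rewrite dotE fct_sumE.
  by apply: differentiable_sum => i; exact: differentiableM.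
have -> : quadratic_map c l k = \sum_j (fun y => (quadratic_map c l k y 0 j) *: (delta_mx 0 j : 'rV[R]_m)).
  by apply/funext => y; rewrite fct_sumE [LHS]row_sum_delta.
apply: differentiable_sum => j; apply: differentiableZl.
have -> : (fun y => quadratic_map c l k y 0 j) =
    (cst (c j) + (fun y => dot (l j) y)) + (k j *: (fun y : R8 => dot y y)).
  by apply/funext => y; rewrite mxE.
by apply: differentiableD; [apply: differentiableD => //; exact: differentiable_cst|exact: differentiableZ].
Qed.

Lemma smooth_quadratic_map m (c : 'I_m -> R) l k : smooth_on setT (quadratic_map c l k).
Proof.
move=> s x _.
suff [c' [l' [k' ->]]] : exists c' l' k',
    foldr (fun v (h : R8 -> 'rV[R]_m) => 'D_v h) (quadratic_map c l k) s = quadratic_map c' l' k'.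
  exact: differentiable_quadratic_map.
elim: s => [|v s [c' [l' [k' /= ->]]]]; first by exists c, l, k.
exists (fun j => dot (l' j) v), (fun j => (2 * k' j) *: v), (fun=> 0); apply/funext => y.
have [_ ->] := is_derive_quadratic_map c' l' k' y v; apply/rowP => j; rewrite !mxE.
by rewrite mul0r addr0 dotZl (dotC v y).
Qed.

(** A single global map works: components 0 to 3 are the linear equations of [W], component 4 is
    |x|^2 - 1. *)
Lemma great_sphere_submanifold W : \dim W = 4%N -> submanifold 3 (great_sphere W).
Proof.
move=> dW p [pW p1]; have [l [lo lW]] := dim4_equations dW.
pose l' (j : 'I_(8 - 3)) : R8 := if (j < 4)%N then l (inord j) else 0.
pose k (j : 'I_(8 - 3)) : R := if (j < 4)%N then 0 else 1.
pose F := quadratic_map (fun j => - k j) l' k.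
have Fj (j : 'I_4) x : F x 0 (widen_ord (isT : 4 <= 8 - 3)%N j) = dot (l j) x.
  rewrite mxE /k /l' /= ltn_ord inord_val oppr0; ring.
have F4 x : F x 0 (@Ordinal 5 4 isT) = dot x x - 1.
  rewrite mxE /k /l' /= dot0l; ring.
have FE x : F x = 0 <-> great_sphere W x.
  split=> [F0|[xW x1]].
    split=> /=; first by apply/lW => j; rewrite -Fj F0 mxE.
    by apply/eqP; rewrite -subr_eq0 -F4 F0 mxE.
  apply/rowP => j; rewrite [RHS]mxE; have [j4|j4] := ltnP j 4.
    have -> : j = widen_ord (isT : 4 <= 8 - 3)%N (Ordinal j4) by exact: val_inj.
    by rewrite Fj; exact: (iffLR (lW x)).
  have -> : j = @Ordinal 5 4 isT by apply: val_inj; apply/eqP; rewrite eqn_leq j4 -ltnS ltn_ord.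
  by rewrite F4 x1 subrr.
exists setT, F; split=> //.
- exact: openT.
- exact: smooth_quadratic_map.
- by rewrite setIT; apply/seteqP; split=> x /=; [move/FE|case=> _ /FE].
move=> x [[xW x1] _] y; rewrite /= in xW; rewrite /S7 /= in x1.
pose w := \sum_j y 0 (widen_ord (isT : 4 <= 8 - 3)%N j) *: l j.
have lx j : dot (l j) x = 0 by exact: (iffLR (lW x)).
have lw i : dot (l i) w = y 0 (widen_ord (isT : 4 <= 8 - 3)%N i).
  rewrite dotC dot_suml (bigD1 i) //= big1.
    by rewrite dotZl lo eqxx mulr1 addr0.
  by move=> j ji; rewrite dotZl lo (negbTE ji) mulr0.
(* [w] solves the four linear components, and moving along [x] does not disturb them; the last one
   requires 2 (x.w + r) = y_4. *)
pose r := y 0 (@Ordinal 5 4 isT) / 2 - dot x w.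
exists (w + r *: x); have [_ ->] := is_derive_quadratic_map (fun j => - k j) l' k x (w + r *: x).
apply/rowP => j; rewrite mxE; have [j4|j4] := ltnP j 4.
  have -> : j = widen_ord (isT : 4 <= 8 - 3)%N (Ordinal j4) by exact: val_inj.
  have E : inord j = Ordinal j4 :> 'I_4 by apply: val_inj; rewrite /= inordK.
  by rewrite /l' /k /= j4 E dotDr dotZr lx lw; ring.
have -> : j = @Ordinal 5 4 isT by apply: val_inj; apply/eqP; rewrite eqn_leq j4 -ltnS ltn_ord.
by rewrite /l' /k /= dot0l dotDr dotZr x1 /r; field.
Qed.

End GreatSpheres.

Section Alternating.
Variables (R : realType) (V : lmodType R) (t : V -> V -> V -> R).
Hypothesis t_lin : forall a u u' v w, t (a *: u + u') v w = a * t u v w + t u' v w.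
Hypothesis t_swap12 : forall u v w, t v u w = - t u v w.
Hypothesis t_swap23 : forall u v w, t u w v = - t u v w.

(** Used in contrapositive form: an orientation that is nonzero on some tangent triple is nonzero on
    every basis of the tangent space. *)
Lemma alternating_span_eq0 u v w : t u v w = 0 ->
  let S x := exists r s q, x = r *: u + (s *: v + q *: w) in
  forall x y z, S x -> S y -> S z -> t x y z = 0.
Proof.
move=> E S.
have half (a : R) : a = - a -> a = 0 by move=> h; lra.
have t0 y z : t 0 y z = 0.
  have := t_lin 1 0 0 y z; rewrite scaler0 addr0 mul1r => /eqP.
  by rewrite -subr_eq0 opprD addrA subrr sub0r oppr_eq0 => /eqP.
have z12 x z : t x x z = 0 by exact: half (t_swap12 x x z).
have z23 x z : t x z z = 0 by exact: half (t_swap23 x z z).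
have z13 x z : t x z x = 0 by rewrite t_swap23 z12 oppr0.
have p1 : t v u w = 0 by rewrite t_swap12 E oppr0.
have p2 : t u w v = 0 by rewrite t_swap23 E oppr0.
have p3 : t v w u = 0 by rewrite t_swap23 p1 oppr0.
have p4 : t w u v = 0 by rewrite t_swap12 p2 oppr0.
have p5 : t w v u = 0 by rewrite t_swap12 p3 oppr0.
pose zs := (z12, z23, z13, E, p1, p2, p3, p4, p5).
have lin x y z : t u y z = 0 -> t v y z = 0 -> t w y z = 0 -> S x -> t x y z = 0.
  move=> h1 h2 h3 [r [s [q ->]]]; rewrite !t_lin -[q *: w]addr0 t_lin h1 h2 h3 t0.
  by rewrite !mulr0 !addr0.
have lin2 e y z : t e u z = 0 -> t e v z = 0 -> t e w z = 0 -> S y -> t e y z = 0.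
  move=> h1 h2 h3 Sy; rewrite t_swap12 (lin y) ?oppr0 // t_swap12 ?h1 ?h2 ?h3 oppr0 //.
have lin3' e f z : t e f u = 0 -> t e f v = 0 -> t e f w = 0 -> S z -> t e f z = 0.
  move=> h1 h2 h3 Sz; rewrite t_swap23 (lin2 e z) ?oppr0 // t_swap23 ?h1 ?h2 ?h3 oppr0 //.
move=> x y z Sx Sy Sz.
apply: (lin x) => //; apply: (lin2 _ y) => //; apply: (lin3' _ _ z) => //; by rewrite ?zs.
Qed.

End Alternating.

(** * Associative great spheres: closure under the cross product, and the two families of
    examples *)

Section Associatives.
Variable R : realType.
Local Notation R8 := 'rV[R]_8.
Local Notation qf := (R8_qform R).
Local Notation assoc_form := (assoc_form (@Bform R)).
Local Notation lin_form := (lin_form (@Bform R)).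
Local Notation squash_form := (squash_form (@dot R) (@Bform R)).
Local Notation qline W := (quaternionic_line (@dot R) (@im R) (fun x => x \in W)).
Local Notation cplane W := (complex_plane (@dot R) (@im R) (@Bform R) (fun x => x \in W)).
Implicit Types (p u v w : R8) (W : {vspace R8}).

(** Complete p, u, v to an orthonormal basis of [W] by [w]. The orientation does not vanish on u, v,
    w, so squaring the equality of the 3-form and the volume form removes the sign and yields the
    hypothesis of [Gcross_span]. *)
Lemma associative3_Gcross_closed W : \dim W = 4%N ->
  associative3 (great_sphere W) -> Gcross_closed W.
Proof.
move=> dW [_ _ [t [tA _ tnz] tE]] p u v pW uW vW p1 u1 v1 pu pv uv.
have [w [wW w1 wp]] := @exists_unit_orthogonal _ W [:: p; u; v] ltac:(by rewrite dW).
have pw : dot p w = 0 by rewrite dotC wp ?inE ?eqxx.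
have uw : dot u w = 0 by rewrite dotC wp ?inE ?eqxx ?orbT.
have vw : dot v w = 0 by rewrite dotC wp ?inE ?eqxx ?orbT.
have gp : great_sphere W p by split.
have Tu x : x \in W -> dot p x = 0 -> tangent (great_sphere W) p x.
  by move=> xW px; apply/(tangent_great_sphere x dW gp).
have t0 : t p u v w != 0.
  apply/eqP => t0; have [x [y [z [Tx Ty Tz]]]] := tnz p gp.
  have [h1 h2 h3] := tA p gp.
  have S y' : tangent (great_sphere W) p y' -> exists r s q : R, y' = r *: u + (s *: v + q *: w).
    move=> /(tangent_great_sphere y' dW gp)[yW py].
    have [] := frame_span dW pW uW vW wW _ _ _ yW; try by split.
    move=> r1 [r2 [r3 [r4 E]]]; exists r2, r3, r4.
    have r10 : r1 = 0.
      move: py; rewrite E (dotDr p) (dotDr p) (dotDr p) !(dotZr _ p) p1 pu pv pw.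
      by rewrite !mulr0 mulr1 !addr0.
    by rewrite E r10 scale0r add0r addrA.
  by rewrite (alternating_span_eq0 h1 h2 h3 t0 (S x Tx) (S y Ty) (S z Tz)) eqxx.
have := tE p u v w gp (Tu u uW pu) (Tu v vW pv) (Tu w wW pw).
rewrite /vol_form phitilde_tangent // det_gtilde //.
set A := assoc_form p u v w; set G := gram_det _ _ _ _ => E.
have G0 : 0 <= G by apply: (gram_det_ge0 qf).
have E2 : (27 / 25 * A) ^+ 2 = (9 / 25) ^+ 3 * G.
  rewrite E exprMn sqr_sg t0 mul1r sqr_sqrtr //; exact: mulr_ge0.
have [||||r [s [q ->]]] := @Gcross_span _ _ _ _ _ qf p u v w p1; try by split.
  rewrite -/A -/G; have -> : G = (25 / 9) ^+ 3 * ((9 / 25) ^+ 3 * G) by field.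
  by rewrite -E2; field.
by do !apply: memvD; exact: memvZ.
Qed.

Lemma linear_continuous_R8 (f : R8 -> R) :
  (forall r x y, f (r *: x + y) = r * f x + f y) -> continuous f.
Proof.
move=> fl x.
have f0 : f 0 = 0.
  have := fl 1 0 0; rewrite scaler0 addr0 mul1r => /eqP.
  by rewrite -subr_eq0 opprD addrA subrr sub0r oppr_eq0 => /eqP.
have fD : {morph f : y z / y + z >-> y + z}.
  by move=> y z; have := fl 1 y z; rewrite scale1r mul1r.
have fZ r y : f (r *: y) = r * f y by have := fl r y 0; rewrite f0 !addr0.
have -> : f = \sum_k (fun y : R8 => y 0 k * f (delta_mx 0 k)).
  apply/funext => y; rewrite fct_sumE {1}(row_sum_delta y) (big_morph f fD f0).
  by apply: eq_bigr => k _; rewrite fZ.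
apply: differentiable_continuous; apply: differentiable_sum => k.
by apply: (differentiableZl (f (delta_mx 0 k) : R)); exact: differentiable_coord.
Qed.

(** The form k [lin_form] is the orientation. On tangent vectors it equals [assoc_form], so the sign
    in the volume form is the right one. *)
Lemma associative3_of_lin_form W (k : R) : \dim W = 4%N ->
  (forall p u v w, p \in W -> dot p p = 1 -> u \in W -> v \in W -> w \in W ->
    dot p u = 0 -> dot p v = 0 -> dot p w = 0 ->
    (5 * assoc_form p u v w) ^+ 2 = gram_det (squash_form p) u v w /\
    assoc_form p u v w = k * lin_form p u v w) ->
  (forall p, p \in W -> dot p p = 1 -> exists u v w,
    [/\ u \in W /\ dot p u = 0, v \in W /\ dot p v = 0, w \in W /\ dot p w = 0
      & assoc_form p u v w != 0]) ->
  associative3 (great_sphere W).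
Proof.
move=> dW WA Wnz; split; first by move=> x [].
  exact: great_sphere_submanifold.
exists (fun p u v w => k * lin_form p u v w); first split.
- move=> p _; have [h1 h2 h3] := lin_form_alternating qf p.
  split=> [a u u' v w|u v w|u v w].
  + by rewrite h1; move: (lin_form p u v w) (lin_form p u' v w) => s t; ring.
  + by rewrite h2 mulrN.
  + by rewrite h3 mulrN.
- move=> u v w; apply: continuous_subspaceT; apply: linear_continuous_R8 => r x y.
  by rewrite (lin_form_linear qf); move: (lin_form x u v w) (lin_form y u v w) => s t; ring.
- move=> p gp; have [pW p1] := gp.
  have [u [v [w [[uW pu] [vW pv] [wW pw] nz]]]] := Wnz p pW p1.
  exists u, v, w; split; try exact/(tangent_great_sphere _ dW gp).
  by have [_ <-] := WA p u v w pW p1 uW vW wW pu pv pw.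
move=> p u v w gp /(tangent_great_sphere _ dW gp)[uW pu] /(tangent_great_sphere _ dW gp)[vW pv].
move=> /(tangent_great_sphere _ dW gp)[wW pw]; have [pW p1] := gp.
have [E1 E2] := WA p u v w pW p1 uW vW wW pu pv pw.
rewrite /vol_form phitilde_tangent // det_gtilde // -E1 -E2.
move: (assoc_form p u v w) => A.
have -> : (9 / 25) ^+ 3 * (5 * A) ^+ 2 = (27 / 25 * A) ^+ 2 by field.
rewrite sqrtr_sqr normrM ger0_norm ?divr_ge0 ?ler0n // mulrCA.
by congr (_ * _); rewrite -numEsg.
Qed.

Lemma quaternionic_line_associative3 W e : \dim W = 4%N -> qline W e ->
  associative3 (great_sphere W).
Proof.
move=> dW le; apply: (associative3_of_lin_form (k := - 15^-1) dW).
  by move=> p u v w *; exact: (quaternionic_line_assoc qf le).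
by move=> p *; exact: (quaternionic_line_nonzero qf le).
Qed.

Lemma complex_plane_associative3 W n e f : \dim W = 4%N -> cplane W n e f ->
  associative3 (great_sphere W).
Proof.
move=> dW cp.
have WD x y : x \in W -> y \in W -> x + y \in W by exact: memvD.
have WZ (r : R) x : x \in W -> r *: x \in W by exact: memvZ.
have Ws := frame_span dW.
apply: (associative3_of_lin_form (k := 1) dW).
  by move=> p u v w *; rewrite mul1r; exact: (complex_plane_assoc qf WD WZ (fun _ _ _ _ => @Ws _ _ _ _) cp).
by move=> p *; exact: (complex_plane_nonzero qf WD WZ (fun _ _ _ _ => @Ws _ _ _ _) cp).
Qed.

Lemma associative3_cases W : \dim W = 4%N -> associative3 (great_sphere W) ->
  (exists e, qline W e) \/ (exists n e f, cplane W n e f).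
Proof.
by move=> dW /(associative3_Gcross_closed dW); exact: Gcross_closed_cases.
Qed.

End Associatives.

(** * Orbits of the standard planes *)

Section Orbits.
Variable R : realType.
Local Notation R8 := 'rV[R]_8.
Local Notation R3 := (R * R * R)%type.
Local Notation qline W := (quaternionic_line (@dot R) (@im R) (fun x => x \in W)).
Local Notation cplane W := (complex_plane (@dot R) (@im R) (@Bform R) (fun x => x \in W)).
Implicit Types (x y e f u v : R8) (q : quat R) (W : {vspace R8}) (n : R3).

Definition sp2_lin (g : 'M[R[i]]_4) x : R8 := ofC (g *m toC x).

Lemma toC_sp2_lin g x : toC (sp2_lin g x) = g *m toC x.
Proof. exact: ofCK. Qed.

Lemma toC_inj : injective (@toC R).
Proof. exact: can_inj (@toCK R). Qed.

Lemma act_lq (a : Sp1 R) (g : Sp2 R) x :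
  act (cls (a, g)) x = lq a (sp2_lin (sp2val g) x).
Proof.
apply: (etrans (actE (a, g) x)); apply: toC_inj; apply: (etrans (ofCK _)).
apply: esym; apply: (etrans (toC_lq _ _)); congr sp1_act; exact: toC_sp2_lin.
Qed.

Lemma lq_sp2_lin q (g : Sp2 R) x : lq q (sp2_lin (sp2val g) x) = sp2_lin (sp2val g) (lq q x).
Proof.
apply: toC_inj; rewrite (toC_lq q (sp2_lin _ x)) (toC_sp2_lin _ x) (toC_sp2_lin _ (lq q x)).
by rewrite (toC_lq q x) sp1_act_Sp2.
Qed.

Lemma lq_linear q (r : R) x y : lq q (r *: x + y) = r *: lq q x + lq q y.
Proof.
apply: toC_inj; apply: (etrans (toC_lq _ _)).
apply: (etrans (congr1 (sp1_act q) (toC_linear r x y))).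
apply: (etrans (sp1_act_linear _ _ _ _)); apply: (etrans _ (esym (toC_linear _ _ _))).
by congr (_ *: _ + _); exact: esym (toC_lq _ _).
Qed.

Lemma lqD q x y : lq q (x + y) = lq q x + lq q y.
Proof. by have := lq_linear q 1 x y; rewrite !scale1r. Qed.

Lemma lqZ q (r : R) x : lq q (r *: x) = r *: lq q x.
Proof.
have dbl (M : zmodType) (m : M) : m = m + m -> m = 0.
  by move=> h; apply: (addrI m); rewrite addr0 -h.
have q0 : lq q 0 = 0 by apply: dbl; rewrite -(lqD q 0 0) addr0.
by have := lq_linear q r x 0; rewrite q0 !addr0.
Qed.

Definition qim n : quat R := ((0 +i* n.1.1)%C, (n.1.2 +i* n.2)%C).

Lemma im_lq n x : im n x = lq (qim n) x.
Proof. by rewrite /qim lqE scale0r add0r -!surjective_pairing. Qed.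

Lemma lq1 x : lq (1, 0) x = x.
Proof. by apply: toC_inj; rewrite toC_lq /sp1_act /= scale1r scale0r addr0. Qed.

Lemma quat_real q : exists q0 q1 q2 q3 : R, q = ((q0 +i* q1)%C, (q2 +i* q3)%C).
Proof. by case: q => [[q0 q1] [q2 q3]]; exists q0, q1, q2, q3. Qed.

Lemma quat_eq (a0 a1 a2 a3 b0 b1 b2 b3 : R) :
  a0 = b0 -> a1 = b1 -> a2 = b2 -> a3 = b3 ->
  ((a0 +i* a1)%C, (a2 +i* a3)%C) = ((b0 +i* b1)%C, (b2 +i* b3)%C) :> quat R.
Proof. by move=> -> -> -> ->. Qed.

Lemma qmul_real (a0 a1 a2 a3 b0 b1 b2 b3 : R) :
  qmul ((a0 +i* a1)%C, (a2 +i* a3)%C) ((b0 +i* b1)%C, (b2 +i* b3)%C) =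
  (((a0 * b0 - a1 * b1 - a2 * b2 - a3 * b3) +i* (a0 * b1 + a1 * b0 + a2 * b3 - a3 * b2))%C,
   ((a0 * b2 - a1 * b3 + a2 * b0 + a3 * b1) +i* (a0 * b3 + a1 * b2 - a2 * b1 + a3 * b0))%C).
Proof.
by rewrite /qmul /=; congr (_, _); apply/eqP; rewrite eq_complex /=; apply/andP; split;
  apply/eqP; ring.
Qed.

Lemma line_lqP W e : qline W e <->
  dot e e = 1 /\ forall x, x \in W <-> exists q, x = lq q e.
Proof.
split=> -[e1 We]; split=> // x; split=> [/We|].
- by move=> [r [[[a b] c] ->]]; exists ((r +i* a)%C, (b +i* c)%C); rewrite lqE.
- move=> [q ->]; have [q0 [q1 [q2 [q3 ->]]]] := quat_real q; rewrite lqE; apply/We.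
  by exists q0, (q1, q2, q3).
- by move=> [q ->]; have [q0 [q1 [q2 [q3 ->]]]] := quat_real q; rewrite lqE; exists q0, (q1, q2, q3).
- by move=> [r [[[a b] c] ->]]; apply/We; exists ((r +i* a)%C, (b +i* c)%C); rewrite lqE.
Qed.

Lemma hq_lqr q x y : hq x (lq q y) = qmul q (hq x y).
Proof.
rewrite /hq !qcoord_lq.
move: (qcoord x 0) (qcoord x 1) (qcoord y 0) (qcoord y 1) => a b c d.
rewrite /qmul /qconj /=; congr (_, _); rewrite !(rmorphD, rmorphN, rmorphM, conjcK) /= ?conjcK; ring.
Qed.

Lemma hq_sym x y : hq y x = qconj (hq x y).
Proof.
rewrite !hqE (BformC x y) (dotC y x); move: (Bform x y) => [[a b] c] /=.
by rewrite /qconj /=; congr (_, _); apply/eqP; rewrite eq_complex /= !eqxx.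
Qed.

Lemma hq_lql q x y : hq (lq q x) y = qmul (hq x y) (qconj q).
Proof.
rewrite hq_sym hq_lqr (hq_sym x y) /qmul /qconj /=; congr (_, _);
  rewrite !(rmorphD, rmorphN, rmorphM, conjcK) /= ?conjcK; ring.
Qed.

Lemma hq_lq_lq q q' x y : hq (lq q x) (lq q' y) = qmul q' (qmul (hq x y) (qconj q)).
Proof. by rewrite (hq_lqr q' (lq q x) y) (hq_lql q x y). Qed.

Lemma sum4 (F : 'I_4 -> R[i]) :
  \sum_k F k = F (inord 0) + F (inord 1) + F (inord 2) + F (inord 3).
Proof.
rewrite !big_ord_recl big_ord0 addr0 !addrA.
by congr (F _ + F _ + F _ + F _); apply: val_inj; rewrite /= inordK.
Qed.

(** The quaternionic form packs the Hermitian product and the symplectic form of C^4; preserving it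
    means being both unitary and symplectic. *)
Lemma hq_toC x y : hq x y =
  (((map_mx conjc (toC x))^T *m toC y) 0 0, - ((toC x)^T *m (Jmx R *m toC y)) 0 0).
Proof.
rewrite /hq /qcoord; move: (toC x) (toC y) => X Y.
have H (Z : 'cV[R[i]]_4) (p : 'I_2) : toH Z 0 p = (Z (inord p.*2) 0, Z (inord p.*2.+1) 0).
  by rewrite mxE.
have [J0 J1] := JmulE Y 0; have [J2 J3] := JmulE Y 1; rewrite /= in J0 J1 J2 J3.
have -> : ((map_mx conjc X)^T *m Y) 0 0 =
    conjc (X (inord 0) 0) * Y (inord 0) 0 + conjc (X (inord 1) 0) * Y (inord 1) 0
    + conjc (X (inord 2) 0) * Y (inord 2) 0 + conjc (X (inord 3) 0) * Y (inord 3) 0.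
  by rewrite mxE sum4 !mxE.
have -> : (X^T *m (Jmx R *m Y)) 0 0 =
    X (inord 0) 0 * - Y (inord 1) 0 + X (inord 1) 0 * Y (inord 0) 0
    + X (inord 2) 0 * - Y (inord 3) 0 + X (inord 3) 0 * Y (inord 2) 0.
  by rewrite mxE sum4 J0 J1 J2 J3; congr (_ * _ + _ * _ + _ * _ + _ * _); rewrite mxE.
rewrite !H /= /qmul /qconj /=; congr (_, _); rewrite ?rmorphN /= ?conjcK; ring.
Qed.

Lemma hq_sp2_lin (g : Sp2 R) x y : hq (sp2_lin (sp2val g) x) (sp2_lin (sp2val g) y) = hq x y.
Proof.
case: g => g /= /andP[/eqP gU /eqP gJ]; rewrite !hq_toC !toC_sp2_lin.
have gV := mulmx1C gU; congr (_, - _).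
  rewrite map_mxM trmx_mul -mulmxA (mulmxA _ g) [_ *m g](_ : _ = 1%:M) ?mul1mx //.
congr (fun_of_matrix _ 0 0); rewrite trmx_mul -!mulmxA; congr (_ *m _).
by rewrite !mulmxA gJ.
Qed.

Definition qbasis1 : R8 := row8 1 0 0 0 0 0 0 0.
Definition qbasis2 : R8 := row8 0 0 0 0 1 0 0 0.

(** The complex frame e, j e, f, j f of a quaternionic frame e, f; for the standard quaternionic
    basis it is the standard basis of C^4. *)
Definition jframe e f (k : 'I_4) : R8 :=
  lq (if odd k then quat_j R else (1, 0)) (if (k < 2)%N then e else f).

Lemma toC_row8 (a0 a1 a2 a3 a4 a5 a6 a7 : R) k : (k < 4)%N ->
  toC (row8 a0 a1 a2 a3 a4 a5 a6 a7) (inord k) 0 =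
  (nth 0 [:: a0; a1; a2; a3; a4; a5; a6; a7] k.*2 +i*
   nth 0 [:: a0; a1; a2; a3; a4; a5; a6; a7] k.*2.+1)%C.
Proof.
move=> k4; rewrite !mxE !inordK //.
  by rewrite -doubleS -[8%N]/(4.*2) leq_double.
by rewrite -[8%N]/(4.*2) ltn_double.
Qed.

Lemma toC_jframe k : toC (jframe qbasis1 qbasis2 k) = delta_mx k 0.
Proof.
have jE : quat_j R = ((0 +i* 0)%C, (1 +i* 0)%C) by [].
have oE : (1, 0) = ((1 +i* 0)%C, (0 +i* 0)%C) :> quat R by [].
apply/matrixP => m z; rewrite ord1 -[m]inord_val [RHS]mxE andbT -val_eqE /= inordK //.
rewrite /jframe jE oE /qbasis1 /qbasis2.
case: k m => [[|[|[|[|k]]]] hk] [[|[|[|[|m]]]] hm] //=; rewrite lq_row8 toC_row8 //=;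
  by apply/eqP; rewrite eq_complex /=; apply/andP; split; apply/eqP; ring.
Qed.

Lemma hq_jframe e f e' f' : hq e e = hq e' e' -> hq e f = hq e' f' -> hq f f = hq f' f' ->
  forall i j, hq (jframe e f i) (jframe e f j) = hq (jframe e' f' i) (jframe e' f' j).
Proof.
move=> h1 h2 h3; have h4 : hq f e = hq f' e' by rewrite hq_sym h2 -hq_sym.
move=> i j; rewrite /jframe; apply: (etrans (hq_lq_lq _ _ _ _)).
apply: (etrans _ (esym (hq_lq_lq _ _ _ _))).
by case: (i < 2)%N; case: (j < 2)%N; rewrite ?h1 ?h2 ?h3 ?h4.
Qed.

Lemma hq_self x : hq x x = ((dot x x)%:C%C, 0).
Proof. by rewrite hqE Bform_xx. Qed.

Lemma qbasis_hq : [/\ dot qbasis1 qbasis1 = 1, dot qbasis2 qbasis2 = 1,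
  dot qbasis1 qbasis2 = 0 & Bform qbasis1 qbasis2 = 0].
Proof.
rewrite /qbasis1 /qbasis2 !dot_row8 Bform_row8; split; try ring.
by apply: R3_eq => /=; ring.
Qed.

(** The columns of [g] are the complex frame of e, f. It has the same values of [hq] as the standard
    frame, and by [hq_toC] the two components of these values give unitarity and invariance of
    [Jmx]. *)
Lemma sp2_complete e f : dot e e = 1 -> dot f f = 1 -> hq e f = 0 ->
  exists g : Sp2 R, sp2_lin (sp2val g) qbasis1 = e /\ sp2_lin (sp2val g) qbasis2 = f.
Proof.
move=> e1 f1 ef; have [b1 b2 b12 B12] := qbasis_hq.
have T := @hq_jframe e f qbasis1 qbasis2; rewrite !hq_self e1 f1 b1 b2 in T.
have {}T := T erefl; rewrite ef (iffRL (hq0P qbasis1 qbasis2) (conj b12 B12)) in T.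
have {}T := T erefl erefl.
pose g : 'M[R[i]]_4 := \matrix_(i, j) toC (jframe e f j) i 0.
pose X k := toC (jframe e f k); pose D k := toC (jframe qbasis1 qbasis2 k).
have XE k : X k = col k g by apply/colP => i; rewrite !mxE.
have DE k : D k = delta_mx k 0 by exact: toC_jframe.
have gd k : g *m D k = X k by rewrite DE XE colE.
have TT i j : (((map_mx conjc (X i))^T *m X j) 0 0, - ((X i)^T *m (Jmx R *m X j)) 0 0) =
    (((map_mx conjc (D i))^T *m D j) 0 0, - ((D i)^T *m (Jmx R *m D j)) 0 0).
  exact: etrans (esym (hq_toC _ _)) (etrans (T i j) (hq_toC _ _)).
have gd0 : g *m toC qbasis1 = toC e by have := gd 0; rewrite /X /D /jframe /= (lq1 qbasis1) (lq1 e).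
have gd2 : g *m toC qbasis2 = toC f.
  by have := gd (@Ordinal 4 2 isT); rewrite /X /D /jframe /= (lq1 qbasis2) (lq1 f).
clear gd; clearbody X D.
have gV : adjmx g *m g = 1%:M.
  apply/matrixP => i j; have := congr1 fst (TT i j); rewrite /= !XE !DE => E.
  transitivity (((map_mx conjc (col i g))^T *m col j g) 0 0).
    by rewrite !mxE; apply: eq_bigr => k _; rewrite !mxE.
  rewrite E mxE (bigD1 j) //= big1 => [|k kj]; last by rewrite !mxE (negbTE kj) mulr0.
  rewrite !mxE !eqxx addr0 mulr1 andbT eq_sym.
  by case: (i == j); rewrite ?conjc1 ?conjc0.
have gJ : g^T *m Jmx R *m g = Jmx R.
  apply/matrixP => i j; have := congr1 (fun q => - q.2) (TT i j).
  rewrite /= !opprK !XE !DE => E.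
  transitivity (((col i g)^T *m (Jmx R *m col j g)) 0 0).
    rewrite -mulmxA !mxE; apply: eq_bigr => k _; rewrite !mxE; congr (_ * _).
    by apply: eq_bigr => m _; rewrite !mxE.
  rewrite E -colE mxE (bigD1 i) //= big1 => [|k ki]; last by rewrite !mxE (negbTE ki) mul0r.
  by rewrite !mxE !eqxx addr0 mul1r.
have gS : is_Sp2 g by rewrite /is_Sp2 (mulmx1C gV) gJ !eqxx.
exists (MkSp2 gS); split; apply: toC_inj; apply: (etrans (toC_sp2_lin _ _)).
  exact: gd0.
exact: gd2.
Qed.

Lemma mem_V1_lq x : x \in V1 R <-> exists q, x = lq q qbasis1.
Proof.
rewrite mem_V1; split=> [|[q ->]].
  have [a0 [a1 [a2 [a3 [a4 [a5 [a6 [a7 ->]]]]]]]] := row8P x.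
  have -> : 2 = inord 2 :> 'I_4 by apply: val_inj; rewrite /= inordK.
  have -> : 3 = inord 3 :> 'I_4 by apply: val_inj; rewrite /= inordK.
  rewrite !toC_row8 //= => /andP[/eqP[-> ->] /eqP[-> ->]].
  exists ((a0 +i* a1)%C, (a2 +i* a3)%C); rewrite /qbasis1 lq_row8; congr row8; ring.
have [q0 [q1 [q2 [q3 ->]]]] := quat_real q; rewrite /qbasis1 lq_row8.
have -> : 2 = inord 2 :> 'I_4 by apply: val_inj; rewrite /= inordK.
have -> : 3 = inord 3 :> 'I_4 by apply: val_inj; rewrite /= inordK.
by rewrite !toC_row8 //= !eq_complex /= !mulr0 !subr0 !addr0 !eqxx.
Qed.

Lemma mem_V2_lq x : x \in V2 R <->
  exists z z' : R[i], x = lq (z, 0) qbasis1 + lq (z', 0) qbasis2.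
Proof.
have e1 : 1 = inord 1 :> 'I_4 by apply: val_inj; rewrite /= inordK.
have e3 : 3 = inord 3 :> 'I_4 by apply: val_inj; rewrite /= inordK.
rewrite mem_V2 e3 e1; split=> [|[[a b] [[a' b'] ->]]].
  have [a0 [a1 [a2 [a3 [a4 [a5 [a6 [a7 ->]]]]]]]] := row8P x.
  rewrite !toC_row8 //= => /andP[/eqP[-> ->] /eqP[-> ->]].
  exists (a0 +i* a1)%C, (a4 +i* a5)%C; rewrite /qbasis1 /qbasis2.
  rewrite -[(a0 +i* a1, 0)%C]/((a0 +i* a1)%C, (0 +i* 0)%C) -[(a4 +i* a5, 0)%C]/((a4 +i* a5)%C, (0 +i* 0)%C).
  by rewrite !lq_row8 add_row8; congr row8; ring.
rewrite -[((a +i* b)%C, 0)]/((a +i* b)%C, (0 +i* 0)%C) -[((a' +i* b')%C, 0)]/((a' +i* b')%C, (0 +i* 0)%C).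
rewrite /qbasis1 /qbasis2 !lq_row8 add_row8 !toC_row8 //= !eq_complex /=.
by rewrite !(mulr0, mul0r, subr0, addr0) !eqxx.
Qed.

End Orbits.

Lemma mem4 (T : eqType) (a b c d : T) : let s := [:: a; b; c; d] in
  [/\ a \in s, b \in s, c \in s & d \in s].
Proof. by rewrite /= !inE !eqxx !orbT. Qed.

(** * Images of the standard planes, transitivity on each family, and stabilizers *)

Section Stabilizers.
Variable R : realType.
Local Notation R8 := 'rV[R]_8.
Local Notation R3 := (R * R * R)%type.
Local Notation qline W := (quaternionic_line (@dot R) (@im R) (fun x => x \in W)).
Local Notation cplane W := (complex_plane (@dot R) (@im R) (@Bform R) (fun x => x \in W)).
Local Notation b1 := (qbasis1 R).
Local Notation b2 := (qbasis2 R).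
Local Notation lin g := (sp2_lin (sp2val g)).
Implicit Types (e f u v : R8) (q : quat R) (W : {vspace R8}) (n : R3) (a : Sp1 R) (g : Sp2 R).

Lemma mem_act_vs (x : Sp1Sp2 R) W y : y \in act_vs x W <-> exists2 v, v \in W & y = act x v.
Proof.
split=> [/memv_imgP[v vW ->]|[v vW ->]]; first by exists v => //; exact: lfunE.
by apply/memv_imgP; exists v => //; exact: esym (lfunE _ _).
Qed.

Lemma act_vsM (x y : Sp1Sp2 R) W : act_vs (x * y)%g W = act_vs x (act_vs y W).
Proof.
apply/vspaceP => z; apply/idP/idP => /mem_act_vs[v vW E]; apply/mem_act_vs.
  exists (act y v); last exact: (etrans E (actM x y v)).
  by apply/mem_act_vs; exists v; [exact: vW|reflexivity].
move: vW => /mem_act_vs[w wW E']; exists w; first exact: wW.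
apply: (etrans E); apply: (etrans (congr1 (act x) E')); exact: (esym (actM x y w)).
Qed.

Lemma act_vs1 W : act_vs 1%g W = W.
Proof.
apply/vspaceP => z; apply/idP/idP => [/mem_act_vs[v vW ->]|zW].
  by have -> := act1 v.
by apply/mem_act_vs; exists z; [exact: zW|exact: (esym (act1 z))].
Qed.

Lemma act_vsK (x : Sp1Sp2 R) W : act_vs x^-1%g (act_vs x W) = W.
Proof. by rewrite -act_vsM mulVg act_vs1. Qed.

Lemma dim_act_vs (x : Sp1Sp2 R) W : \dim (act_vs x W) = \dim W.
Proof.
have le (y : Sp1Sp2 R) (U : {vspace R8}) : (\dim (act_vs y U) <= \dim U)%N.
  by rewrite -(limg_ker_dim (linfun (act y)) U) leq_addl.
apply/eqP; rewrite eqn_leq le /= -{1}(act_vsK x W); exact: le.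
Qed.

Lemma dim_coord_plane (i j k l : 'I_8) : uniq [:: i; j; k; l] ->
  \dim (coord_plane R [:: i; j; k; l]) = 4%N.
Proof.
move=> uq; pose s := [tuple i; j; k; l].
pose X := [tuple of map (fun m => delta_mx 0 m : R8) s].
have dd (m m' : 'I_8) : dot (delta_mx 0 m : R8) (delta_mx 0 m' : R8) = (m == m')%:R.
  rewrite dotE (bigD1 m) //= big1 => [|p pm]; last by rewrite !mxE (negbTE pm) andbF mul0r.
  by rewrite !mxE !eqxx mul1r addr0.
have Xn (p : 'I_4) : X`_p = delta_mx 0 (tnth s p) :> R8.
  by rewrite (nth_map i) ?size_tuple // (tnth_nth i).
have fX : free X.
  apply: orthogonal_free => [p p' pp|p]; rewrite !Xn.
    rewrite dd; case: eqVneq => // E; case/negP: pp; apply/eqP/val_inj/eqP.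
    have := E; rewrite !(tnth_nth i) => E'.
    by have := @nth_uniq _ i [:: i; j; k; l] p p' (ltn_ord p) (ltn_ord p') uq => <-; apply/eqP; exact: E'.
  apply/eqP => /(congr1 (fun z : R8 => dot z (delta_mx 0 (tnth s p)))).
  by rewrite dd dot0l eqxx => /eqP; rewrite oner_eq0.
exact: (eqP fX).
Qed.

Lemma dim_V1 : \dim (V1 R) = 4%N.
Proof. by apply: dim_coord_plane; rewrite /= !inE -!val_eqE /= !inordK. Qed.
Lemma dim_V2 : \dim (V2 R) = 4%N.
Proof. by apply: dim_coord_plane; rewrite /= !inE -!val_eqE /= !inordK. Qed.

Lemma sp1_inv_mul a q : qmul a (qmul (qconj a) q) = q.
Proof. by rewrite qmulA qmulKC (eqP (valP a)) qmul1q. Qed.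

Lemma mem_act_V1 a g y : y \in act_vs (cls (a, g)) (V1 R) <-> exists q, y = lq q (lin g b1).
Proof.
split=> [/mem_act_vs[v /mem_V1_lq[q ->] ->]|[q ->]].
  exists (qmul a q); rewrite lqM (lq_sp2_lin q g b1); exact: act_lq.
apply/mem_act_vs; exists (lq (qmul (qconj a) q) b1).
  by apply/mem_V1_lq; exists (qmul (qconj a) q).
rewrite -{1}[q](sp1_inv_mul a) lqM (lq_sp2_lin _ g b1); exact: esym (act_lq _ _ _).
Qed.

Lemma sp2_linD (g : 'M[R[i]]_4) u v : sp2_lin g (u + v) = sp2_lin g u + sp2_lin g v.
Proof.
apply: toC_inj; have tD (x y : R8) : toC (x + y) = toC x + toC y.
  by have := toC_linear 1 x y; rewrite !scale1r.
rewrite [RHS]tD !toC_sp2_lin -mulmxDr; congr (_ *m _); exact: tD.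
Qed.

Lemma mem_act_V2 a g y : y \in act_vs (cls (a, g)) (V2 R) <-> exists z z' : R[i],
  y = lq (qmul a (z, 0)) (lin g b1) + lq (qmul a (z', 0)) (lin g b2).
Proof.
have L z (b : R8) : lq a (lin g (lq (z, 0) b)) = lq (qmul a (z, 0)) (lin g b).
  exact: (etrans (congr1 (lq a) (esym (lq_sp2_lin (z, 0) g b))) (esym (lqM a (z, 0) (lin g b)))).
have E z z' : act (cls (a, g)) (lq (z, 0) b1 + lq (z', 0) b2) =
    lq (qmul a (z, 0)) (lin g b1) + lq (qmul a (z', 0)) (lin g b2).
  apply: (etrans (act_lq a g _)).
  apply: (etrans (congr1 (lq a) (sp2_linD (sp2val g) (lq (z, 0) b1) (lq (z', 0) b2)))).
  apply: (etrans (lqD a (lin g (lq (z, 0) b1)) (lin g (lq (z', 0) b2)))).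
  exact: (f_equal2 +%R (L z b1) (L z' b2)).
split=> [/mem_act_vs[v /mem_V2_lq[z [z' ->]] ->]|[z [z' ->]]].
  by exists z, z'; exact: E.
apply/mem_act_vs; exists (lq (z, 0) b1 + lq (z', 0) b2); last exact: esym (E _ _).
by apply/mem_V2_lq; exists z, z'.
Qed.

Lemma dot_lin g u v : dot (lin g u) (lin g v) = dot u v.
Proof. by have := congr1 (fun q => complex.Re q.1) (hq_sp2_lin g u v); rewrite !hqE. Qed.

Lemma act_V1_line (x : Sp1Sp2 R) : exists e, qline (act_vs x (V1 R)) e.
Proof.
have [[a g] ->] := cls_surj x; exists (lin g b1); apply/line_lqP; split.
  by have [h _ _ _] := qbasis_hq R; rewrite (dot_lin g b1 b1).
by move=> y; exact: mem_act_V1.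
Qed.

(** A unit [f] orthogonal to the quaternionic line of [e] exists since that line is spanned by 4 < 8
    vectors; [sp2_complete] then moves the standard basis to e, f. *)
Lemma line_orbit W e : qline W e -> exists x, W = act_vs x (V1 R).
Proof.
move=> /line_lqP[e1 We].
have d8 : \dim (fullv : {vspace R8}) = 8%N by rewrite dimvf dim_matrix.
have [f [_ f1 fo]] := @exists_unit_orthogonal _ fullv
  [:: e; cstruct 0 e; cstruct 1 e; cstruct 2 e] ltac:(by rewrite d8).
have ef : hq e f = 0.
  apply/hq0P; split; first by apply: (etrans (dotC _ _)); apply: fo; exact: mem_head.
  rewrite (BformE e f); apply: R3_eq; apply: (etrans (dotC _ _)); apply: fo.
  - have [_ h _ _] := mem4 e (cstruct 0 e) (cstruct 1 e) (cstruct 2 e); exact: h.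
  - have [_ _ h _] := mem4 e (cstruct 0 e) (cstruct 1 e) (cstruct 2 e); exact: h.
  - have [_ _ _ h] := mem4 e (cstruct 0 e) (cstruct 1 e) (cstruct 2 e); exact: h.
have [g [gE _]] := sp2_complete e1 f1 ef.
exists (cls (1%g, g)); apply/vspaceP => y; apply/idP/idP.
  by move=> /We[q ->]; apply/mem_act_V1; exists q; rewrite gE.
by move=> /mem_act_V1[q ->]; apply/We; exists q; rewrite gE.
Qed.

(** The hypothesis n a = a i turns a (r + s i) into (r + s n) a. *)
Lemma lq_rotation a n (r s : R) x : qmul (qim n) a = qmul a (quat_i R) ->
  lq (qmul a ((r +i* s)%C, 0)) x = r *: lq a x + s *: im n (lq a x).
Proof.
move=> na; rewrite lqM -[((r +i* s)%C, 0)]/((r +i* s)%C, (0 +i* 0)%C) (lqE r s 0 0 x).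
rewrite (lq_linear a r x _); congr (_ + _).
have -> : (s, 0, 0) = s *: (1, 0, 0) :> R3.
  by apply: R3_eq; rewrite /= /GRing.scale /= ?mulr1 ?mulr0.
rewrite (imZl s (1, 0, 0) x) (im_lq n (lq a x)) -lqM na lqM.
rewrite (lqZ a s (im (1, 0, 0) x)); congr (s *: lq a _); exact: im_lq.
Qed.

Lemma sp1_real a : exists a0 a1 a2 a3 : R,
  sp1val a = ((a0 +i* a1)%C, (a2 +i* a3)%C) /\ a0 ^+ 2 + a1 ^+ 2 + a2 ^+ 2 + a3 ^+ 2 = 1.
Proof.
have [a0 [a1 [a2 [a3 E]]]] := quat_real (sp1val a); exists a0, a1, a2, a3; split=> //.
have : qnorm2 (sp1val a) == 1 by exact: valP a.
rewrite E qnorm2_real.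
by rewrite eq_complex /= eqxx andbT => /eqP.
Qed.

(* n = a i a^{-1} *)
Definition sp1_axis a : R3 :=
  let a0 := complex.Re (sp1val a).1 in let a1 := complex.Im (sp1val a).1 in
  let a2 := complex.Re (sp1val a).2 in let a3 := complex.Im (sp1val a).2 in
  (a0 ^+ 2 + a1 ^+ 2 - a2 ^+ 2 - a3 ^+ 2, 2 * (a1 * a2 + a0 * a3), 2 * (a1 * a3 - a0 * a2)).

Lemma sp1_axisP a : dot3 (sp1_axis a) (sp1_axis a) = 1 /\
  qmul (qim (sp1_axis a)) a = qmul a (quat_i R).
Proof.
have [a0 [a1 [a2 [a3 [E h]]]]] := sp1_real a.
rewrite /sp1_axis E /=; split.
  transitivity ((a0 ^+ 2 + a1 ^+ 2 + a2 ^+ 2 + a3 ^+ 2) ^+ 2); last by rewrite h expr1n.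
  by rewrite /dot3 /=; ring.
rewrite /qim /= -[quat_i R]/((0 +i* 1)%C, (0 +i* 0)%C) !qmul_real.
have N (c d : R) : c = (a0 ^+ 2 + a1 ^+ 2 + a2 ^+ 2 + a3 ^+ 2) * d -> c = d by rewrite h mul1r.
by apply: quat_eq; apply: N; ring.
Qed.

(** Since n^2 = -1, n (1 - n i) = n + i = (1 - n i) i. This quaternion has square norm 2 + 2 n1 and
    vanishes only for n = - i, where j does instead. *)
Lemma exists_sp1_axis n : dot3 n n = 1 -> exists a, qmul (qim n) a = qmul a (quat_i R).
Proof.
case: n => [[n1 n2] n3]; rewrite /dot3 /= => h.
have iE : quat_i R = ((0 +i* 1)%C, (0 +i* 0)%C) by [].
have [E|ne] := eqVneq n1 (-1).
  have n20 : n2 = 0 by apply/eqP; rewrite -sqrf_eq0; apply/eqP; move: h (sqr_ge0 n2) (sqr_ge0 n3); rewrite E; lra.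
  have n30 : n3 = 0 by apply/eqP; rewrite -sqrf_eq0; apply/eqP; move: h (sqr_ge0 n3); rewrite E n20; lra.
  exists (sp1_j R); rewrite iE /qim E n20 n30 /= /quat_j.
  rewrite -[(0 : R[i], 1 : R[i])]/((0 +i* 0)%C, (1 +i* 0)%C) !qmul_real.
  by apply: quat_eq; ring.
have p0 : 0 < 2 + 2 * n1.
  have : -1 <= n1.
    have := sqr_ge0 n2; have := sqr_ge0 n3; rewrite !expr2 => h3 h2.
    have : n1 * n1 <= 1 by lra.
    move=> h1; rewrite leNgt; apply/negP => lt.
    have : 0 < (- n1 - 1) * (1 - n1) by apply: mulr_gt0; lra.
    by rewrite mulrBl mulrBr; lra.
  by rewrite le_eqVlt eq_sym (negbTE ne) /=; lra.
pose r := (Num.sqrt (2 + 2 * n1))^-1.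
have r2 : r ^+ 2 * (2 + 2 * n1) = 1 by rewrite exprVn sqr_sqrtr ?mulVf ?gt_eqF // ltW.
have qn : qnorm2 ((r * (1 + n1) +i* 0)%C, ((- r * n3) +i* (r * n2))%C) == 1 :> R[i].
  rewrite qnorm2_real; apply/eqP; congr (_%:C)%C.
  transitivity (r ^+ 2 * (1 + 2 * n1 + (n1 * n1 + n2 * n2 + n3 * n3))); first by ring.
  by rewrite h -[RHS]r2; ring.
exists (MkSp1 qn); rewrite /= iE /qim /= !qmul_real; apply: quat_eq; try ring.
transitivity (r * n1 + r * (n1 * n1 + n2 * n2 + n3 * n3)); first by ring.
by rewrite h; ring.
Qed.

End Stabilizers.

Lemma lincomb4_unit (K : ringType) (M : lmodType K) (x y z t : M) :
  x = 1 *: x + 0 *: y + 0 *: z + 0 *: t /\ y = 0 *: x + 1 *: y + 0 *: z + 0 *: t.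
Proof. by rewrite !scale1r !scale0r !addr0 add0r. Qed.

Section Stabilizers2.
Variable R : realType.
Local Notation R8 := 'rV[R]_8.
Local Notation R3 := (R * R * R)%type.
Local Notation cplane W := (complex_plane (@dot R) (@im R) (@Bform R) (fun x => x \in W)).
Local Notation b1 := (qbasis1 R).
Local Notation b2 := (qbasis2 R).
Local Notation lin g := (sp2_lin (sp2val g)).
Implicit Types (e f u v x y : R8) (q : quat R) (W : {vspace R8}) (a : Sp1 R) (g : Sp2 R).

Lemma qmulq0 q : qmul q 0 = 0.
Proof.
have [a0 [a1 [a2 [a3 ->]]]] := quat_real q.
have z : (0 : quat R) = ((0 +i* 0)%C, (0 +i* 0)%C) by [].
by rewrite z qmul_real; apply: quat_eq; ring.
Qed.
Lemma qconj0 : qconj (0 : quat R) = 0.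
Proof. by apply/eqP; rewrite xpair_eqE !eq_complex /= !oppr0 !eqxx. Qed.
Lemma qmul0q q : qmul 0 q = 0.
Proof. by rewrite /qmul /= !mul0r subr0 addr0. Qed.
Lemma qconj_involutive : involutive (@qconj R).
Proof. by case=> z w; rewrite /qconj /= conjcK opprK. Qed.

Lemma lq_unit a x : dot x x = 1 -> dot (lq a x) (lq a x) = 1.
Proof.
move=> x1; have := hq_lq_lq a a x x; rewrite (hq_self x) (hq_self (lq a x)) x1.
rewrite (qmul1q (qconj a)) qmulKC; have -> : qnorm2 (sp1val a) = 1 by exact: (eqP (valP a)).
by move=> /(congr1 (fun q => complex.Re q.1)).
Qed.

Lemma lq_hq0 a x y : hq x y = 0 -> hq (lq a x) (lq a y) = 0.
Proof. by move=> h; have := hq_lq_lq a a x y; rewrite h qmul0q qmulq0. Qed.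

Lemma lin_hq0 g x y : hq x y = 0 -> hq (lin g x) (lin g y) = 0.
Proof. by move=> h; have := hq_sp2_lin g x y; rewrite h. Qed.

Lemma qbasis_hq0 : hq b1 b2 = 0.
Proof. by have [_ _ h1 h2] := qbasis_hq R; apply/hq0P. Qed.

Lemma act_V2_plane a g :
  cplane (act_vs (cls (a, g)) (V2 R)) (sp1_axis a) (lq a (lin g b1)) (lq a (lin g b2)).
Proof.
have [n1 na] := sp1_axisP a; have [h1 h2 _ _] := qbasis_hq R.
split=> //.
- by apply: lq_unit; rewrite (dot_lin g b1 b1).
- by apply: lq_unit; rewrite (dot_lin g b2 b2).
- by apply/hq0P/lq_hq0/lin_hq0/qbasis_hq0.
move=> y; split=> [/mem_act_V2[[r s] [[r' s'] ->]]|[r [s [r' [s' ->]]]]].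
  exists r, s, r', s'; rewrite (lq_rotation r s (lin g b1) na) (lq_rotation r' s' (lin g b2) na).
  exact: addrA.
apply/mem_act_V2; exists (r +i* s)%C, (r' +i* s')%C.
rewrite (lq_rotation r s (lin g b1) na) (lq_rotation r' s' (lin g b2) na).
exact: esym (addrA _ _ _).
Qed.

(** Left multiplication by the inverse of [a] turns [n] into i, after which Sp(2) carries the
    standard basis to the rotated pair. *)
Lemma plane_orbitP W n e f : cplane W n e f -> exists x : Sp1Sp2 R, W = act_vs x (V2 R).
Proof.
move=> [n1 e1 f1 [ef Bef] We]; have [a na] := exists_sp1_axis n1.
pose a' := sp1_inv a.
have ef0 : hq e f = 0 by apply/hq0P.
have [g [g1 g2]] := sp2_complete (lq_unit a' e1) (lq_unit a' f1) (lq_hq0 a' ef0).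
have aK x : lq a (lq a' x) = x.
  rewrite -(lqM a a' x) /= qmulKC; have -> : qnorm2 (sp1val a) = 1 by exact: (eqP (valP a)).
  exact: lq1.
have L r s x : lq (qmul a ((r +i* s)%C, 0)) (lq a' x) = r *: x + s *: im n x.
  by rewrite (lq_rotation r s (lq a' x) na) (aK x).
exists (cls (a, g)); apply/vspaceP => y; apply/idP/idP.
  move=> /We[r [s [r' [s' ->]]]]; apply/mem_act_V2; exists (r +i* s)%C, (r' +i* s')%C.
  rewrite g1 g2 (L r s e) (L r' s' f); exact: esym (addrA _ _ _).
move=> /mem_act_V2[[r s] [[r' s']]]; rewrite g1 g2 (L r s e) (L r' s' f) => ->.
by apply/We; exists r, s, r', s'; exact: addrA.
Qed.

Lemma act_vs_stable (x : Sp1Sp2 R) W : (forall v, v \in W -> act x v \in W) -> act_vs x W = W.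
Proof.
move=> h; apply/eqP; rewrite eqEdim dim_act_vs leqnn andbT.
by apply/subvP => y /mem_act_vs[v vW ->]; exact: h.
Qed.

Lemma stabilizer_act (x : Sp1Sp2 R) W v : stabilizer W x -> v \in W -> act x v \in W.
Proof. by move=> sx vW; rewrite -sx; apply/mem_act_vs; exists v. Qed.

Lemma qcoordE x : qcoord x 0 = (toC x 0 0, toC x 1 0) /\ qcoord x 1 = (toC x 2 0, toC x 3 0).
Proof.
have E k : (k < 4)%N -> forall j : 'I_4, val j = k -> inord k = j.
  by move=> k4 j jk; apply: val_inj; rewrite /= inordK.
have T (p : 'I_2) : qcoord x p = (toC x (inord p.*2) 0, toC x (inord p.*2.+1) 0).
  by rewrite /qcoord [LHS]mxE.
by rewrite (T 0) (T 1) /=; split; congr (toC x _ 0, toC x _ 0); apply: E.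
Qed.

Lemma mem_V1_qcoord x : x \in V1 R <-> qcoord x 1 = 0.
Proof.
have [_ ->] := qcoordE x; rewrite mem_V1; split=> [/andP[/eqP-> /eqP->]//|].
by move=> /eqP; rewrite xpair_eqE.
Qed.

Lemma mem_V2_qcoord x : x \in V2 R <-> (qcoord x 0).2 = 0 /\ (qcoord x 1).2 = 0.
Proof.
have [-> ->] := qcoordE x; rewrite mem_V2 /=; split=> [/andP[/eqP-> /eqP->]//|[-> ->]].
by rewrite !eqxx.
Qed.

Lemma qcoordD x y i : qcoord (x + y) i = qcoord x i + qcoord y i.
Proof.
have tD : toC (x + y) = toC x + toC y by have := toC_linear 1 x y; rewrite !scale1r.
by rewrite /qcoord tD !mxE.
Qed.

Lemma qcoord_qbasis : [/\ qcoord b1 0 = (1, 0), qcoord b1 1 = 0,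
  qcoord b2 0 = 0 & qcoord b2 1 = (1, 0)].
Proof.
have [h1 h2] := @qcoord_row8 R 1 0 0 0 0 0 0 0.
by have [h3 h4] := @qcoord_row8 R 0 0 0 0 1 0 0 0; split; rewrite ?h1 ?h2 ?h3 ?h4.
Qed.

Lemma qcoord_expand x : x = lq (qcoord x 0) b1 + lq (qcoord x 1) b2.
Proof.
have [h1 h2 h3 h4] := qcoord_qbasis.
apply: qcoord_inj => i; apply: esym; apply: (etrans (qcoordD _ _ _)).
apply: (etrans (f_equal2 +%R (qcoord_lq (qcoord x 0) b1 i) (qcoord_lq (qcoord x 1) b2 i))).
case: i => [[|[|i]] hi] //.
  have -> : Ordinal hi = 0 by exact: val_inj.
  by rewrite h1 h3 qmulq0 qmulq1 addr0.
have -> : Ordinal hi = 1 by exact: val_inj.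
by rewrite h2 h4 qmulq0 qmulq1 add0r.
Qed.

Lemma qcoord_lin g x i :
  qcoord (lin g x) i = qmul (qcoord x 0) (qcoord (lin g b1) i) + qmul (qcoord x 1) (qcoord (lin g b2) i).
Proof.
have E : lin g x = lq (qcoord x 0) (lin g b1) + lq (qcoord x 1) (lin g b2).
  exact: (etrans (congr1 (lin g) (qcoord_expand x)) (etrans (sp2_linD _ _ _)
    (f_equal2 +%R (esym (lq_sp2_lin (qcoord x 0) g b1)) (esym (lq_sp2_lin (qcoord x 1) g b2))))).
exact: (etrans (congr1 (fun y => qcoord y i) E) (etrans (qcoordD _ _ _)
  (f_equal2 +%R (qcoord_lq (qcoord x 0) (lin g b1) i) (qcoord_lq (qcoord x 1) (lin g b2) i)))).
Qed.

(** Images of the quaternionic basis, conjugated because a quaternionic matrix acts on rows through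
    its conjugate transpose. *)
Definition sp2_qmx g : 'M[quat R]_2 :=
  \matrix_(p, k) qconj (qcoord (lin g (if k == 0 then b1 else b2)) p).

Lemma sum2 (M : zmodType) (F : 'I_2 -> M) : \sum_i F i = F 0 + F 1.
Proof. by rewrite !big_ord_recl big_ord0 addr0; congr (F _ + F _); exact: val_inj. Qed.

Lemma sp2_qmx_rep g : quat_rep (sp2_qmx g) (sp2val g).
Proof.
move=> u p; rewrite sum2.
have -> : qconj (sp2_qmx g p 0) = qcoord (lin g b1) p by rewrite mxE qconj_involutive.
have -> : qconj (sp2_qmx g p 1) = qcoord (lin g b2) p by rewrite mxE qconj_involutive.
have C i : qcoord (ofC u) i = toH u 0 i by rewrite /qcoord ofCK.
rewrite -(C 0) -(C 1); apply: (etrans _ (qcoord_lin g (ofC u) p)).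
by rewrite /qcoord toC_sp2_lin ofCK.
Qed.

Lemma quat_rep_qcoord A g : quat_rep A (sp2val g) ->
  forall p, qcoord (lin g b1) p = qconj (A p 0) /\ qcoord (lin g b2) p = qconj (A p 1).
Proof.
move=> gA p; have [h1 h2 h3 h4] := qcoord_qbasis.
have E x : qcoord (lin g x) p = qmul (qcoord x 0) (qconj (A p 0)) + qmul (qcoord x 1) (qconj (A p 1)).
  by have := gA (toC x) p; rewrite sum2 -toC_sp2_lin.
split; [rewrite (E b1) h1 h2|rewrite (E b2) h3 h4].
  by rewrite qmul1q qmul0q addr0.
by rewrite qmul1q qmul0q add0r.
Qed.

Lemma stabilizer_V1 : stabilizer (V1 R) = K1 R.
Proof.
have [h1 h2 h3 h4] := qcoord_qbasis.
apply/seteqP; split=> x.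
  have [[a g] ->] := cls_surj x => sx; exists (a, g) => //=; split=> //.
  exists (sp2_qmx g); first exact: sp2_qmx_rep.
  have b1V : lin g b1 \in V1 R.
    rewrite -sx; apply/mem_act_V1; exists (1, 0); exact: esym (lq1 _).
  have z1 := iffLR (mem_V1_qcoord _) b1V.
  (* The image of [b1] is a unit vector with only a first coordinate, so orthogonality kills the
     first coordinate of the image of [b2]. *)
  have z2 : qcoord (lin g b2) 0 = 0.
    have := lin_hq0 g qbasis_hq0; rewrite /hq z1.
    rewrite qconj0 qmulq0 addr0 => E; have n1 : qnorm2 (qcoord (lin g b1) 0) = 1.
      have := qnorm2_qcoord (lin g b1); rewrite z1 (dot_lin g b1 b1).
      have [-> _ _ _] := qbasis_hq R.
      by rewrite {2}/qnorm2 /= !mul0r !addr0.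
    have := congr1 (fun q => qmul q (qcoord (lin g b1) 0)) E.
    by rewrite /= qmul0q -qmulA qconjK n1 qmulq1.
  move=> p k pk; rewrite mxE.
  case: p k pk => [[|[|p]] hp] [[|[|k]] hk] //= _.
    have -> : Ordinal hp = 0 by exact: val_inj.
    by rewrite z2 qconj0.
  have -> : Ordinal hp = 1 by exact: val_inj.
  by rewrite z1 qconj0.
move=> [[a g] /= [_ [A gA A0]] <-]; apply: act_vs_stable => v vV.
rewrite [act _ _]act_lq; apply/mem_V1_qcoord.
rewrite (qcoord_lq a (lin g v)) qcoord_lin (iffLR (mem_V1_qcoord v) vV) qmul0q addr0.
have [-> _] := quat_rep_qcoord gA 1; rewrite A0 //.
by rewrite qconj0 !qmulq0.
Qed.

Lemma V2_Bform x y : x \in V2 R -> y \in V2 R ->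
  (Bform x y).1.2 = 0 /\ (Bform x y).2 = 0.
Proof.
move=> /mem_V2_qcoord[x0 x1] /mem_V2_qcoord[y0 y1].
have : (hq x y).2 = 0.
  rewrite /hq /= /qmul /qconj /= x0 x1 y0 y1; ring.
by rewrite hqE /= => /eqP; rewrite eq_complex /= => /andP[/eqP-> /eqP->].
Qed.

(** The axis n is recovered from the image plane as B(e, n e), while [B] takes values in R i on
    [V2]. Hence the j and k components of n vanish, and these are, up to sign and a factor 2, the
    imaginary and real parts of the product of the two components of [a]. *)
Lemma stabilizer_V2_axis a g : stabilizer (V2 R) (cls (a, g)) ->
  (sp1val a).1 * (sp1val a).2 = 0.
Proof.
move=> sx; have [n1 e1 _ _ We] := act_V2_plane a g; rewrite sx in We.
set e := lq a (lin g b1) in We e1 *.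
have eV : e \in V2 R.
  by apply/We; exists 1, 0, 0, 0; exact: (proj1 (lincomb4_unit _ _ _ _)).
have neV : im (sp1_axis a) e \in V2 R.
  by apply/We; exists 0, 1, 0, 0; exact: (proj2 (lincomb4_unit _ _ _ _)).
have := V2_Bform eV neV; rewrite (qf_B_im_self (R8_qform R) (sp1_axis a) e1).
have [a0 [a1 [a2 [a3 [E _]]]]] := sp1_real a; rewrite /sp1_axis E /= => -[h2 h3].
apply/eqP; rewrite eq_complex /=; apply/andP; split; apply/eqP; lra.
Qed.

Lemma stabilizer_V2_U2 a g : (sp1val a).2 = 0 -> stabilizer (V2 R) (cls (a, g)) ->
  @U2 R g.
Proof.
move=> a2 sx.
exists (sp2_qmx g); first exact: sp2_qmx_rep.
have a1 : (sp1val a).1 != 0.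
  apply/eqP => a1; have := valP a; rewrite /qnorm2 /= a1 a2 !mul0r addr0.
  by rewrite eq_sym oner_eq0.
have key b : b \in V2 R -> forall p, (qcoord (lin g b) p).2 = 0.
  move=> bV p; have := stabilizer_act sx bV; rewrite [act _ _]act_lq => /mem_V2_qcoord.
  rewrite !(qcoord_lq a (lin g b)) /qmul a2 /= !mul0r !addr0.
  move=> -[/eqP + /eqP]; rewrite !mulf_eq0 (negbTE a1) /= => /eqP z0 /eqP z1.
  case: p => [[|[|p]] hp] //.
    by have -> : Ordinal hp = 0 by exact: val_inj.
  by have -> : Ordinal hp = 1 by exact: val_inj.
have [h1 h2 h3 h4] := qcoord_qbasis.
have b1V : b1 \in V2 R by apply/mem_V2_qcoord; rewrite h1 h2.
have b2V : b2 \in V2 R by apply/mem_V2_qcoord; rewrite h3 h4.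
move=> p k; rewrite mxE /qconj /=; case: (k == 0).
  by rewrite (key b1 b1V p) oppr0.
by rewrite (key b2 b2V p) oppr0.
Qed.

Lemma stabilizer_V2_U1 a g : (sp1val a).2 = 0 -> stabilizer (V2 R) (cls (a, g)) ->
  K2 R (cls (a, g)).
Proof. by move=> a2 sx; exists (a, g) => //=; split=> //; exact: stabilizer_V2_U2 sx. Qed.

Lemma K2_stabilizer (x : Sp1Sp2 R) : K2 R x -> stabilizer (V2 R) x.
Proof.
move=> [[a g] /= [a2 [A gA A0]] <-]; apply: act_vs_stable => v /mem_V2_qcoord[v0 v1].
rewrite [act _ _]act_lq; apply/mem_V2_qcoord.
have key p : (qcoord (lq a (lin g v)) p).2 = 0.
  rewrite (qcoord_lq a (lin g v)) qcoord_lin; have [-> ->] := quat_rep_qcoord gA p.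
  rewrite /U1 /= in a2; rewrite /qmul /qconj /= a2 v0 v1 !A0; ring.
by split; exact: key.
Qed.

Lemma stabilizerM W (x y : Sp1Sp2 R) : stabilizer W x -> stabilizer W y -> stabilizer W (x * y)%g.
Proof.
move=> sx sy; exact: (etrans (act_vsM x y W) (etrans (congr1 (act_vs x) sy) sx)).
Qed.

Lemma stabilizerV W (x : Sp1Sp2 R) : stabilizer W x -> stabilizer W x^-1%g.
Proof.
move=> sx; exact: (etrans (congr1 (act_vs x^-1%g) (esym sx)) (act_vsK x W)).
Qed.

(** By [stabilizer_V2_axis], [a] lies in U(1) or in U(1) j; dividing by [conj_elt] reduces the
    second case to the first. *)
Lemma stabilizer_V2 : stabilizer (V2 R) = K2 R `|` lcoset (K2 R) (conj_elt R).
Proof.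
apply/seteqP; split=> x; last first.
  case=> [|[k kK <-]]; first exact: K2_stabilizer.
  by apply: stabilizerM; [exact: conj_elt_V2|exact: K2_stabilizer].
have [[a g] ->] := cls_surj x => sx.
have /eqP := stabilizer_V2_axis sx; rewrite mulf_eq0 => /orP[/eqP a1|/eqP a2]; last first.
  by left; exact: stabilizer_V2_U1.
right; pose j := (sp1_j R, (sp2_J R)^-1)%g : Sp1xSp2 R.
pose a' := ((sp1_j R)^-1 * a)%g; pose g' := (((sp2_J R)^-1)^-1 * g)%g.
have E : ((conj_elt R)^-1 * cls (a, g))%g = cls (a', g').
  exact: (etrans (congr1 (fun z => q_mul z (cls (a, g))) (q_invE j)) (q_mulE _ _)).
exists ((conj_elt R)^-1 * cls (a, g))%g; last first.
  exact: (etrans (mulgA _ _ _) (etrans (congr1 (fun z => z * cls (a, g))%g (mulgV _)) (mul1g _))).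
have sy : stabilizer (V2 R) (cls (a', g')).
  exact: (eq_ind _ (stabilizer (V2 R)) (stabilizerM (stabilizerV (conj_elt_V2 R)) sx) _ E).
have a'2 : (sp1val a').2 = 0.
  rewrite /a' /= /qmul /qconj /= a1; move: (sp1val a).2 => [b c].
  by apply/eqP; rewrite eq_complex /=; apply/andP; split; apply/eqP; ring.
exact: (eq_ind_r (K2 R) (stabilizer_V2_U1 a'2 sy) E).
Qed.

End Stabilizers2.

(** * The two orbits as coset spaces *)

(* A unit quaternion a = z + w j is determined modulo U(1) by |z|^2 and z w, i.e.
   by the point a i a^{-1} of S^2.  Sending |z|^2 to (|z|^2 + 3) / 5 > 1/2 and
   keeping the direction of z w moves S^2 injectively into an open hemisphere,
   which contains no two antipodal points. *)
Section Spread.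
Variable R : realType.
Implicit Types (w : R * R).

(** The default direction at 0 is harmless: injectivity is only claimed among vectors of equal
    norm. *)
Definition dir2 w : R * R :=
  if w == 0 then (1, 0) else
  let m := Num.sqrt (w.1 ^+ 2 + w.2 ^+ 2) in (w.1 / m, w.2 / m).

Lemma sumsq_eq0 w : w.1 ^+ 2 + w.2 ^+ 2 = 0 -> w = 0.
Proof.
move=> /eqP; rewrite paddr_eq0 ?sqr_ge0 // !sqrf_eq0 => /andP[/eqP h1 /eqP h2].
by rewrite [w]surjective_pairing h1 h2.
Qed.

Lemma dir2_norm w : (dir2 w).1 ^+ 2 + (dir2 w).2 ^+ 2 = 1.
Proof.
rewrite /dir2; case: eqVneq => [_|w0] /=; first by rewrite expr1n expr0n addr0.
set q := w.1 ^+ 2 + w.2 ^+ 2.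
have q0 : 0 < q.
  rewrite lt0r addr_ge0 ?sqr_ge0 // andbT; apply: contraNneq w0 => h.
  by rewrite (sumsq_eq0 h).
have m0 : Num.sqrt q != 0 by rewrite gt_eqF // sqrtr_gt0.
rewrite !exprMn !exprVn -mulrDl -/q sqr_sqrtr ?ltW //; exact: divff (lt0r_neq0 q0).
Qed.

Lemma dir2_inj w w' : w.1 ^+ 2 + w.2 ^+ 2 = w'.1 ^+ 2 + w'.2 ^+ 2 ->
  dir2 w = dir2 w' -> w = w'.
Proof.
move=> h; have [w0|w0] := eqVneq w 0.
  by move=> _; rewrite w0 [RHS]sumsq_eq0 // -h w0 /= expr0n addr0.
have w'0 : w' != 0.
  by apply: contraNneq w0 => E; rewrite (sumsq_eq0 (w := w)) // h E /= expr0n addr0.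
rewrite /dir2 (negbTE w0) (negbTE w'0) /= h.
set m := Num.sqrt _; have m0 : m != 0.
  rewrite gt_eqF // sqrtr_gt0 lt0r addr_ge0 ?sqr_ge0 // andbT.
  by apply: contraNneq w'0 => E; rewrite (sumsq_eq0 E).
move=> [/(congr1 (fun t => t * m)) E1 /(congr1 (fun t => t * m)) E2].
move: E1 E2; rewrite !divfK // => E1 E2.
by rewrite [w]surjective_pairing [w']surjective_pairing E1 E2.
Qed.

(** The last two equations are the real and imaginary parts of s s' + c c' d conj(d') = 0. Taking
    moduli gives (s s')^2 = (c c')^2, that is s^2 + s'^2 = 1. *)
Lemma unit_prod (s c s' c' : R) (d d' : R * R) :
  d.1 ^+ 2 + d.2 ^+ 2 = 1 -> d'.1 ^+ 2 + d'.2 ^+ 2 = 1 ->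
  s ^+ 2 + c ^+ 2 = 1 -> s' ^+ 2 + c' ^+ 2 = 1 ->
  1 / 2 < s ^+ 2 -> 1 / 2 < s' ^+ 2 ->
  s * s' + c * c' * (d.1 * d'.1 + d.2 * d'.2) = 0 ->
  c * c' * (d.2 * d'.1 - d.1 * d'.2) = 0 -> False.
Proof.
move=> h h' sc sc' s2 s2' E1 E2.
have E : (s * s') ^+ 2 = (c * c') ^+ 2.
  have -> : s * s' = - (c * c' * (d.1 * d'.1 + d.2 * d'.2)) by lra.
  transitivity ((c * c') ^+ 2 * ((d.1 ^+ 2 + d.2 ^+ 2) * (d'.1 ^+ 2 + d'.2 ^+ 2))
    - (c * c' * (d.2 * d'.1 - d.1 * d'.2)) ^+ 2); first by ring.
  by rewrite E2 h h'; ring.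
move: E; rewrite !exprMn; have -> : c ^+ 2 = 1 - s ^+ 2 by lra.
have -> : c' ^+ 2 = 1 - s' ^+ 2 by lra.
by move: (s ^+ 2) (s' ^+ 2) s2 s2' => x y x2 y2; rewrite mulrBl mulrBr; lra.
Qed.

(** Comparing moduli in s c' d' = c s' d gives s c' = c s', which determines first s^2 and then the
    direction. *)
Lemma unit_quot (s c s' c' : R) (d d' : R * R) :
  d.1 ^+ 2 + d.2 ^+ 2 = 1 -> d'.1 ^+ 2 + d'.2 ^+ 2 = 1 ->
  s ^+ 2 + c ^+ 2 = 1 -> s' ^+ 2 + c' ^+ 2 = 1 -> 0 < s -> 0 < s' -> 0 < c -> 0 < c' ->
  s * c' * d'.1 = c * s' * d.1 -> s * c' * d'.2 = c * s' * d.2 ->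
  s ^+ 2 = s' ^+ 2 /\ d = d'.
Proof.
move=> h h' sc sc' s0 s0' c0 c0' E1 E2.
have E : (s * c') ^+ 2 = (c * s') ^+ 2.
  transitivity ((s * c' * d'.1) ^+ 2 + (s * c' * d'.2) ^+ 2).
    by rewrite -[LHS]mulr1 -h'; ring.
  by rewrite E1 E2 -[RHS]mulr1 -h; ring.
have F : s * c' = c * s'.
  by apply/eqP; rewrite -(eqrXn2 (n := 2)) ?E // ltW // mulr_gt0.
have p0 : c * s' != 0 by rewrite gt_eqF // mulr_gt0.
split.
  move: E; rewrite !exprMn; have -> : c ^+ 2 = 1 - s ^+ 2 by lra.
  have -> : c' ^+ 2 = 1 - s' ^+ 2 by lra.
  by move: (s ^+ 2) (s' ^+ 2) => x y; rewrite mulrBl mulrBr; lra.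
rewrite F in E1 E2.
by rewrite [d]surjective_pairing [d']surjective_pairing (mulfI p0 E1) (mulfI p0 E2).
Qed.

Definition spread_quat (a : Sp1 R) : quat R :=
  let z := (sp1val a).1 in let w := (sp1val a).2 in
  let t := (complex.Re z ^+ 2 + complex.Im z ^+ 2 + 3) / 5 in
  let d := dir2 (complex.Re (z * w), complex.Im (z * w)) in
  ((Num.sqrt t +i* 0)%C, (Num.sqrt (1 - t) * d.1 +i* (Num.sqrt (1 - t) * d.2))%C).

Lemma spread_bounds (a : Sp1 R) :
  let z := (sp1val a).1 in
  let t := (complex.Re z ^+ 2 + complex.Im z ^+ 2 + 3) / 5 in 1 / 2 < t /\ 0 < 1 - t.
Proof.
have [a0 [a1 [a2 [a3 [-> h]]]]] := sp1_real a; rewrite /=.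
move: h (sqr_ge0 a0) (sqr_ge0 a1) (sqr_ge0 a2) (sqr_ge0 a3).
by move: (a0 ^+ 2) (a1 ^+ 2) (a2 ^+ 2) (a3 ^+ 2) => b0 b1 b2 b3 *; split; lra.
Qed.

Lemma spread_subproof (a : Sp1 R) : qnorm2 (spread_quat a) == 1.
Proof.
have [t1 t2] := spread_bounds a; rewrite /spread_quat.
set t := (_ + 3) / 5 in t1 t2 *; set d := dir2 _.
rewrite qnorm2_real; apply/eqP; congr (_%:C)%C.
have -> : 0 ^+ 2 = 0 :> R by rewrite expr0n.
rewrite !exprMn !sqr_sqrtr ?ltW //; last by lra.
transitivity (t + (1 - t) * (d.1 ^+ 2 + d.2 ^+ 2)); first by ring.
by rewrite dir2_norm; ring.
Qed.

Definition spread (a : Sp1 R) : Sp1 R := MkSp1 (spread_subproof a).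

(** The hypothesis is what [stabilizer_V2_axis] provides for the quotient of the spread quaternions.
    Vanishing of the first factor would mean antipodal points, excluded by [unit_prod]; vanishing of
    the second gives equal points by [unit_quot]. *)
Lemma spread_inj (a b : Sp1 R) :
  let c := qmul (qconj (spread a)) (spread b) in
  c.1 * c.2 = 0 -> c.2 = 0 /\ (qmul (qconj a) b).2 = 0.
Proof.
have [s1 s2] := spread_bounds a; have [s1' s2'] := spread_bounds b.
have [a0 [a1 [a2 [a3 [Ea ha]]]]] := sp1_real a.
have [e0 [e1 [e2 [e3 [Eb hb]]]]] := sp1_real b.
rewrite Ea /= in s1 s2; rewrite Eb /= in s1' s2'.
set ta := (_ + 3) / 5 in s1 s2; set tb := (_ + 3) / 5 in s1' s2'.
pose wa := (a0 * a2 - a1 * a3, a0 * a3 + a1 * a2); pose wb := (e0 * e2 - e1 * e3, e0 * e3 + e1 * e2).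
have Sa : spread_quat a = ((Num.sqrt ta +i* 0)%C,
    (Num.sqrt (1 - ta) * (dir2 wa).1 +i* (Num.sqrt (1 - ta) * (dir2 wa).2))%C).
  by rewrite /spread_quat Ea.
have Sb : spread_quat b = ((Num.sqrt tb +i* 0)%C,
    (Num.sqrt (1 - tb) * (dir2 wb).1 +i* (Num.sqrt (1 - tb) * (dir2 wb).2))%C).
  by rewrite /spread_quat Eb.
have qconj_real (x0 x1 x2 x3 : R) : qconj ((x0 +i* x1)%C, (x2 +i* x3)%C) =
    ((x0 +i* - x1)%C, (- x2 +i* - x3)%C) by [].
rewrite -[sp1val (spread a)]/(spread_quat a) -[sp1val (spread b)]/(spread_quat b).
rewrite Sa Sb Ea Eb !qconj_real !qmul_real {Sa Sb Ea Eb}.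
have na := dir2_norm wa; have nb := dir2_norm wb.
have inj := @dir2_inj wa wb.
move: (dir2 wa) (dir2 wb) na nb inj => d d' na nb inj.
have pa : 0 < ta by lra.
have pb : 0 < tb by lra.
have qa := sqr_sqrtr (ltW pa); have qb := sqr_sqrtr (ltW pb).
have ra := sqr_sqrtr (ltW s2); have rb := sqr_sqrtr (ltW s2').
have sa0 : 0 < Num.sqrt ta by rewrite sqrtr_gt0.
have sb0 : 0 < Num.sqrt tb by rewrite sqrtr_gt0.
have ca0 : 0 < Num.sqrt (1 - ta) by rewrite sqrtr_gt0.
have cb0 : 0 < Num.sqrt (1 - tb) by rewrite sqrtr_gt0.
move: (Num.sqrt ta) (Num.sqrt tb) (Num.sqrt (1 - ta)) (Num.sqrt (1 - tb)) qa qb ra rb sa0 sb0 ca0 cb0.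
move=> sa sb ca cb qa qb ra rb sa0 sb0 ca0 cb0.
have oa : sa ^+ 2 + ca ^+ 2 = 1 by lra.
have ob : sb ^+ 2 + cb ^+ 2 = 1 by lra.
rewrite /=.
move=> /eqP; rewrite mulf_eq0 => /orP[].
  rewrite eq_complex /= => /andP[/eqP h1 /eqP h2]; exfalso.
  apply: (unit_prod na nb oa ob).
  - by rewrite qa.
  - by rewrite qb.
  - by rewrite -[RHS]h1; ring.
  - by rewrite -[RHS]h2; ring.
move=> c20; split; first exact/eqP.
move: c20; rewrite eq_complex /= => /andP[/eqP h1 /eqP h2].
have [|| st dd] := unit_quot na nb oa ob sa0 sb0 ca0 cb0.
- by apply/eqP; rewrite -subr_eq0; apply/eqP; rewrite -[RHS]h1; ring.
- by apply/eqP; rewrite -subr_eq0; apply/eqP; rewrite -[RHS]h2; ring.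
have tt : a0 ^+ 2 + a1 ^+ 2 = e0 ^+ 2 + e1 ^+ 2.
  by move: st; rewrite qa qb /ta /tb; lra.
have /inj /(_ dd)[w1 w2] : wa.1 ^+ 2 + wa.2 ^+ 2 = wb.1 ^+ 2 + wb.2 ^+ 2.
  rewrite /=; transitivity ((a0 ^+ 2 + a1 ^+ 2) * (a2 ^+ 2 + a3 ^+ 2)); first by ring.
  have -> : a2 ^+ 2 + a3 ^+ 2 = e2 ^+ 2 + e3 ^+ 2 by lra.
  by rewrite tt; ring.
set X := (X in (X +i* _)%C); set Y := (Y in (_ +i* Y)%C).
have [z0|z0] := eqVneq (e0 ^+ 2 + e1 ^+ 2) 0.
  have := sumsq_eq0 (w := (a0, a1)); rewrite /= tt z0 => /(_ erefl)[y0 y1].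
  have := sumsq_eq0 (w := (e0, e1)); rewrite /= z0 => /(_ erefl)[y2 y3].
  by apply/eqP; rewrite eq_complex /= /X /Y y0 y1 y2 y3; apply/andP; split; apply/eqP; ring.
(* [X] and [Y] are the parts of conj(z_a) w_b - w_a conj(z_b); multiplied by z_b this vanishes
   because z_a w_a = z_b w_b and |z_a| = |z_b|. *)
have K1 : e0 * X - e1 * Y = 0.
  transitivity (a0 * (e0 * e2 - e1 * e3) + a1 * (e0 * e3 + e1 * e2) - (e0 ^+ 2 + e1 ^+ 2) * a2).
    by rewrite /X /Y; ring.
  by rewrite -w1 -w2 -tt; ring.
have K2 : e0 * Y + e1 * X = 0.
  transitivity (a0 * (e0 * e3 + e1 * e2) - a1 * (e0 * e2 - e1 * e3) - (e0 ^+ 2 + e1 ^+ 2) * a3).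
    by rewrite /X /Y; ring.
  by rewrite -w1 -w2 -tt; ring.
have X0 : (e0 ^+ 2 + e1 ^+ 2) * X = 0.
  by transitivity (e0 * (e0 * X - e1 * Y) + e1 * (e0 * Y + e1 * X)); [ring|rewrite K1 K2; ring].
have Y0 : (e0 ^+ 2 + e1 ^+ 2) * Y = 0.
  by transitivity (e0 * (e0 * Y + e1 * X) - e1 * (e0 * X - e1 * Y)); [ring|rewrite K1 K2; ring].
move/eqP: X0; rewrite mulf_eq0 (negbTE z0) /= => /eqP->.
by move/eqP: Y0; rewrite mulf_eq0 (negbTE z0) /= => /eqP->.
Qed.

End Spread.

Lemma inj_card_le_sub (T U : Type) (A : set T) (B : set U) (f : T -> U) :
  (forall x, A x -> B (f x)) -> set_inj A f -> (A #<= B)%card.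
Proof.
move=> fAB fi; have [k] := iffRL injfunPex (ex_intro2 _ _ f fAB fi); exact: inj_card_le.
Qed.

Section CosetSpaces.
Variable R : realType.
Local Notation G := (Sp1Sp2 R).
Local Notation R8 := 'rV[R]_8.
Implicit Types (x y : G) (K : set G) (W : {vspace R8}).

Definition subgroup_set K := [/\ K 1%g, forall x y, K x -> K y -> K (x * y)%g
  & forall x, K x -> K x^-1%g].

Lemma lcosetP K x y : subgroup_set K -> lcoset K x = lcoset K y <-> K (x^-1 * y)%g.
Proof.
move=> [K0 KM KV]; split=> [E|Kxy].
  have : lcoset K x y by rewrite E; exists 1%g => //; exact: mulg1.
  by case=> k Kk <-; rewrite mulgA mulVg mul1g.
have sub u v : K (u^-1 * v)%g -> lcoset K u `<=` lcoset K v.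
  move=> Kuv _ [k Kk <-]; exists ((u^-1 * v)^-1 * k)%g; first by apply: KM => //; exact: KV.
  by rewrite invgM invgK !mulgA mulgV mul1g.
apply/seteqP; split; apply: sub => //.
by have := KV _ Kxy; rewrite invgM invgK.
Qed.

Lemma stabilizer_subgroup W : subgroup_set (stabilizer W).
Proof.
split; first exact: act_vs1.
  by move=> x y; exact: stabilizerM.
by move=> x; exact: stabilizerV.
Qed.

Lemma act_vs_eq W x y : act_vs x W = act_vs y W <-> stabilizer W (x^-1 * y)%g.
Proof.
split=> [E|E].
  exact: (etrans (act_vsM x^-1%g y W) (etrans (congr1 (act_vs x^-1%g) (esym E)) (act_vsK x W))).
have := congr1 (act_vs x) (E : act_vs (x^-1 * y)%g W = W); rewrite -act_vsM => <-.
by rewrite mulgA mulgV mul1g.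
Qed.

Lemma cls_div (p q : Sp1xSp2 R) : ((cls p)^-1 * cls q)%g = cls (p^-1 * q)%g.
Proof. exact: (etrans (congr1 (fun z => q_mul z (cls q)) (q_invE p)) (q_mulE _ _)). Qed.

(** A class has two representatives differing by a common sign, which does not affect the vanishing
    of the second component of [a]. *)
Lemma K2P (a : Sp1 R) (g : Sp2 R) :
  K2 R (cls (a, g)) <-> (sp1val a).2 = 0 /\ stabilizer (V2 R) (cls (a, g)).
Proof.
split=> [h|[a2 s]]; last exact: stabilizer_V2_U1.
split; last exact: K2_stabilizer.
case: h => -[b h] /= [b2 _] /eqP/cls_eqP[] /(congr1 (fun p : Sp1xSp2 R => sp1val p.1)) E.
  by rewrite -[RHS](b2 : (sp1val b).2 = 0) (E : sp1val b = sp1val a).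
have {}E : sp1val b = qmul (sp1val a) (((-1) +i* (- 0))%C, (0 +i* 0)%C) by exact: E.
have [a0 [a1 [a2 [a3 F]]]] := quat_real (sp1val a).
have := congr1 snd E; rewrite (b2 : (sp1val b).2 = 0) F qmul_real /= => /eqP.
rewrite eq_sym eq_complex /= => /andP[/eqP h1 /eqP h2].
by apply/eqP; rewrite eq_complex /=; apply/andP; split; apply/eqP; lra.
Qed.

Lemma K2_subgroup : subgroup_set (K2 R).
Proof.
have [S1 SM SV] := stabilizer_subgroup (V2 R); split.
- by apply/(K2P 1%g 1%g); split.
- move=> x y; have [[a g] ->] := cls_surj x; have [[b h] ->] := cls_surj y.
  move=> /K2P[a2 sa] /K2P[b2 sb].
  have E : (cls (a, g) * cls (b, h))%g = cls (a * b, g * h)%g by exact: q_mulE.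
  have s := SM _ _ sa sb; rewrite E in s *; apply/K2P; split=> //.
  by rewrite /= a2 b2 mulr0 mul0r addr0.
- move=> x; have [[a g] ->] := cls_surj x; move=> /K2P[a2 sa].
  have E : ((cls (a, g))^-1)%g = cls (a^-1, g^-1)%g by exact: q_invE.
  have s := SV _ sa; rewrite E in s *; apply/K2P; split=> //.
  by rewrite /= a2 oppr0.
Qed.

(** It need not be constant on cosets: it will be evaluated at one chosen element of each coset, and
    only [spread_plane_inj] matters. *)
Definition spread_plane x : {vspace R8} :=
  act_vs (cls (spread (repr x).1, (repr x).2)) (V2 R).

Lemma spread_plane_inj x y : spread_plane x = spread_plane y -> K2 R (x^-1 * y)%g.
Proof.
have xE : x = cls (repr x) by rewrite /cls reprK.
have yE : y = cls (repr y) by rewrite /cls reprK.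
rewrite /spread_plane; move: (repr x) (repr y) xE yE => [a g] [b h] /= xE yE.
move=> /act_vs_eq sz.
have E1 := cls_div (spread a, g) (spread b, h).
have {}sz : stabilizer (V2 R) (cls ((spread a)^-1 * spread b, g^-1 * h)%g).
  exact: (eq_ind _ (stabilizer (V2 R)) sz _ E1).
have [c2 ab2] := spread_inj (stabilizer_V2_axis sz).
have gU := @stabilizer_V2_U2 R ((spread a)^-1 * spread b)%g (g^-1 * h)%g c2 sz.
have E2 : (x^-1 * y)%g = cls (a^-1 * b, g^-1 * h)%g by rewrite xE yE; exact: cls_div.
by rewrite E2; exists (a^-1 * b, g^-1 * h)%g.
Qed.

(** Cosets inject into planes by [spread_plane] at a chosen element. Planes inject into cosets by a
    chosen group element, since [K2] is contained in the stabilizer. *)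
Lemma card_coset_orbit : (coset_space (K2 R) #= plane_orbit (V2 R))%card.
Proof.
apply: Cantor_Bernstein.
  pose ch C : G := xget 1%g [set x | lcoset (K2 R) x = C].
  have chP C : coset_space (K2 R) C -> lcoset (K2 R) (ch C) = C.
    by move=> [x _ xC]; exact: (xgetI 1%g (P := [set x | lcoset (K2 R) x = C]) xC).
  apply: (inj_card_le_sub (f := fun C => spread_plane (ch C))).
    by move=> C _; exists (cls (spread (repr (ch C)).1, (repr (ch C)).2)).
  move=> C C'; rewrite !inE => CK C'K /spread_plane_inj h.
  by rewrite -(chP C CK) -(chP C' C'K); exact/(lcosetP _ _ K2_subgroup).
pose ch W : G := xget 1%g [set x | act_vs x (V2 R) = W].
have chP W : plane_orbit (V2 R) W -> act_vs (ch W) (V2 R) = W.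
  by move=> [x _ xW]; exact: (xgetI 1%g (P := [set x | act_vs x (V2 R) = W]) xW).
apply: (inj_card_le_sub (f := fun W => lcoset (K2 R) (ch W))).
  by move=> W _; exists (ch W).
move=> W W'; rewrite !inE => WO W'O /(lcosetP _ _ K2_subgroup)/K2_stabilizer h.
by rewrite -(chP W WO) -(chP W' W'O); exact/act_vs_eq.
Qed.

(** A quaternionic line contains e and j e with B(e, j e) = j, whereas [B] takes values in R i on
    [V2]. *)
Lemma V1_V2_orbits_disjoint x y : act_vs x (V1 R) <> act_vs y (V2 R).
Proof.
move=> E; have {}E : act_vs (y^-1 * x)%g (V1 R) = V2 R.
  exact: (etrans (act_vsM y^-1%g x (V1 R)) (etrans (congr1 (act_vs y^-1%g) E) (act_vsK y (V2 R)))).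
have [e [e1 We]] := act_V1_line (y^-1 * x)%g; rewrite E in We.
have eV : e \in V2 R.
  by apply/We; exists 1, 0; rewrite (im0l e); exact: esym (etrans (addr0 _) (scale1r _)).
have fV : im (0, 1, 0) e \in V2 R.
  by apply/We; exists 0, (0, 1, 0); exact: esym (etrans (congr1 (+%R^~ _) (scale0r _)) (add0r _)).
have [+ _] := V2_Bform eV fV; rewrite (qf_B_im_self (R8_qform R) (0, 1, 0) e1) /= => /eqP.
by rewrite oner_eq0.
Qed.

Lemma assoc_planes_V1 x : assoc_planes R (act_vs x (V1 R)).
Proof.
have dW : \dim (act_vs x (V1 R)) = 4%N by rewrite dim_act_vs dim_V1.
split=> //; have [e le] := act_V1_line x; exact: (quaternionic_line_associative3 dW le).
Qed.

Lemma assoc_planes_V2 x : assoc_planes R (act_vs x (V2 R)).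
Proof.
have dW : \dim (act_vs x (V2 R)) = 4%N by rewrite dim_act_vs dim_V2.
split=> //; have [[a g] E] := cls_surj x; rewrite E in dW *.
exact: (complex_plane_associative3 dW (act_V2_plane a g)).
Qed.

Lemma assoc_planes_orbits W : \dim W = 4%N -> associative3 (great_sphere W) ->
  exists x, W = act_vs x (V1 R) \/ W = act_vs x (V2 R).
Proof.
move=> dW /(associative3_cases dW)[[e /line_orbit[x E]]|[n [e [f /plane_orbitP[x E]]]]].
  by exists x; left.
by exists x; right.
Qed.

End CosetSpaces.

Theorem theorem1p1 (R : realType) :
  [/\ (* up to the action, an associative 4-plane is V1 or V2 *)
      forall V : {vspace 'rV[R]_8},
        \dim V = 4%N -> associative3 (great_sphere V) ->
        exists x : Sp1Sp2 R, V = act_vs x (V1 R) \/ V = act_vs x (V2 R),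
      (* M = Sp(1)Sp(2)/K1 + Sp(1)Sp(2)/K2 (disjoint union); the identification
         is x K1 |-> x V1 on the first summand, and it maps the second summand
         onto the orbit of V2 (it cannot be equivariant there: see the last
         clause) *)
      exists f : set (Sp1Sp2 R) + set (Sp1Sp2 R) -> {vspace 'rV[R]_8},
        [/\ set_bij (inl @` coset_space (K1 R) `|` inr @` coset_space (K2 R))
                    (assoc_planes R) f,
            forall x, f (inl (lcoset (K1 R) x)) = act_vs x (V1 R)
          & (f \o inr) @` coset_space (K2 R) = plane_orbit (V2 R)],
      (* the stabilizers of V1 and V2 *)
      stabilizer (V1 R) = K1 R
    & stabilizer (V2 R) = K2 R `|` lcoset (K2 R) (conj_elt R)].
Proof.
split; [exact: assoc_planes_orbits| |exact: stabilizer_V1|exact: stabilizer_V2].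
(* Extracting a bijection from equality of cardinals takes a pointed target; the zero subspace is
   the point. *)
have @U : pointedType := HB.pack {vspace 'rV[R]_8} (isPointed.Build {vspace 'rV[R]_8} 0%VS).
have [h [hf hi hs]] : exists h : set (Sp1Sp2 R) -> {vspace 'rV[R]_8},
    set_bij (coset_space (K2 R)) (plane_orbit (V2 R)) h.
  exact: (elimT (@card_set_bijP _ U _ _) (card_coset_orbit R)).
pose ch C : Sp1Sp2 R := xget 1%g [set x | lcoset (K1 R) x = C].
pose f (C : set (Sp1Sp2 R) + set (Sp1Sp2 R)) :=
  match C with inl C => act_vs (ch C) (V1 R) | inr C => h C end.
have K1G : subgroup_set (K1 R) by rewrite -stabilizer_V1; exact: stabilizer_subgroup.
(* The chosen element of the coset gives the same plane as [x], because [K1] is the full stabilizer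
   of [V1]. *)
have fE x : f (inl (lcoset (K1 R) x)) = act_vs x (V1 R).
  have chx : lcoset (K1 R) (ch (lcoset (K1 R) x)) = lcoset (K1 R) x.
    exact: (xgetI 1%g (P := [set y | lcoset (K1 R) y = lcoset (K1 R) x]) erefl).
  by apply/act_vs_eq; rewrite stabilizer_V1; exact/(lcosetP _ _ K1G).
have hE C : coset_space (K2 R) C -> exists y, h C = act_vs y (V2 R).
  by move=> /hf[y _ <-]; exists y.
exists f; split=> //; last first.
  by apply/seteqP; split=> [_ [C CK <-]|W /hs[C CK <-]]; [exact: hf|exists C].
split.
- move=> _ [[C [x _ <-] <-]|[C CK <-]]; first by rewrite fE; exact: assoc_planes_V1.
  by have [y E] := hE C CK; rewrite /f E; exact: assoc_planes_V2.
- move=> _ _ /set_mem[[_ [x _ <-] <-]|[C CK <-]] /set_mem[[_ [y _ <-] <-]|[C' CK' <-]].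
  + rewrite !fE => /act_vs_eq; rewrite stabilizer_V1 => Kxy; congr inl.
    exact/(lcosetP _ _ K1G).
  + by rewrite fE /f; have [z ->] := hE C' CK' => /V1_V2_orbits_disjoint.
  + by rewrite fE /f; have [z ->] := hE C CK => /esym/V1_V2_orbits_disjoint.
  + by move=> E; congr inr; apply: hi E; exact: mem_set.
- move=> W [dW /(assoc_planes_orbits dW)[x [->|E]]].
    by exists (inl (lcoset (K1 R) x)); [left; exists (lcoset (K1 R) x) => //; exists x|exact: fE].
  have [|C CK CE] := hs W; first by exists x.
  by exists (inr C); [right; exists C|].
Qed.
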